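(* Let $0<\alpha<n$, $1\le p<n/\alpha$, $1/q=1/p-\alpha/n$, with $1\le s<p$ if $1<p<n/\alpha$ and $s=1$ if $p=1$. Let $w_1,w_2$ be weights on $\mathbb{R}^n$ with $(w_1^s,w_2^s)\in A_{p/s,q/s}$ and $w_2^s\in A_{p/s,q/s}$. Let $L$ be a linear operator on $L^2(\mathbb{R}^n)$ generating an analytic semigroup $\exp(-tL)$ whose kernel $p_t(x,y)$ satisfies $|p_t(x,y)|\le C t^{-n/2}\exp\left(-c\frac{|x-y|^2}t\right)$ for $x,y\in\mathbb{R}^n$, $t>0$, and let $L^{-\alpha/2}(f)(x)=\frac1{\Gamma(\alpha/2)}\int_0^\infty\exp(-tL)(f)(x)\frac{dt}{t^{-\alpha/2+1}}$. Let $\psi_1,\psi_2$ be positive functions on $\mathbb{R}^n\times\mathbb{R}^+$. (1) Suppose $$\sup_{(a,r)\in\mathbb{R}^n\times\mathbb{R}^+}\frac1{\psi_2(a,r)}\int_r^\infty\frac{\inf_{t\le l<\infty}\psi_1(a,l)\,w_1^p(B(a,l))^{1/p}}{w_2^q(B(a,t))^{1/q}}\frac{dt}t<\infty .$$ If $1<p<n/\alpha$ and $L^{-\alpha/2}$ is bounded from $L^{p,w_1^p}$ to $L^{q,w_2^q}$, then $L^{-\alpha/2}$ is bounded from $\mathcal{M}^{p,w_1^p}_{\psi_1}$ to $\mathcal{M}^{q,w_2^q}_{\psi_2}$; if $p=1$ and $L^{-\alpha/2}$ is bounded from $L^{1,w_1}$ to $WL^{q,w_2^q}$, then $L^{-\alpha/2}$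 is bounded from $\mathcal{M}^{1,w_1}_{\psi_1}$ to $W\mathcal{M}^{q,w_2^q}_{\psi_2}$. (2) Suppose $1<p<n/\alpha$, $w_1\in A_\infty$ and $$\sup_{(a,r)\in\mathbb{R}^n\times\mathbb{R}^+}\frac1{\psi_2(a,r)}\int_r^\infty\left(1+\ln\frac tr\right)\frac{\inf_{t\le l<\infty}\psi_1(a,l)\,w_1^p(B(a,l))^{1/p}}{w_2^q(B(a,t))^{1/q}}\frac{dt}t<\infty .$$ If $b\in BMO$ and $[b,L^{-\alpha/2}]$ is bounded from $L^{p,w_1^p}$ to $L^{q,w_2^q}$, then $[b,L^{-\alpha/2}]$ is bounded from $\mathcal{M}^{p,w_1^p}_{\psi_1}$ to $\mathcal{M}^{q,w_2^q}_{\psi_2}$.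
   Context: Notation: $\mathbb{R}^+=(0,\infty)$; $B(a,r)$ is the open ball in $\mathbb{R}^n$. A weight is a nonnegative locally integrable function on $\mathbb{R}^n$ with values in $(0,\infty)$ a.e.; $w(E)=\int_E w(x)\,dx$ and $w^p(E)=\int_E w(x)^p\,dx$. Weight classes: for $1<p<q<\infty$ and $1/p+1/p'=1$, $(w_1,w_2)\in A_{p,q}$ if there is $C>0$ with $\left(\frac1{|B|}\int_B w_2^q\right)^{1/q}\left(\frac1{|B|}\int_B w_1^{-p'}\right)^{1/p'}\le C$ for all balls $B$; for $p=1<q$, $(w_1,w_2)\in A_{1,q}$ if $\left(\frac1{|B|}\int_B w_2^q\right)^{1/q}\|w_1^{-1}\|_{L^\infty(B)}\le C$ for all balls $B$; $w\in A_{p,q}$ means $(w,w)\in A_{p,q}$. $A_\infty=\bigcup_{p\ge1}A_p$ with $A_p$ the usual Muckenhoupt classes. Spaces: $\|f\|_{L^{p,w}(E)}=\left(\int_E|f|^pw\right)^{1/p}$ and $\|f\|_{WL^{p,w}(E)}=\sup_{\gamma>0}\gamma\,w(\{x\in E:|f(x)|>\gamma\})^{1/p}$; $L^{p,w}$, $WL^{p,w}$ denote the case $E=\mathbb{R}^n$. For positive $\psi$ on $\mathbb{R}^n\times\mathbb{R}^+$, $\mathcal{M}^{p,w}_\psi$ and $W\mathcal{M}^{p,w}_\psi$ consist of the measurable $f$ for which respectively $\|f\|_{\mathcal{M}^{p,w}_\psi}=\sup_{a,r}\frac{1}{\psi(a,r)}w(B(a,r))^{-1/p}\|f\|_{L^{p,w}(B(a,r))}$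 and $\|f\|_{W\mathcal{M}^{p,w}_\psi}=\sup_{a,r}\frac{1}{\psi(a,r)}w(B(a,r))^{-1/p}\|f\|_{WL^{p,w}(B(a,r))}$ is finite. $[b,N](f)=bN(f)-N(bf)$; $BMO$ has seminorm $\|b\|_*=\sup_B\frac1{|B|}\int_B|b-b_B|$, $b_B=\frac1{|B|}\int_Bb$. An operator $N$ is bounded from $X$ to $Y$ if $\|Nf\|_Y\le C\|f\|_X$ for all $f\in X$; for a commutator $[b,N]$ the constant is required to have the form $C\|b\|_*$. *)

(* Defs.v *)
From HB Require Import structures.
From mathcomp Require Import all_boot all_order all_algebra.
From mathcomp Require Import all_classical all_reals all_analysis.
From mathcomp Require Import complex.

Set Implicit Arguments.
Unset Strict Implicit.
Unset Printing Implicit Defensive.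
Import Order.TTheory GRing.Theory Num.Theory.
Import numFieldNormedType.Exports.

Local Open Scope classical_set_scope.
Local Open Scope ring_scope.
Local Open Scope complex_scope.

(* The sigma-algebra of a tuple type is the product one, so measurable means
   Borel measurable throughout this file. *)
Notation Rn R n := (n.-tuple (measurableTypeR R)).

Section cons_measure.
Context (R : realType) (n : nat).
Variables (m1 : {sigma_finite_measure set (measurableTypeR R) -> \bar R})
  (m2 : {sigma_finite_measure set (Rn R n) -> \bar R}).
Local Open Scope ereal_scope.

Definition tcons (x : measurableTypeR R * Rn R n) : Rn R n.+1 :=
  [the n.+1.-tuple (measurableTypeR R) of x.1 :: x.2].

Definition tuncons (x : Rn R n.+1) : measurableTypeR R * Rn R n :=
  (tnth x ord0, [tuple of behead x]).

Lemma tunconsK : cancel tuncons tcons.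
Proof. by move=> x; rewrite [RHS](tuple_eta x). Qed.

Lemma tconsK : cancel tcons tuncons.
Proof.
by move=> [x t]; rewrite /tuncons/tcons/=; congr (_, _); exact/val_inj.
Qed.

Lemma measurable_tcons : measurable_fun [set: measurableTypeR R * Rn R n] tcons.
Proof. exact: measurable_cons. Qed.

Lemma measurable_tuncons : measurable_fun [set: Rn R n.+1] tuncons.
Proof.
by apply: measurable_fun_pair; [exact: measurable_tnth|exact: measurable_behead].
Qed.

Definition cons_measure : set (Rn R n.+1) -> \bar R :=
  pushforward (m1 \x m2) tcons.

Let mtcons (A : set (Rn R n.+1)) : measurable A -> measurable (tcons @^-1` A).
Proof.
by move=> mA; rewrite -[X in measurable X]setTI; exact: measurable_tcons.
Qed.

Let cons_measure0 : cons_measure set0 = 0.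
Proof. by rewrite /cons_measure /pushforward preimage_set0 measure0. Qed.

Let cons_measure_ge0 A : 0 <= cons_measure A.
Proof. by rewrite /cons_measure /pushforward measure_ge0. Qed.

Let cons_measure_sigma_additive : semi_sigma_additive cons_measure.
Proof.
move=> F mF tF mUF; rewrite /cons_measure /pushforward preimage_bigcup.
apply: measure_semi_sigma_additive.
- by move=> i; exact: mtcons.
- apply/trivIsetP => /= i j _ _ ij; rewrite -preimage_setI.
  by move/trivIsetP : tF => /(_ _ _ _ _ ij) ->//; rewrite preimage_set0.
- by rewrite -preimage_bigcup; exact: mtcons.
Qed.

HB.instance Definition _ := isMeasure.Build _ _ _ cons_measure
  cons_measure0 cons_measure_ge0 cons_measure_sigma_additive.

(* m1 \x m2 has no canonical sigma-finite structure: the instance declared on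
   products of subprobabilities takes precedence. *)
Let cons_measure_sigma_finite : sigma_finite setT cons_measure.
Proof.
have /sigma_finiteP[F [TF ndF Foo]] := sigma_finiteT m1.
have /sigma_finiteP[G [TG ndG Goo]] := sigma_finiteT m2.
exists (fun i => tuncons @^-1` (F i `*` G i)).
  rewrite -preimage_bigcup -[LHS](preimage_setT tuncons); congr (_ @^-1` _).
  rewrite -setXTT TF TG predeqE => -[x y]; split.
    move=> [/= [i _ Fix] [j _ Gjy]]; exists (maxn i j) => //; split.
    - by move: x Fix; exact/subsetPset/ndF/leq_maxl.
    - by move: y Gjy; exact/subsetPset/ndG/leq_maxr.
  by move=> [i _ []/= ? ?]; split; exists i.
move=> i; have [? ?] := Foo i; have [? ?] := Goo i; split.
  rewrite -[X in measurable X]setTI; apply: measurable_tuncons => //.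
  exact: measurableX.
rewrite /cons_measure /pushforward -comp_preimage.
have -> : tuncons \o tcons = id by apply/funext => x /=; rewrite tconsK.
by rewrite preimage_id product_measure1E// lte_mul_pinfty// ge0_fin_numE.
Qed.

HB.instance Definition _ := Measure_isSigmaFinite.Build _ _ _ cons_measure
  cons_measure_sigma_finite.

End cons_measure.

Definition point_measure (R : realType) : set (Rn R 0) -> \bar R :=
  dirac [tuple].

Section point_measure.
Variable R : realType.
Local Open Scope ereal_scope.

HB.instance Definition _ := Measure.on (@point_measure R).

Let point_measure_sigma_finite : sigma_finite setT (@point_measure R).
Proof.
exists (fun=> setT); first by rewrite bigcup_const.
by move=> i; split => //; rewrite /point_measure diracE in_setT ltry.
Qed.

HB.instance Definition _ := Measure_isSigmaFinite.Build _ _ _ (@point_measure R)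
  point_measure_sigma_finite.

End point_measure.

Fixpoint leb (R : realType) (n : nat) :
    {sigma_finite_measure set (Rn R n) -> \bar R} :=
  match n with
  | 0 => @point_measure R
  | m.+1 => cons_measure (@lebesgue_measure R) (leb R m)
  end.

Section analysis_on_Rn.
Context (R : realType) (n : nat).
Local Notation Rn := (Rn R n).
Local Notation C := R[i].
Local Notation Re := (@complex.Re R).
Local Notation Im := (@complex.Im R).
Local Notation normc := (@Normc.normc R).
Local Notation mu := (leb R n).
Local Notation leb1 := (@lebesgue_measure R).
Implicit Types (f g b : Rn -> C) (w : Rn -> R) (E : set Rn) (a x y : Rn).

Definition edist x y : R := Num.sqrt (\sum_(i < n) (tnth x i - tnth y i) ^+ 2).

Definition eball a (r : R) : set Rn := [set x | edist x a < r].

Definition cmeasurable d (T : measurableType d) (D : set T) (f : T -> C) :=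
  measurable_fun D (Re \o f) /\ measurable_fun D (Im \o f).

Definition cintegrable d (T : measurableType d)
    (m : {measure set T -> \bar R}) (D : set T) (f : T -> C) :=
  m.-integrable D (EFin \o Re \o f) /\
  m.-integrable D (EFin \o Im \o f).

Definition cintegral d (T : measurableType d)
    (m : {measure set T -> \bar R}) (D : set T) (f : T -> C) : C :=
  (\int[m]_(x in D) Re (f x)) +i* (\int[m]_(x in D) Im (f x)).

Definition weight w :=
  [/\ measurable_fun setT w, forall x, 0 <= w x,
      {ae mu, forall x, 0 < w x} &
      forall a r, 0 < r -> mu.-integrable (eball a r) (EFin \o w)].

Definition wpow w (s : R) : Rn -> R := fun x => w x `^ s.

Definition wmeas w E : \bar R := (\int[mu]_(x in E) (w x)%:E)%E.

Definition avg (g : Rn -> R) a r : \bar R :=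
  ((mu (eball a r))^-1 * \int[mu]_(x in eball a r) (g x)%:E)%E.

Definition norm_inf (g : Rn -> R) E : \bar R :=
  'N[mu]_(+oo)[(EFin \o g) \_ E]%E.

Definition conj_exp (p : R) : R := (1 - p^-1)^-1.

Definition A_pq (p q : R) (w1 w2 : Rn -> R) :=
  exists2 K : R, 0 < K & forall a r, 0 < r ->
    (avg (wpow w2 q) a r `^ q^-1 *
     (if p == 1%R then norm_inf (wpow w1 (-1)) (eball a r)
      else avg (wpow w1 (- conj_exp p)) a r `^ (conj_exp p)^-1) <= K%:E)%E.

Definition A_p (p : R) w :=
  exists2 K : R, 0 < K & forall a r, 0 < r ->
    (avg w a r *
     (if p == 1%R then norm_inf (wpow w (-1)) (eball a r)
      else avg (wpow w (- (p - 1)^-1)) a r `^ (p - 1)) <= K%:E)%E.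

Definition A_infty w := exists2 p, 1 <= p & A_p p w.

Definition Lpw_norm (p : R) w E f : \bar R :=
  ((\int[mu]_(x in E) (normc (f x) `^ p * w x)%:E) `^ p^-1)%E.

Definition WLpw_norm (p : R) w E f : \bar R :=
  ereal_sup [set (gamma%:E * wmeas w (E `&` [set x | (gamma < normc (f x))%R])
                   `^ p^-1)%E
               | gamma in `]0%R, +oo[].

Definition sup_balls (F : Rn -> R -> \bar R) : \bar R :=
  ereal_sup [set F z.1 z.2 | z in [set z : Rn * R | 0 < z.2]].

(* The factor w(B)^{-1/p} is written as the inverse of w(B)^{1/p}, since
   [poweR] sends +oo to +oo even for a negative exponent. *)
Definition Morrey_norm (psi : Rn -> R -> R) (p : R) w f : \bar R :=
  sup_balls (fun a r => ((psi a r)^-1%:E * (wmeas w (eball a r) `^ p^-1)^-1 *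
                          Lpw_norm p w (eball a r) f)%E).

Definition WMorrey_norm (psi : Rn -> R -> R) (p : R) w f : \bar R :=
  sup_balls (fun a r => ((psi a r)^-1%:E * (wmeas w (eball a r) `^ p^-1)^-1 *
                          WLpw_norm p w (eball a r) f)%E).

Definition bmean b a r : C :=
  ((fine (mu (eball a r)))^-1)%:C * cintegral mu (eball a r) b.

Definition bmo_norm b : \bar R :=
  sup_balls (fun a r => avg (fun x => normc (b x - bmean b a r)) a r).

Definition BMO b :=
  [/\ cmeasurable setT b,
      forall a r, 0 < r -> cintegrable mu (eball a r) b &
      (bmo_norm b < +oo)%E].

(* A partially defined operator; [app N f] is meaningful when [dom N f]. *)
Record operator := Operator {
  dom : set (Rn -> C);
  app :> (Rn -> C) -> Rn -> C }.

(* [nX] and [nY] are the norms of the spaces X and Y, each of which consists of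
   the measurable functions of finite norm. *)
Definition bounded_by (K : \bar R) (nX nY : (Rn -> C) -> \bar R)
    (N : operator) :=
  forall f, cmeasurable setT f -> (nX f < +oo)%E ->
    [/\ dom N f, cmeasurable setT (N f), (nY (N f) < +oo)%E &
        (nY (N f) <= K * nX f)%E].

Definition bounded nX nY N := exists2 K : R, 0 < K & bounded_by K%:E nX nY N.

Definition commutator b (N : operator) : operator :=
  Operator [set f | dom N f /\ dom N (b \* f)]
    (fun f x => b x * N f x - N (b \* f) x).

Definition L2norm f : \bar R := 'N[mu]_(2%:E)[EFin \o normc \o f]%E.

Definition L2 : set (Rn -> C) :=
  [set f | cmeasurable setT f /\ (L2norm f < +oo)%E].

(* Elements of L^2 are represented by functions, so that identities between
   them hold almost everywhere. *)
Definition linear_op (N : operator) :=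
  [/\ dom N `<=` L2, (forall f, dom N f -> L2 (N f)), dom N (cst 0) &
      forall (c : C) f g, dom N f -> dom N g ->
        dom N (fun x => c * f x + g x) /\
        {ae mu, forall x, N (fun y => c * f y + g y) x = c * N f x + N g x}].

Definition bounded_linear_L2 (A : (Rn -> C) -> Rn -> C) :=
  linear_op (Operator L2 A) /\
  exists K : R, forall f, L2 f -> (L2norm (A f) <= K%:E * L2norm f)%E.

Definition sector (omega : R) : set C :=
  [set z | exists r phi : R,
    [/\ 0 < r, `|phi| < omega & z = (r * cos phi) +i* (r * sin phi)]].

Definition analytic_semigroup (T : C -> (Rn -> C) -> Rn -> C) :=
  exists omega : R,
  [/\ 0 < omega <= pi / 2,
      (forall z, z = 0 \/ sector omega z -> bounded_linear_L2 (T z)),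
      (forall f, L2 f -> {ae mu, forall x, T 0 f x = f x}) /\
      (forall z1 z2 f, sector omega z1 -> sector omega z2 -> L2 f ->
        {ae mu, forall x, T (z1 + z2) f x = T z1 (T z2 f) x}),
      (forall f, L2 f -> forall e : R, 0 < e -> exists2 d : R, 0 < d &
        forall z, sector omega z -> normc z < d ->
          (L2norm (T z f \- f)%R <= e%:E)%E) &
      (* complex differentiability in the operator norm *)
      (forall z, sector omega z -> exists2 T' : (Rn -> C) -> Rn -> C,
        bounded_linear_L2 T' & forall e : R, 0 < e -> exists2 d : R, 0 < d &
          forall h f, normc h < d -> sector omega (z + h) -> L2 f ->
            (L2norm (fun x => T (z + h) f x - T z f x - h * T' f x)%R
              <= (e * normc h)%:E * L2norm f)%E)].

(* exp(-tL) = T t, i.e. -L is the infinitesimal generator of T. *)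
Definition generates (L : operator) (T : C -> (Rn -> C) -> Rn -> C) :=
  let derivative f g :=
    L2norm (fun x => (t^-1)%:C * (T t%:C f x - f x) + g x)%R @[t --> 0^'+]
      --> 0%E in
  (forall f, dom L f -> derivative f (L f)) /\
  (forall f g, L2 f -> L2 g -> derivative f g -> dom L f).

Implicit Type k : R -> Rn -> Rn -> C.

(* exp(-tL) f by means of its kernel k; this makes sense beyond L^2. *)
Definition kernel_op k (t : R) f x : C :=
  cintegral mu setT (fun y => k t x y * f y).

Definition heat_kernel k (T : C -> (Rn -> C) -> Rn -> C) :=
  cmeasurable [set z : measurableTypeR R * (Rn * Rn) | 0 < (z.1 : R)]
    (fun z : measurableTypeR R * (Rn * Rn) => k z.1 z.2.1 z.2.2) /\
  forall t f, 0 < t -> L2 f -> {ae mu, forall x, T t%:C f x = kernel_op k t f x}.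

Definition gaussian_bound k :=
  exists K c : R, [/\ 0 < K, 0 < c & forall t x y, 0 < t ->
    normc (k t x y) <=
      K * t `^ (- (n%:R / 2)) * expR (- (c * (edist x y ^+ 2 / t)))].

Definition Gamma (z : R) : R :=
  \int[leb1]_(t in `]0, +oo[) (t `^ (z - 1) * expR (- t)).

(* L^{-alpha/2}; its domain consists of the f for which the integrals defining
   L^{-alpha/2} f(x) converge absolutely for almost every x. *)
Definition frac_power k (alpha : R) : operator :=
  let integrand f x (t : R) : C :=
    kernel_op k t f x * ((t `^ (- (alpha / 2) + 1))^-1)%:C in
  Operator
    [set f | {ae mu, forall x,
       (forall t, 0 < t -> cintegrable mu setT (fun y => k t x y * f y)) /\
       cintegrable leb1 `]0, +oo[ (integrand f x)}]
    (fun f x => ((Gamma (alpha / 2))^-1)%:C *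
                cintegral leb1 `]0, +oo[ (integrand f x)).

Definition psi_ratio (psi1 : Rn -> R -> R) (p q : R) (w1 w2 : Rn -> R)
    a (t : R) : \bar R :=
  (ereal_inf [set (psi1 a l)%:E * wmeas (wpow w1 p) (eball a l) `^ p^-1
             | l in `[t, +oo[] /
   (wmeas (wpow w2 q) (eball a t) `^ q^-1))%E.

Definition Morrey_condition (psi1 psi2 : Rn -> R -> R) (p q : R)
    (w1 w2 : Rn -> R) :=
  (sup_balls (fun a r => (psi2 a r)^-1%:E *
     \int[leb1]_(t in `]r, +oo[)
       (psi_ratio psi1 p q w1 w2 a t * t^-1%:E)) < +oo)%E.

Definition log_Morrey_condition (psi1 psi2 : Rn -> R -> R) (p q : R)
    (w1 w2 : Rn -> R) :=
  (sup_balls (fun a r => (psi2 a r)^-1%:E *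
     \int[leb1]_(t in `]r, +oo[)
       ((1 + ln (t / r))%:E * psi_ratio psi1 p q w1 w2 a t * t^-1%:E)) < +oo)%E.

End analysis_on_Rn.

(* Main.v *)
From Pilot Require Import Defs.
From HB Require Import structures.
From mathcomp Require Import all_boot all_order all_algebra.
From mathcomp Require Import all_classical all_reals all_analysis.
From mathcomp Require Import measurable_realfun ess_sup_inf complex ring lra.

Set Implicit Arguments.
Unset Strict Implicit.
Unset Printing Implicit Defensive.
Import Order.TTheory GRing.Theory Num.Theory.
Import numFieldNormedType.Exports.

Local Open Scope classical_set_scope.
Local Open Scope ring_scope.

Local Notation edist := Pilot.Defs.edist.

(** Fix a ball [B] of radius [r] and centre [a], and split [f = f1 + f2] with
    [f1] the restriction of [f] to the doubled ball.  The near part [f1] is in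
    the weighted Lebesgue space, where boundedness is assumed, and its norm is at
    most the Morrey norm of [f] times the value at [2 r] of the infimum
    [source_size] that occurs in the integral condition.  For [x] in [B] and [y]
    outside the doubled ball, [|x - y| >= |y - a| / 2], so the Gaussian bound,
    integrated in time ([gaussian_time_integral]), gives the pointwise estimate
    [frac_power_tail]: [|N f2 (x)|] is at most a constant times the integral of
    [|f2 (y)| |y - a|^(alpha - n)].

    That integral is cut into dyadic shells ([dyadic_tail]).  On a ball of radius
    [t] the weight condition and Hölder bound the integral of [|f|] by its
    weighted norm times [t^(n - alpha) / u(B)^(1/q)], [u = w2^q]
    ([ball_integral_bound], and [ball_integral_bound1] at the endpoint), so the
    shells add up to a sum of the terms [source_size / u^(1/q)] at the radii
    [2^j r].  This sum is a lower Riemann sum of the integral in the hypothesis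
    ([dyadic_integral_ge], [dyadic_sum]), hence at most a constant times [psi2].
    The doubling of [u] ([Ainf_doubling]) moves between consecutive radii.

    For the commutator, with [z] the mean of [b] on [B], the far part is
    [(b - z) N f2 - N ((b - z) f2)].  The oscillation of [b] has to be integrated
    against [u] on [B], and against [|f|] on the shells, that is, after Hölder,
    against [w1^(-p')].  Both follow from the weighted John-Nirenberg inequality
    [john_nirenberg_ball]: [u] and its dual [v = w2^(-p')] are A-infinity weights
    because [|F|^kap <= u(F)^(1/q) v(F)^(1/p')] for every [F] while the weight
    condition bounds the right-hand side on balls by [|B|^kap] ([Ainf_dual]), and
    [w1^(-p')] is dominated by [v] on balls ([sigma_le_dual]).  The means of [b]
    on the balls of radii [r] and [2^j r] differ by a multiple of [j]; the
    logarithm in the second integral condition absorbs this factor.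

    The John-Nirenberg inequality is proved on the binary tree of boxes obtained
    by halving the longest side of a cube again and again.  A stopping argument
    bounds the exponential of the largest deviation of the averages along a
    branch ([exp_max_bound]), and almost every value of the function is reached
    by these averages because every measurable set is approximated by unions of
    nodes ([node_avg_le_ae]). *)

(** * The John-Nirenberg inequality on a binary tree *)

Section john_nirenberg_tree.
Context d (X : measurableType d) (R : realType).
Variables (mu : {measure set X -> \bar R}) (S : seq bool -> set X).
Hypothesis mS : forall s, measurable (S s).
Hypothesis S_split : forall s, S s = S (true :: s) `|` S (false :: s).
Hypothesis S_disj : forall s, [disjoint S (true :: s) & S (false :: s)].
Hypothesis mu_half : forall b s, (mu (S s) = 2%:E * mu (S (b :: s)))%E.
Hypothesis mu_root : (0 < mu (S [::]) < +oo)%E.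

Local Notation m s := (fine (mu (S s))).

Lemma mu_nodeE s : mu (S s) = (m s)%:E /\ 0 < m s.
Proof.
elim: s => [|b s [sE s0]].
  case/andP: mu_root => r0 roo.
  by rewrite fineK ?fine_gt0 ?r0 ?roo ?ge0_fin_numE// ltW.
have := mu_half b s; rewrite sE; case: (mu (S (b :: s))) => [r|//|//] /=.
  by move=> [mE]; split=> //; lra.
  by rewrite gt0_muley ?lte_fin.
by rewrite gt0_muleNy ?lte_fin.
Qed.

Lemma mu_nodeS b s : m s = 2 * m (b :: s).
Proof.
have [sE _] := mu_nodeE s; have [bsE _] := mu_nodeE (b :: s).
by have := mu_half b s; rewrite sE bsE => -[].
Qed.

Lemma node_sub b s : S (b :: s) `<=` S s.
Proof. by rewrite [S s]S_split; case: b => x; [left|right]. Qed.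

Lemma node_sub_root s : S s `<=` S [::].
Proof.
by elim: s => [//|b s IH]; apply: subset_trans IH; exact: node_sub.
Qed.

Section stopping.
Variable f : X -> R.
Hypothesis fi : mu.-integrable (S [::]) (EFin \o f).

Definition node_avg s : R := (m s)^-1 * \int[mu]_(x in S s) f x.

Lemma integrable_sub E : measurable E -> E `<=` S [::] ->
  mu.-integrable E (EFin \o f).
Proof. by move=> mE ES; apply: integrableS fi. Qed.

Lemma node_integrable s : mu.-integrable (S s) (EFin \o f).
Proof. exact: integrable_sub (@node_sub_root s). Qed.

Lemma mu_sub_lty E : measurable E -> E `<=` S [::] -> (mu E < +oo)%E.
Proof.
move=> mE ES; case/andP: mu_root => _; apply: le_lt_trans.
by apply: le_measure => //; rewrite inE.
Qed.

Lemma integrable_cst_sub (h : R) E : measurable E -> E `<=` S [::] ->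
  mu.-integrable E (EFin \o cst h).
Proof.
move=> mE ES; apply: measurable_bounded_integrable => //.
  exact: mu_sub_lty.
exact: bounded_cst.
Qed.

Lemma integrableBcst_sub (h : R) E : measurable E -> E `<=` S [::] ->
  mu.-integrable E (EFin \o (fun x => f x - h)).
Proof.
move=> mE ES.
exact: (integrableB mE (integrable_sub mE ES) (integrable_cst_sub h mE ES)).
Qed.

Lemma integrable_norm_sub (h : R) E : measurable E -> E `<=` S [::] ->
  mu.-integrable E (EFin \o (fun x => `|f x - h|)).
Proof.
by move=> mE ES; apply: integrable_norm; exact: integrableBcst_sub.
Qed.

Lemma node_int_sub (h : R) s :
  \int[mu]_(x in S s) (f x - h) = m s * (node_avg s - h).
Proof.
rewrite RintegralB//; [|exact: node_integrable|]; last first.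
  exact: (integrable_cst_sub h (mS s) (@node_sub_root s)).
rewrite Rintegral_cst// mulrBr mulrA divff ?mul1r 1?mulrC//.
by have [_ /gt_eqF ->] := mu_nodeE s.
Qed.

Lemma node_avg_dev (h : R) s :
  m s * `|node_avg s - h| <= \int[mu]_(x in S s) `|f x - h|.
Proof.
have [_ ms0] := mu_nodeE s.
rewrite -{1}(gtr0_norm ms0) -normrM -node_int_sub.
apply: le_normr_Rintegral => //; apply: integrableBcst_sub => //.
exact: node_sub_root.
Qed.

Variable A : R.
Hypothesis A0 : 0 < A.
Hypothesis osc : forall s,
  \int[mu]_(x in S s) `|f x - node_avg s| <= A * m s.

Lemma node_avg_child b s : `|node_avg (b :: s) - node_avg s| <= 2 * A.
Proof.
have [_ ms0] := mu_nodeE s; have [_ mbs0] := mu_nodeE (b :: s).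
have h1 := node_avg_dev (node_avg s) (b :: s).
have h2 : \int[mu]_(x in S (b :: s)) `|f x - node_avg s| <= A * m s.
  apply: le_trans (osc s).
  rewrite /Rintegral fine_le//.
  - apply: integrable_fin_num => //; apply: integrable_norm_sub => //.
    exact: node_sub_root.
  - apply: integrable_fin_num => //; apply: integrable_norm_sub => //.
    exact: node_sub_root.
  apply: ge0_subset_integral => //; [|exact: node_sub].
  have /integrable_norm_sub := mS s => /(_ (node_avg s) (@node_sub_root s)).
  exact: measurable_int.
rewrite -(ler_pM2l mbs0); apply: le_trans h1 (le_trans h2 _).
by rewrite (mu_nodeS b s) le_eqVlt; apply/orP; left; apply/eqP; ring.
Qed.

(** The stopping set of the John-Nirenberg argument, cut off at the depth [k].
    Stopping at the first bad node makes its pieces disjoint nodes. *)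
Fixpoint bad k s h : set X :=
  if 2 * A < `|node_avg s - h| then S s else
  if k is k'.+1 then bad k' (true :: s) h `|` bad k' (false :: s) h else set0.

Lemma bad_sub k s h : bad k s h `<=` S s.
Proof.
elim: k s => [|k IH] s /=; case: ifP => _ x //.
by move=> [/IH|/IH]; exact: node_sub.
Qed.

Lemma bad_measurable k s h : measurable (bad k s h).
Proof.
by elim: k s => [|k IH] s /=; case: ifP => // _; exact: measurableU.
Qed.

Lemma bad_disj k s h : [disjoint bad k (true :: s) h & bad k (false :: s) h].
Proof.
apply/disj_setPS => x [/bad_sub xt /bad_sub xf].
by have /disj_setPS := S_disj s; apply; split; [exact: xt|exact: xf].
Qed.

Let bad_sub_root k s h : bad k s h `<=` S [::].
Proof. by move=> x /bad_sub; exact: node_sub_root. Qed.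

Lemma bad_chebyshev k s h :
  2 * A * fine (mu (bad k s h)) <= \int[mu]_(x in bad k s h) `|f x - h|.
Proof.
elim: k s => [|k IH] s /=; case: ifP => far.
- have [_ ms0] := mu_nodeE s; apply: le_trans (node_avg_dev h s).
  by rewrite mulrC ler_pM2l// ltW.
- by rewrite measure0 mulr0 Rintegral_ge0.
- have [_ ms0] := mu_nodeE s; apply: le_trans (node_avg_dev h s).
  by rewrite mulrC ler_pM2l// ltW.
rewrite Rintegral_setU; [|exact: bad_measurable..| |exact: bad_disj].
  rewrite measureU; [|exact: bad_measurable..|]; last first.
    by apply/disj_set2P; exact: bad_disj.
  rewrite fineD; last 2 first.
  - rewrite ge0_fin_numE//; apply: mu_sub_lty; [exact: bad_measurable|].
    exact: bad_sub_root.
  - rewrite ge0_fin_numE//; apply: mu_sub_lty; [exact: bad_measurable|].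
    exact: bad_sub_root.
    by rewrite mulrDr; exact: lerD (IH _) (IH _).
apply: integrable_norm_sub.
  by apply: measurableU; exact: bad_measurable.
by move=> x [|]; exact: bad_sub_root.
Qed.

(** A stopping height of twice the mean oscillation leaves, by Chebyshev, at most
    half of the node. *)
Lemma bad_half k s :
  2 * fine (mu (bad k s (node_avg s))) <= m s.
Proof.
rewrite -(ler_pM2l A0) mulrA [A * 2]mulrC.
apply: le_trans (bad_chebyshev _ _ _) (le_trans _ (osc s)).
rewrite /Rintegral fine_le//.
- apply: integrable_fin_num; first exact: bad_measurable.
  apply: integrable_norm_sub; first exact: bad_measurable.
  exact: bad_sub_root.
- apply: integrable_fin_num => //; apply: integrable_norm_sub => //.
  exact: node_sub_root.
apply: ge0_subset_integral => //; [exact: bad_measurable| |exact: bad_sub].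
have /integrable_norm_sub := mS s => /(_ (node_avg s) (@node_sub_root s)).
exact: measurable_int.
Qed.

(** The integral of the exponential of [e] times the largest deviation along a
    branch, expressed by the masses [V] of the nodes, so that two weights can be
    compared node by node. *)
Fixpoint exp_max (V : seq bool -> R) (e : R) k s h M : R :=
  let M' := Num.max M `|node_avg s - h| in
  if k is k'.+1 then
    exp_max V e k' (true :: s) h M' + exp_max V e k' (false :: s) h M'
  else expR (e * M') * V s.

(** Changing the reference value, to restart the estimate at a stopping node,
    only costs a constant factor. *)
Lemma exp_max_shift V e k s h h' M M' D :
  (forall s, 0 <= V s) -> 0 <= e -> `|h - h'| <= D -> M <= M' + D ->
  exp_max V e k s h M <= expR (e * D) * exp_max V e k s h' M'.
Proof.
move=> V0 e0 hh'; elim: k s M M' => [|k IH] s M M' MM' /=.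
  rewrite mulrA -expRD ler_wpM2r// ler_expR -mulrDr ler_wpM2l//.
  rewrite ge_max; apply/andP; split.
    by rewrite addrC (le_trans MM')// lerD2r le_max lexx.
  have -> : node_avg s - h = (node_avg s - h') - (h - h') by ring.
  rewrite (le_trans (ler_normB _ _))// addrC lerD// le_max lexx orbT//.
have {}MM' : Num.max M `|node_avg s - h| <=
             Num.max M' `|node_avg s - h'| + D.
  rewrite ge_max; apply/andP; split.
    by rewrite (le_trans MM')// lerD2r le_max lexx.
  have -> : node_avg s - h = (node_avg s - h') - (h - h') by ring.
  by rewrite (le_trans (ler_normB _ _))// lerD// le_max lexx orbT.
by rewrite mulrDr lerD// IH.
Qed.

Lemma exp_max_le V W (C e : R) k s h M : (forall s, W s <= C * V s) ->
  exp_max W e k s h M <= C * exp_max V e k s h M.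
Proof.
move=> WV; elim: k s M => [|k IH] s M /=; last by rewrite mulrDr lerD.
by rewrite mulrCA ler_wpM2l// expR_ge0.
Qed.

Variable v : X -> R.
Hypothesis v0 : forall x, 0 <= v x.
Hypothesis vi : mu.-integrable (S [::]) (EFin \o v).
Variable th : R.
Hypothesis th1 : 2^-1 <= th < 1.
Local Notation V E := (\int[mu]_(x in E) v x).
Hypothesis v_Ainf : forall s E, measurable E -> E `<=` S s ->
  2 * fine (mu E) <= m s -> V E <= th * V (S s).

Let VU E F : measurable E -> measurable F -> E `<=` S [::] -> F `<=` S [::] ->
  [disjoint E & F] -> V (E `|` F) = V E + V F.
Proof.
move=> mE mF ES FS EF; rewrite Rintegral_setU//.
apply: integrableS vi => //; first exact: measurableU.
by move=> x [/ES|/FS].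
Qed.

Let V_ge0 E : 0 <= V E.
Proof. by apply: Rintegral_ge0 => x _. Qed.

Let VS s : V (S s) = V (S (true :: s)) + V (S (false :: s)).
Proof.
by rewrite {1}S_split VU//; exact: node_sub_root.
Qed.

(** As long as no node is bad, all deviations stay below [2 * A]; from the first
    bad node on, the deviation is measured from the average of that node, where
    the bound [B] for smaller depths applies. *)
Lemma exp_max_bad B e K : 0 <= e -> 0 <= B ->
  (forall k s, (k < K)%N ->
     exp_max (fun s => V (S s)) e k s (node_avg s) 0 <= B * V (S s)) ->
  forall k s h M, (k < K)%N -> `|node_avg s - h| <= 4 * A -> M <= 2 * A ->
  exp_max (fun s => V (S s)) e k s h M <=
    expR (e * (2 * A)) * V (S s) + expR (e * (4 * A)) * B * V (bad k s h).
Proof.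
move=> e0 B0 IHK; have A0' := ltW A0.
have far k s h M : (k < K)%N -> `|node_avg s - h| <= 4 * A -> M <= 2 * A ->
    exp_max (fun s => V (S s)) e k s h M <=
    expR (e * (2 * A)) * V (S s) + expR (e * (4 * A)) * B * V (S s).
  move=> kK sh M2; rewrite ler_wpDl ?mulr_ge0 ?expR_ge0//.
  apply: le_trans (_ : _ <= expR (e * (4 * A)) * exp_max (fun s => V (S s)) e k s (node_avg s) 0) _.
    by apply: exp_max_shift => //; [rewrite distrC|lra].
  by rewrite -mulrA ler_wpM2l ?expR_ge0// IHK.
elim=> [|k IH] s h M kK sh M2 /=; case: ifPn => [sh2|].
- exact: (far 0).
- rewrite -leNgt => sh2; rewrite Rintegral_set0 mulr0 addr0.
  rewrite ler_wpM2r// ler_expR ler_wpM2l// ge_max M2//.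
- exact: (far k.+1).
rewrite -leNgt => sh2; have kK' := ltnW kK.
have child b : `|node_avg (b :: s) - h| <= 4 * A.
  have -> : node_avg (b :: s) - h =
    (node_avg (b :: s) - node_avg s) + (node_avg s - h) by ring.
  by rewrite (le_trans (ler_normD _ _))//; have := node_avg_child b s; lra.
have M2' : Num.max M `|node_avg s - h| <= 2 * A by rewrite ge_max M2.
rewrite (VU (bad_measurable _ _ _) (bad_measurable _ _ _) (@bad_sub_root _ _ _)
  (@bad_sub_root _ _ _) (bad_disj _ _ _)).
rewrite VS !mulrDr addrACA lerD//; exact: IH.
Qed.

(** The exponential integrability at every finite depth: past a bad node the
    deviation restarts from that node's own average, and bad nodes carry only
    the fraction [th] of the weight. *)
Lemma exp_max_bound K s :
  exp_max (fun s => V (S s)) (ln ((1 + th) / (2 * th)) / (4 * A)) K s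
    (node_avg s) 0 <= 4 / (1 - th) * V (S s).
Proof.
set e := ln _ / _; case/andP: th1 => th2 th3.
have h1 : 1 <= (1 + th) / (2 * th) by rewrite ler_pdivlMr; lra.
have e0 : 0 <= e by rewrite divr_ge0 ?ln_ge0//; have := A0; lra.
have e4 : expR (e * (4 * A)) = (1 + th) / (2 * th).
  rewrite divfK ?lnK// ?posrE; first by lra.
  by rewrite gt_eqF// mulr_gt0.
have e2 : expR (e * (2 * A)) <= 2.
  apply: le_trans (_ : _ <= expR (e * (4 * A))) _.
    by rewrite ler_expR ler_wpM2l//; have := A0; lra.
  by rewrite e4 ler_pdivrMr; lra.
have B0 : 0 <= 4 / (1 - th) by rewrite divr_ge0; lra.
elim/ltn_ind: K s => -[|K] IH s.
  rewrite /= subrr normr0 maxxx mulr0 expR0 ler_wpM2r// ler_pdivlMr; lra.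
have step b : exp_max (fun s => V (S s)) e K (b :: s) (node_avg s) 0 <=
    expR (e * (2 * A)) * V (S (b :: s)) +
    expR (e * (4 * A)) * (4 / (1 - th)) * V (bad K (b :: s) (node_avg s)).
  apply: (@exp_max_bad _ _ K.+1) => //; last by have := A0; lra.
    by move=> k s0 kK; exact: IH.
  by have := node_avg_child b s; have := A0; lra.
rewrite /= subrr normr0 maxxx.
apply: le_trans (lerD (step true) (step false)) _.
rewrite addrACA -!mulrDr -VS
  -(VU (bad_measurable _ _ _) (bad_measurable _ _ _) (@bad_sub_root _ _ _)
  (@bad_sub_root _ _ _) (bad_disj _ _ _)).
have bE : bad K.+1 s (node_avg s) =
   bad K (true :: s) (node_avg s) `|` bad K (false :: s) (node_avg s).
  by rewrite /= subrr normr0 ltNge mulr_ge0// ltW.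
have vb : V (bad K.+1 s (node_avg s)) <= th * V (S s).
  apply: v_Ainf; [exact: bad_measurable|exact: bad_sub|exact: bad_half].
rewrite -bE.
apply: le_trans (_ : _ <= 2 * V (S s) +
   (1 + th) / (2 * th) * (4 / (1 - th)) * (th * V (S s))) _.
  rewrite lerD ?ler_wpM2r// e4 ler_wpM2l// mulr_ge0//; lra.
rewrite mulrA -mulrDl ler_wpM2r// le_eqVlt; apply/orP; left; apply/eqP.
by field; apply/andP; split; lra.
Qed.

End stopping.

Section step_approximation.

(** Unions of nodes of a fixed generation: the step sets of the tree. *)
Fixpoint sel k s (P : pred (seq bool)) : set X :=
  if k is k'.+1 then sel k' (true :: s) P `|` sel k' (false :: s) P
  else if P s then S s else set0.

Lemma sel_measurable k s P : measurable (sel k s P).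
Proof.
elim: k s => [|k IH] s /=; first by case: (P s).
exact: measurableU.
Qed.

Lemma selP k s P x :
  sel k s P x <-> exists t, [/\ size t = k, P (t ++ s) & S (t ++ s) x].
Proof.
elim: k s => [|k IH] s /=.
  split; last by case=> -[|b t] [] //= _ ->.
  by case: ifP => // Ps Ssx; exists [::].
split=> [|[t]].
  move=> [/IH|/IH] [t [tk Pt St]].
    by exists (rcons t true); rewrite size_rcons tk cat_rcons.
  by exists (rcons t false); rewrite size_rcons tk cat_rcons.
case/lastP: t => [|t b]; first by case.
rewrite size_rcons cat_rcons => -[[tk] Pt St].
by case: b Pt St => Pt St; [left|right]; apply/IH; exists t.
Qed.

Lemma node_uniq t t' x : size t = size t' -> S t x -> S t' x -> t = t'.
Proof.
elim: t t' => [[]//|b t IH] [//|b' t'] /= [tt'] tx t'x.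
have tE : t = t' by apply: IH => //; [exact: node_sub tx|exact: node_sub t'x].
subst t'; congr (_ :: _); have /disj_setPS dis := S_disj t.
case: b tx; case: b' t'x => // h1 h2; exfalso; apply: (dis x);
  by split.
Qed.

Lemma node_ex k x : S [::] x -> exists2 t, size t = k & S t x.
Proof.
move=> Qx; elim: k => [|k [t tk tx]]; first by exists [::].
move: tx; rewrite S_split => -[tx|tx].
  by exists (true :: t) => //=; rewrite tk.
by exists (false :: t) => //=; rewrite tk.
Qed.

Lemma sel_sub k P : sel k [::] P `<=` S [::].
Proof. by move=> x /selP [t [_ _]] /node_sub_root. Qed.

Lemma selC k P : S [::] `\` sel k [::] P = sel k [::] (predC P).
Proof.
apply/seteqP; split => x.
  move=> [Qx nx]; have [t tk tx] := node_ex k Qx.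
  apply/selP; exists t; rewrite cats0; split => //=.
  apply/negP => Pt; apply: nx; apply/selP; exists t.
  by rewrite cats0.
move=> /selP [t]; rewrite cats0 => -[tk /= Pt tx]; split.
  exact: node_sub_root tx.
move=> /selP [t']; rewrite cats0 => -[t'k /= Pt' t'x].
by move: Pt; rewrite (node_uniq _ tx t'x) ?Pt' ?tk.
Qed.

Lemma sel_refine k j P : sel k [::] P = sel (j + k) [::] (P \o drop j).
Proof.
apply/seteqP; split => x /selP [t]; rewrite cats0 => -[tk Pt tx]; apply/selP.
  have [t' t'k t'x] := node_ex (j + k) (node_sub_root tx).
  exists t'; rewrite cats0; split => //=.
  suff -> : drop j t' = t by [].
  apply: node_uniq tx; first by rewrite size_drop t'k addKn tk.
  have := t'x; rewrite -{1}(cat_take_drop j t').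
  elim: (take j t') => [//|b l IH] /= /node_sub; exact: IH.
exists (drop j t); rewrite cats0; split => //.
  by rewrite size_drop tk addKn.
have := tx; rewrite -{1}(cat_take_drop j t).
elim: (take j t) => [//|b l IH] /= /node_sub; exact: IH.
Qed.

Lemma selU k P P' : sel k [::] P `|` sel k [::] P' = sel k [::] (predU P P').
Proof.
apply/seteqP; split => x.
  move=> [|] /selP [t [tk Pt tx]]; apply/selP; exists t; split => //=.
    by rewrite Pt.
  by rewrite Pt orbT.
move=> /selP [t [tk /= /orP[Pt|Pt] tx]]; [left|right]; apply/selP; exists t => //.
Qed.

Definition symd (E V : set X) := (E `&` S [::]) `\` V `|` V `\` E.

Lemma symd_measurable E V : measurable E -> measurable V -> measurable (symd E V).
Proof.
move=> mE mV; apply: measurableU; apply: measurableD => //.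
exact: measurableI.
Qed.

(** The sets approximated in measure by step sets form a sigma-algebra; when it
    contains all measurable sets, this replaces the differentiation theorem. *)
Definition approx : set (set X) := [set E | measurable E /\
  forall e : R, 0 < e -> exists k P, (mu (symd E (sel k [::] P)) < e%:E)%E].

Lemma approxC E : approx E -> approx (~` E).
Proof.
move=> [mE aE]; split; first exact: measurableC.
move=> e e0; have [k [P lt]] := aE e e0; exists k, (predC P).
apply: le_lt_trans lt; apply: le_measure; rewrite ?inE.
- by apply: symd_measurable; [exact: measurableC|exact: sel_measurable].
- by apply: symd_measurable => //; exact: sel_measurable.
rewrite -selC => x [[[nE Qx] n]|[[Qx nx] /contrapT Ex]].
  right; split => //; apply: contrapT => nx; exact: n.
by left.
Qed.

Lemma approxU E F : approx E -> approx F -> approx (E `|` F).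
Proof.
move=> [mE aE] [mF aF]; split; first exact: measurableU.
move=> e e0; have e20 : 0 < e / 2 by rewrite divr_gt0.
have [k [P lt]] := aE _ e20; have [k' [P' lt']] := aF _ e20.
exists (k' + k)%N, (predU (P \o drop k') (P' \o drop k)).
rewrite -selU -sel_refine (addnC k') -sel_refine.
apply: le_lt_trans (_ : (mu (symd E (sel k [::] P)) +
   mu (symd F (sel k' [::] P')) < _)%E); last first.
  by rewrite [e]splitr EFinD lteD.
have m1 := symd_measurable mE (sel_measurable k [::] P).
have m2 := symd_measurable mF (sel_measurable k' [::] P').
apply: (le_trans _ (measureU2 _ m1 m2)).
apply: le_measure; rewrite ?inE; [|exact: measurableU|].
  apply: symd_measurable; first exact: measurableU.
  by apply: measurableU; exact: sel_measurable.
move=> x [[[[Ex|Fx] Qx] n]|[[Px|Px] n]].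
- by left; left; split => // h; apply: n; left.
- by right; left; split => // h; apply: n; right.
- by left; right; split => // h; apply: n; left.
- by right; right; split => // h; apply: n; right.
Qed.

Lemma approx0 : approx set0.
Proof.
split=> // e e0; exists 0%N, pred0 => /=.
by rewrite /symd set0I !set0D setU0 measure0 lte_fin.
Qed.

Lemma approx_bigcup (F : (set X)^nat) : (forall i, approx (F i)) -> approx (\bigcup_i F i).
Proof.
move=> aF; have mF i : measurable (F i) by case: (aF i).
have mU : measurable (\bigcup_i F i) by exact: bigcupT_measurable.
split=> // e e0; have e20 : 0 < e / 2 by rewrite divr_gt0.
pose G i := \big[setU/set0]_(j < i) F j.
have aG i : approx (G i).
  rewrite /G; elim: i => [|i IH]; first by rewrite big_ord0; exact: approx0.
  by rewrite big_ord_recr /=; exact: approxU.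
have mG i : measurable (G i) by case: (aG i).
pose H i := (S [::] `&` \bigcup_i F i) `\` G i.
have mH i : measurable (H i) by apply: measurableD => //; exact: measurableI.
have H0 : \bigcap_i H i = set0.
  rewrite -subset0 => x Hx.
  have [[Qx [j _ Fj]] _] := Hx 0%N I.
  have [_] := Hx j.+1 I; apply; rewrite /G -bigcup_mkord; exists j => //=.
have /(_ _) cvgH : mu \o H @ \oo --> mu (\bigcap_i H i).
  apply: nonincreasing_cvg_mu => //.
  - apply: le_lt_trans (_ : (mu (S [::]) < _)%E); last by case/andP: mu_root.
    by apply: le_measure; rewrite ?inE// => x [[]].
  - by rewrite H0.
  - apply/nonincreasing_seqP => i; apply/subsetPset => x [Ux nG].
    by split=> // Gx; apply: nG; rewrite /G big_ord_recr /=; left.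
rewrite H0 measure0 in cvgH.
have [i lti] : exists i, (mu (H i) < (e / 2)%:E)%E.
  have /fine_cvgP[_ /cvgrPdist_lt /(_ _ e20)] := cvgH.
  move=> [i _ /(_ i (leqnn i))] /=; rewrite sub0r normrN => h; exists i.
  have Hfin : mu (H i) \is a fin_num.
    rewrite ge0_fin_numE//; apply: mu_sub_lty => //; move=> x [[]] //.
  by rewrite -[mu (H i)]fineK// lte_fin (le_lt_trans (ler_norm _)).
have [_ /(_ _ e20) [k [P lt]]] := aG i.
exists k, P.
apply: le_lt_trans (_ : (mu (H i) + mu (symd (G i) (sel k [::] P)) < _)%E);
  last by rewrite [e]splitr EFinD lteD.
have m2 := symd_measurable (mG i) (sel_measurable k [::] P).
apply: (le_trans _ (measureU2 _ (mH i) m2)).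
apply: le_measure; rewrite ?inE; [|exact: measurableU|].
  by apply: symd_measurable => //; exact: sel_measurable.
have GU : G i `<=` \bigcup_i F i.
  by rewrite /G -bigcup_mkord => x [j _ Fj]; exists j.
move=> x [[[Ux Qx] n]|[Px n]].
  have [Gx|nGx] := pselect (G i x); first by right; left.
  by left; split.
by right; right; split=> // /GU.
Qed.

Lemma approx_sigma_algebra : sigma_algebra setT approx.
Proof.
split; first exact: approx0.
  by move=> A /approxC; rewrite setTD.
exact: approx_bigcup.
Qed.

End step_approximation.

Hypothesis approxT : forall E, measurable E -> approx E.

(** A one-sided differentiation theorem: the union of the nodes chosen by a
    good approximation of [D `&` [set x | q < f x]], among those meeting [D],
    has average at most [q]. *)
Lemma node_avg_le_ae f (D : set X) (q : R) :
  mu.-integrable (S [::]) (EFin \o f) -> measurable D -> D `<=` S [::] ->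
  (forall s, S s `&` D !=set0 -> node_avg f s <= q) ->
  mu (D `&` [set x | q < f x]) = 0%E.
Proof.
move=> fi mD DQ avgD; set E := D `&` _.
have mf : measurable_fun (S [::]) f by move/measurable_int/measurable_EFinP: fi.
have EQ : E `<=` S [::] by move=> x [/DQ].
have mE : measurable E.
  have -> : E = D `&` (S [::] `&` [set x | q < f x]).
    by rewrite setIA (setIidl DQ).
  apply: measurableI => //.
  have -> : [set x | q < f x] = f @^-1` `]q, +oo[.
    by apply/seteqP; split => x /=; rewrite in_itv/= andbT.
  exact: mf.
pose g x := f x - q.
have gi F : measurable F -> F `<=` S [::] -> mu.-integrable F (EFin \o g).
  by move=> mF FQ; exact: integrableBcst_sub.
have gni F : measurable F -> F `<=` S [::] ->
    mu.-integrable F (EFin \o (fun x => `|g x|)).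
  by move=> mF FQ; exact: integrable_norm_sub.
have small e : 0 < e -> \int[mu]_(x in E) g x <= e.
  move=> e0.
  have gQ : mu.-integrable setT (EFin \o (g \_ (S [::]))).
    rewrite -restrict_EFin; apply/(@integrable_mkcond _ _ _ mu (S [::])) => //.
    exact: gi.
  have [r [r0 gr]] := integral_normr_continuous gQ e0.
  have [_ /(_ _ r0) [k [P EP]]] := approxT mE.
  (* Dropping the nodes that miss [D] loses no point of [E]. *)
  pose P' := predI P (fun t => `[< S t `&` D !=set0 >]).
  pose V := sel k [::] P'.
  have mV : measurable V by exact: sel_measurable.
  have VQ : V `<=` S [::] by exact: sel_sub.
  have ltV : (mu (symd E V) < r%:E)%E.
    apply: le_lt_trans EP; apply: le_measure; rewrite ?inE.
    - exact: symd_measurable.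
    - by apply: symd_measurable => //; exact: sel_measurable.
    move=> x [[[Ex Qx] nV]|[/selP[t [tk /andP[Pt _] tx]] nE]].
      left; split=> // /selP [t [tk Pt tx]]; apply: nV; apply/selP; exists t.
      split=> //=; rewrite Pt/=; apply/asboolP; exists x; split=> //.
      by case: Ex.
    by right; split=> //; apply/selP; exists t.
  have V0 : \int[mu]_(x in V) g x <= 0.
    rewrite /V; move: (k) ([::] : seq bool).
    elim=> [|j IH] s /=.
      case: ifP => [/andP[_ /asboolP sD]|_]; last by rewrite Rintegral_set0.
      rewrite node_int_sub//; have [_ ms0] := mu_nodeE s.
      by rewrite pmulr_rle0// subr_le0 avgD.
    rewrite Rintegral_setU; [by rewrite -[leRHS]addr0 lerD|exact: sel_measurable..| |].
      apply: gi; first by apply: measurableU; exact: sel_measurable.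
      by move=> x [|] /selP [t [_ _ tx]]; exact: node_sub_root tx.
    apply/disj_setPS => x [/selP [t [tk _]] + /selP [t' [t'k _]]].
    rewrite -!cat_rcons => tx t'x.
    have := node_uniq _ tx t'x.
    rewrite !size_cat !size_rcons tk t'k => /(_ erefl) /eqP.
    by rewrite eqseq_cat ?size_rcons ?tk ?t'k// eqseq_rcons andbF.
  have mI := measurableI _ _ mE mV.
  have mEV := measurableD mE mV; have mVE := measurableD mV mE.
  have IQ : E `&` V `<=` S [::] by move=> x [/EQ].
  have EVQ : E `\` V `<=` S [::] by move=> x [/EQ].
  have VEQ : V `\` E `<=` S [::] by move=> x [/VQ].
  have symdE : symd E V = (E `\` V) `|` (V `\` E).
    by rewrite /symd (setIidl EQ).
  have splitE : \int[mu]_(x in E) g x =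
      \int[mu]_(x in E `&` V) g x + \int[mu]_(x in E `\` V) g x.
    rewrite -Rintegral_setU//; first by rewrite setUIDK.
      by rewrite setUIDK; exact: gi.
    by apply/disj_setPS => x [[_ Vx] [_]].
  have splitV : \int[mu]_(x in V) g x =
      \int[mu]_(x in E `&` V) g x + \int[mu]_(x in V `\` E) g x.
    rewrite setIC -Rintegral_setU//; first by rewrite setUIDK.
    - by rewrite setIC.
    - by rewrite setUIDK; exact: gi.
    by apply/disj_setPS => x [[_ Vx] [_]].
  have := gr _ (symd_measurable mE mV) ltV.
  have -> : \int[mu]_(x in symd E V) `|(g \_ (S [::])) x| =
            \int[mu]_(x in symd E V) `|g x|.
    apply: eq_Rintegral => x; rewrite inE symdE => sx; rewrite patchE mem_set//.
    by case: sx => [/EVQ|/VEQ].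
  rewrite symdE Rintegral_setU//; last 2 first.
  - by apply: gni; [exact: measurableU|move=> x [/EVQ|/VEQ]].
  - by apply/disj_setPS => x [[_ nV] [Vx]].
  have h1 := le_normr_Rintegral mEV (gi _ mEV EVQ).
  have h2 := le_normr_Rintegral mVE (gi _ mVE VEQ).
  have h3 := ler_norm (\int[mu]_(x in E `\` V) g x).
  have h4 := ler_norm (- \int[mu]_(x in V `\` E) g x).
  by rewrite normrN in h4; lra.
have g0 x : E x -> 0 <= g x by move=> [_ /=]; rewrite /g subr_ge0; exact: ltW.
have int0 : \int[mu]_(x in E) g x = 0.
  apply/eqP; rewrite eq_le Rintegral_ge0// andbT.
  by apply/ler_addgt0Pr => e e0; rewrite add0r; exact: small.
have /(ae_eq_integral_abs mu mE) : measurable_fun E (EFin \o g).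
  exact: measurable_int (gi _ mE EQ).
move=> [+ _]; have -> : (\int[mu]_(x in E) `|(EFin \o g) x| = 0)%E.
  have -> : (\int[mu]_(x in E) `|(EFin \o g) x| = \int[mu]_(x in E) (g x)%:E)%E.
    by apply: eq_integral => x; rewrite inE => Ex /=; rewrite ger0_norm// g0.
  rewrite -[LHS]fineK; first by congr EFin.
  exact: integrable_fin_num (gi _ mE EQ).
move=> /(_ erefl) [N [mN N0 sub]]; apply/eqP; rewrite -measure_le0 -N0.
apply: le_measure; rewrite ?inE// => x Ex; apply: sub => /= h.
have [gx0] := h Ex; case: Ex => _ /=; rewrite -subr_gt0.
by move: gx0; rewrite /g => ->; rewrite ltxx.
Qed.

Section exponential_integrability.
Variable f : X -> R.
Hypothesis fi : mu.-integrable (S [::]) (EFin \o f).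

(** The largest deviation from [h] met along the branch of [x]: [exp_max] is
    the integral of its exponential. *)
Fixpoint path_max k s h M x : R :=
  let M' := Num.max M `|node_avg f s - h| in
  if k is k'.+1 then
    if `[< S (true :: s) x >] then path_max k' (true :: s) h M' x
    else path_max k' (false :: s) h M' x
  else M'.

Lemma path_max_ge k s h M x : Num.max M `|node_avg f s - h| <= path_max k s h M x.
Proof.
elim: k s M => [|k IH] s M //=.
by case: ifP => _; apply: le_trans (IH _ _); rewrite le_max lexx.
Qed.

Lemma path_maxS k s h M x : path_max k s h M x <= path_max k.+1 s h M x.
Proof.
elim: k s M => [|k IH] s M; last first.
  rewrite [leRHS]/= [leLHS]/=; case: ifP => _; exact: IH.
by rewrite /=; case: ifP => _; rewrite le_max lexx.
Qed.

Lemma path_max_node k t s h M x : S (t ++ s) x -> (size t <= k)%N ->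
  `|node_avg f (t ++ s) - h| <= path_max k s h M x.
Proof.
elim: k t s M => [|k IH] t s M.
  rewrite leqn0 => tx /eqP/size0nil -> /=.
  by rewrite le_max lexx orbT.
case/lastP: t => [|t b].
  move=> _ _; apply: le_trans (path_max_ge _ _ _ _ _).
  by rewrite le_max lexx orbT.
rewrite size_rcons cat_rcons ltnS => tx tk /=.
have bx : S (b :: s) x.
  elim: (t) tx => [//|c t' IHt] /= /node_sub; exact: IHt.
case: asboolP => [tr|fa]; last by case: b tx bx => // tx _; exact: IH.
case: b tx bx => tx bx; first exact: IH.
by have /disj_setPS := S_disj s; case/(_ x); split.
Qed.

Lemma measurable_path_max k s h M : measurable_fun setT (path_max k s h M).
Proof.
elim: k s M => [|k IH] s M /=; first exact: measurable_cst.
apply: measurable_fun_if => //; last 2 first.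
- exact: measurable_funTS.
- exact: measurable_funTS.
apply: (measurable_fun_bool true).
rewrite setTI (_ : _ @^-1` _ = S (true :: s)) //.
by apply/seteqP; split => x /=; [move=> /asboolP|move=> ?; apply/asboolP].
Qed.

Variable w : X -> R.
Hypothesis w0 : forall x, 0 <= w x.
Hypothesis wi : mu.-integrable (S [::]) (EFin \o w).

Let mw s : measurable_fun (S s) w.
Proof.
apply: measurable_funS (@node_sub_root s) _ => //.
by move/measurable_int/measurable_EFinP: wi.
Qed.

Lemma integral_exp_path_max e k s h M :
  (\int[mu]_(x in S s) (expR (e * path_max k s h M x) * w x)%:E =
   (exp_max f (fun s => \int[mu]_(x in S s) w x) e k s h M)%:E)%E.
Proof.
elim: k s M => [|k IH] s M /=.
  under eq_integral do rewrite EFinM.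
  rewrite ge0_integralZl_EFin ?expR_ge0//; last 2 first.
  - by move=> x _; rewrite lee_fin.
  - exact/measurable_EFinP.
  rewrite EFinM /Rintegral fineK//; apply: integrable_fin_num => //.
  by apply: integrableS wi => //; exact: node_sub_root.
rewrite {1}S_split ge0_integral_setU//; last 2 first.
- apply/measurable_EFinP; rewrite -S_split; apply: measurable_funM => //.
  apply: measurableT_comp => //; apply: measurable_funM => //.
  exact: measurable_funTS (measurable_path_max k.+1 s h M).
- by move=> x _; rewrite lee_fin mulr_ge0// expR_ge0.
rewrite EFinD -!IH; apply: f_equal2; apply: eq_integral => x; rewrite inE => sx.
  by rewrite asboolT.
rewrite asboolF// => tx; have /disj_setPS := S_disj s.
by case/(_ x); split.
Qed.

(** Where all averages along the branch stay within [q] of [h], so does [f]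
    itself, by [node_avg_le_ae] applied to [f] and to [- f]; rational [q] give a
    single null set. *)
Lemma dev_le_path_max_ae h : {ae mu, forall x, S [::] x ->
  forall q : R, q < `|f x - h| -> exists k, q < path_max k [::] h 0 x}.
Proof.
pose D (q : R) := [set x | S [::] x /\ forall k, path_max k [::] h 0 x <= q].
have mD q : measurable (D q).
  have -> : D q = S [::] `&` \bigcap_k (path_max k [::] h 0 @^-1` `]-oo, q]).
    apply/seteqP; split => x /= -[Qx Dx]; split => // k.
      by move=> _ /=; rewrite in_itv/=.
    by have := Dx k I; rewrite /= in_itv.
  apply: measurableI => //; apply: bigcapT_measurable => k.
  by rewrite -[X in measurable X]setTI; exact: measurable_path_max.
have DQ q : D q `<=` S [::] by move=> x [].
have near q s : S s `&` D q !=set0 -> `|node_avg f s - h| <= q.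
  move=> [x [sx [_ /(_ (size s)) Dx]]]; apply: le_trans Dx.
  by have := @path_max_node (size s) s [::] h 0 x; rewrite cats0; apply.
have up q : mu (D q `&` [set x | h + q < f x]) = 0%E.
  apply: node_avg_le_ae => // s /near; rewrite ler_norml => /andP[_].
  by rewrite lerBlDr addrC.
have nfi : mu.-integrable (S [::]) (EFin \o (fun x => - f x)).
  exact: (integrableN fi).
have down q : mu (D q `&` [set x | q - h < - f x]) = 0%E.
  apply: node_avg_le_ae => // s /near; rewrite ler_norml => /andP[+ _].
  have -> : node_avg (fun x => - f x) s = - node_avg f s.
    rewrite /node_avg -mulrN; congr (_ * _).
    have := @RintegralZl _ _ _ mu (S s) f (-1) (mS s) (node_integrable fi s).
    by rewrite mulN1r => <-; apply: eq_Rintegral => x _; rewrite mulN1r.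
  by lra.
have rat_null (r : rat) : mu.-negligible (D (ratr r) `&`
    ([set x | h + ratr r < f x] `|` [set x | ratr r - h < - f x])).
  rewrite setIUr; apply: negligibleU; apply/negligibleP; do ?[exact: up|exact: down].
    have mf : measurable_fun (S [::]) f by move/measurable_int/measurable_EFinP: fi.
    have -> : D (ratr r) `&` [set x | h + ratr r < f x] =
        D (ratr r) `&` (S [::] `&` f @^-1` `]h + ratr r, +oo[).
      rewrite setIA (setIidl (@DQ _)).
      by apply/seteqP; split => x /=; rewrite in_itv/= andbT.
    by apply: measurableI => //; exact: mf.
  have mf : measurable_fun (S [::]) (fun x => - f x).
    by move/measurable_int/measurable_EFinP: nfi.
  have -> : D (ratr r) `&` [set x | ratr r - h < - f x] =
      D (ratr r) `&` (S [::] `&` (fun x => - f x) @^-1` `]ratr r - h, +oo[).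
    rewrite setIA (setIidl (@DQ _)).
    by apply/seteqP; split => x /=; rewrite in_itv/= andbT.
  by apply: measurableI => //; exact: mf.
have : {ae mu, forall x, forall n, if unpickle n is Some r then
    ~ (D (ratr r) `&` ([set x | h + ratr r < f x] `|`
                       [set x | ratr r - h < - f x])) x else True}.
  apply: ae_foralln => n; case: unpickle => [r|]; last exact: aeW.
  have [N [mN N0 sub]] := rat_null r; exists N; split => // x /= nx.
  by apply: sub; exact: contrapT.
apply: filterS => x ratx Qx q /rat_in_itvoo [r].
rewrite in_itv/= => /andP[qr rf].
apply: contrapT => /forallNP small.
have := ratx (pickle r); rewrite pickleK; apply; split.
  split=> // k; have /negP := small k; rewrite -leNgt => /le_trans; apply.
  exact: ltW.
by move: rf; rewrite lter_normr => /orP[rf|rf]; [left|right] => /=; lra.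
Qed.

Variables (A : R) (v : X -> R) (th : R).
Hypothesis A0 : 0 < A.
Hypothesis osc : forall s,
  \int[mu]_(x in S s) `|f x - node_avg f s| <= A * m s.
Hypothesis v0 : forall x, 0 <= v x.
Hypothesis vi : mu.-integrable (S [::]) (EFin \o v).
Hypothesis th1 : 2^-1 <= th < 1.
Local Notation V E := (\int[mu]_(x in E) v x).
Hypothesis v_Ainf : forall s E, measurable E -> E `<=` S s ->
  2 * fine (mu E) <= m s -> V E <= th * V (S s).

Local Notation rate := (ln ((1 + th) / (2 * th)) / (4 * A)).

(** The weighted John-Nirenberg inequality on the tree: letting the depth tend
    to infinity in [exp_max_bound].  The weight [w] is compared with the
    A-infinity weight [v] on the nodes only. *)
Lemma john_nirenberg_exp (C : R) : 0 <= C ->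
  (forall s, \int[mu]_(x in S s) w x <= C * V (S s)) ->
  (\int[mu]_(x in S [::])
     (expR (rate * `|f x - node_avg f [::]|) * w x)%:E <=
   (C * (4 / (1 - th) * V (S [::])))%:E)%E.
Proof.
move=> C0 wv; case/andP: th1 => th2 th3.
set e := rate; set h := node_avg f [::].
have e0 : 0 < e.
  rewrite divr_gt0 ?ln_gt0 ?mulr_gt0//; rewrite ltr_pdivlMr; lra.
pose g k x := ((expR (e * path_max k [::] h 0 x) * w x)%:E)%E.
have mQ := mS [::].
have mf : measurable_fun (S [::]) f by move/measurable_int/measurable_EFinP: fi.
have mg k : measurable_fun (S [::]) (g k).
  apply/measurable_EFinP; apply: measurable_funM => //.
  apply: measurableT_comp => //; apply: measurable_funM => //.
  exact: measurable_funTS (measurable_path_max k [::] h 0).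
have g0 k x : S [::] x -> (0 <= g k x)%E.
  by move=> _; rewrite lee_fin mulr_ge0// expR_ge0.
have gS x : S [::] x -> nondecreasing_seq (g ^~ x).
  move=> _; apply/nondecreasing_seqP => k.
  by rewrite lee_fin ler_wpM2r// ler_expR ler_pM2l// path_maxS.
have cvg := cvg_monotone_convergence (mu := mu) mQ mg g0 gS.
apply: le_trans (_ : (_ <= \int[mu]_(x in S [::]) limn (g ^~ x))%E) _; last first.
  rewrite -(cvg_lim _ cvg)//; apply: lime_le; first by apply/cvg_ex; eexists; exact: cvg.
  near=> k; rewrite /g integral_exp_path_max lee_fin.
  apply: le_trans (@exp_max_le f _ _ C e k [::] h 0 wv) _.
  rewrite ler_wpM2l//.
  exact: (exp_max_bound fi A0 osc v0 vi th1 v_Ainf).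
apply: ae_ge0_le_integral => //.
- by move=> x _; rewrite lee_fin mulr_ge0// expR_ge0.
- apply/measurable_EFinP; apply: measurable_funM => //.
  apply: measurableT_comp => //; apply: measurable_funM => //.
  by apply: measurableT_comp => //; apply: measurable_funB.
- move=> x Qx; apply: lime_ge; first exact: ereal_nondecreasing_is_cvgn (gS x Qx).
  by near=> k; exact: g0.
- apply: (@emeasurable_fun_cvg _ X R (S [::]) g) => // x Qx.
  exact: ereal_nondecreasing_is_cvgn (gS x Qx).
apply: filterS (dev_le_path_max_ae h) => x devx Qx.
have cx := ereal_nondecreasing_is_cvgn (gS x Qx).
have gl k : (g k x <= limn (g ^~ x))%E.
  apply: lime_ge => //; near=> j; apply: gS => //.
  by near: j; exact: nbhs_infty_ge.
have [wx0|wx0] := eqVneq (w x) 0.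
  by rewrite wx0 mulr0; apply: le_trans (gl 0%N); exact: g0.
have wx : 0 < w x by rewrite lt_neqAle eq_sym wx0 w0.
have [L LE] : exists L, limn (g ^~ x) = L by eexists.
rewrite LE; case: L LE => [L| |] LE; last 2 first.
- by rewrite leey.
- by have := gl 0%N; rewrite LE.
rewrite lee_fin -ler_pdivlMr// leNgt; apply/negP => lt.
have Lw0 : 0 < L / w x.
  rewrite divr_gt0//; have := gl 0%N; rewrite LE lee_fin; apply: lt_le_trans.
  by rewrite mulr_gt0// expR_gt0.
have : ln (L / w x) / e < `|f x - h|.
  by rewrite ltr_pdivrMr// [X in _ < X]mulrC -ltr_expR lnK.
move=> /(devx Qx) [k]; rewrite ltr_pdivrMr// [X in _ < X]mulrC -ltr_expR lnK//.
rewrite ltr_pdivrMr// ltNge => /negP; apply.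
by have := gl k; rewrite LE lee_fin.
Unshelve. all: by end_near.
Qed.

End exponential_integrability.
End john_nirenberg_tree.

(** * Balls and boxes *)

Lemma measurable_sqrtr (R : realType) : measurable_fun setT (@Num.sqrt R).
Proof. by apply: continuous_measurable_fun; exact: sqrt_continuous. Qed.

Section euclidean_geometry.
Context (R : realType) (n : nat).
Local Notation Rn := (Rn R n).
Local Notation mu := (leb R n).
Implicit Types (x y a : Rn) (r : R) (lo hi : 'I_n -> R).

Lemma edist_ge0 x y : 0 <= edist x y.
Proof. exact: sqrtr_ge0. Qed.

Lemma edist_sqr x y :
  edist x y ^+ 2 = \sum_(i < n) ((tnth x i : R) - tnth y i) ^+ 2.
Proof. by rewrite sqr_sqrtr// sumr_ge0// => i _; exact: sqr_ge0. Qed.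

Lemma coord_le_edist x y i : `|(tnth x i : R) - tnth y i| <= edist x y.
Proof.
rewrite -(@ler_pXn2r _ 2)// ?nnegrE ?edist_ge0// edist_sqr real_normK ?num_real//.
rewrite (bigD1 i)//= lerDl sumr_ge0// => j _; exact: sqr_ge0.
Qed.

(** With the factor [n.+1] in place of the square root of [n] the inequality is
    strict. *)
Lemma edist_lt x y r : 0 < r ->
  (forall i, `|(tnth x i : R) - tnth y i| <= r) -> edist x y < n.+1%:R * r.
Proof.
move=> r0 xy; have nr0 : 0 < n.+1%:R * r by rewrite mulr_gt0.
rewrite -(@ltr_pXn2r _ 2)// ?nnegrE ?edist_ge0 ?ltW// edist_sqr.
apply: le_lt_trans (_ : _ <= \sum_(i < n) r ^+ 2) _.
  apply: ler_sum => i _; rewrite -(real_normK (num_real _)).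
  by rewrite ler_pXn2r// ?nnegrE// ltW.
rewrite sumr_const card_ord -[_ *+ n]mulr_natl [ltRHS]exprMn ltr_pM2r ?exprn_gt0//.
rewrite -natrX ltr_nat; apply: (@leq_trans n.+1) => //.
by rewrite -mulnn leq_pmulr.
Qed.

(** Squares of distances satisfy the triangle inequality up to a factor 2, which
    is enough here. *)
Lemma edist_far x y a r : edist x a < r -> 2 * r <= edist y a ->
  edist y a / 2 <= edist x y.
Proof.
move=> xa ya; have r0 : 0 <= r by apply: le_trans (ltW xa); exact: edist_ge0.
rewrite -(@ler_pXn2r _ 2)// ?nnegrE ?edist_ge0 ?divr_ge0 ?edist_ge0//.
have h : edist y a ^+ 2 <= 2 * edist x a ^+ 2 + 2 * edist x y ^+ 2.
  rewrite !edist_sqr !mulr_sumr -big_split/=; apply: ler_sum => i _.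
  set u : R := tnth x i; set v : R := tnth y i; set c : R := tnth a i.
  have := sqr_ge0 ((u - c) + (u - v)).
  nra.
have h2 : 2 * edist x a ^+ 2 <= edist y a ^+ 2 / 2.
  have := edist_ge0 x a; nra.
by rewrite exprMn; lra.
Qed.

Lemma measurable_coord i : measurable_fun setT (fun x => tnth x i : R).
Proof. exact: measurable_tnth. Qed.

Lemma measurable_edist a : measurable_fun setT (fun x => edist x a).
Proof.
apply: measurableT_comp => /=; first exact: measurable_sqrtr.
apply: (measurable_sum _ (h := fun i x => ((tnth x i : R) - tnth a i) ^+ 2)) => i.
apply: measurable_funX; apply: measurable_funB => //.
exact: measurable_coord.
Qed.

Lemma measurable_eball a r : measurable (eball a r).
Proof.
have -> : eball a r = (fun x => edist x a) @^-1` `]-oo, r[.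
  by apply/seteqP; split => x; rewrite /eball/= in_itv.
by rewrite -[X in measurable X]setTI; exact: measurable_edist.
Qed.

Lemma eballS a r r' : r <= r' -> eball a r `<=` eball a r'.
Proof. by move=> rr' x; rewrite /eball/= => /lt_le_trans; apply. Qed.

Definition box lo hi : set Rn :=
  [set x | forall i, lo i <= (tnth x i : R) < hi i].

Lemma measurable_box lo hi : measurable (box lo hi).
Proof.
have -> : box lo hi = \big[setI/setT]_(i < n)
    ((fun x => tnth x i : R) @^-1` `[lo i, hi i[).
  rewrite -bigcap_seq; apply/seteqP; split => x /=.
    by move=> xb i _; rewrite /= in_itv/=; exact: xb.
  by move=> xb i; have := xb i; rewrite /= in_itv/=; apply; rewrite mem_index_enum.
apply: bigsetI_measurable => i _.
by rewrite -[X in measurable X]setTI; exact: measurable_coord.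
Qed.

End euclidean_geometry.

Lemma leb_box (R : realType) n (lo hi : 'I_n -> R) :
  (forall i, lo i <= hi i) -> leb R n (box lo hi) = (\prod_(i < n) (hi i - lo i))%:E.
Proof.
elim: n lo hi => [|n IH] lo hi lohi.
  by rewrite big_ord0 /= /point_measure diracE mem_set// => -[].
rewrite /= /cons_measure /pushforward.
have -> : @tcons R n @^-1` (box lo hi) =
    `[lo ord0, hi ord0[ `*` box (lo \o lift ord0) (hi \o lift ord0).
  apply/seteqP; split => -[x t] /=.
    move=> xt; split; first by have := xt ord0; rewrite tnth0 /= in_itv.
    by move=> i; have := xt (lift ord0 i); rewrite tnthS.
  move=> [x0 xt] i; case: (unliftP ord0 i) => [j ->|->].
    by rewrite tnthS; exact: xt.
  by rewrite tnth0; move: x0; rewrite in_itv.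
rewrite product_measure1E//; last exact: measurable_box.
rewrite IH => [|i]; last exact: lohi.
rewrite big_ord_recl EFinM; congr (_ * _)%E.
apply: etrans (lebesgue_measure_itv `[lo ord0, hi ord0[) _.
rewrite /= lte_fin; case: ltP => //.
by move=> h; have := lohi ord0; rewrite le_eqVlt ltNge h orbF => /eqP ->; rewrite subrr.
Qed.

Section balls.
Context (R : realType) (n : nat).
Local Notation Rn := (Rn R n).
Local Notation mu := (leb R n).
Implicit Types (x y a : Rn) (r : R).

Definition cube a r : set Rn :=
  box (fun i => (tnth a i : R) - r) (fun i => (tnth a i : R) + r).

Lemma leb_cube a r : 0 <= r -> mu (cube a r) = ((2 * r) ^+ n)%:E.
Proof.
move=> r0; rewrite /cube leb_box => [|i]; last by lra.
congr EFin; rewrite (eq_bigr (fun=> 2 * r)); last by move=> i _; ring.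
by rewrite prodr_const card_ord.
Qed.

Lemma eball_sub_cube a r : eball a r `<=` cube a r.
Proof.
move=> x xa i; have := le_lt_trans (coord_le_edist x a i) xa.
by rewrite ltr_norml => /andP[h1 h2]; apply/andP; split; lra.
Qed.

Lemma cube_sub_eball a r : 0 < r -> cube a r `<=` eball a (n.+1%:R * r).
Proof.
move=> r0 x xa; apply: edist_lt => // i; have /andP[h1 h2] := xa i.
by rewrite ler_norml; apply/andP; split; lra.
Qed.

Lemma leb_eball_le a r : 0 <= r -> (mu (eball a r) <= ((2 * r) ^+ n)%:E)%E.
Proof.
move=> r0; rewrite -(leb_cube a r0); apply: le_measure; rewrite ?inE.
- exact: measurable_eball.
- exact: measurable_box.
exact: eball_sub_cube.
Qed.

Lemma leb_eball_ge a r : 0 < r ->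
  (((2 * (r / n.+1%:R)) ^+ n)%:E <= mu (eball a r))%E.
Proof.
move=> r0; have rn0 : 0 < r / n.+1%:R by rewrite divr_gt0.
rewrite -(leb_cube a (ltW rn0)); apply: le_measure; rewrite ?inE.
- exact: measurable_box.
- exact: measurable_eball.
rewrite -[X in eball a X](_ : n.+1%:R * (r / n.+1%:R) = r); last first.
  by rewrite mulrCA divff ?mulr1// pnatr_eq0.
exact: cube_sub_eball.
Qed.

End balls.

(** * A binary tree of boxes *)

Section box_tree.
Context (R : realType) (n : nat) (i0 : 'I_n).
Local Notation Rn := (Rn R n).
Local Notation mu := (leb R n).
Local Notation bounds := (('I_n -> R) * ('I_n -> R))%type.
Implicit Types (B : bounds) (x : Rn).

Definition side B i : R := B.2 i - B.1 i.

Definition longest B : 'I_n := [arg max_(i > i0) side B i]%O.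

Lemma side_le_longest B i : side B i <= side B (longest B).
Proof. by rewrite /longest; case: arg_maxP => // j _; exact. Qed.

Definition halve (b : bool) B : bounds :=
  let j := longest B in let c := (B.1 j + B.2 j) / 2 in
  if b then (B.1, fun i => if i == j then c else B.2 i)
  else (fun i => if i == j then c else B.1 i, B.2).

Lemma side_halve b B i : side (halve b B) i =
  if i == longest B then side B i / 2 else side B i.
Proof. by case: b; rewrite /side /=; case: eqVneq => // ->; lra. Qed.

(** Always halving the longest side keeps the boxes fat. *)
Definition fat B :=
  (forall i, 0 < side B i) /\ forall i j, side B i <= 2 * side B j.

Lemma fat_halve b B : fat B -> fat (halve b B).
Proof.
move=> [B0 B2]; split=> [i|i j]; rewrite !side_halve.
  by case: ifP => // _; rewrite divr_gt0.
have := side_le_longest B i; have := side_le_longest B j.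
have := B0 i; have := B0 j; have := B2 i j; have := B2 (longest B) j.
by case: eqVneq => [->|_]; case: eqVneq => [->|_]; lra.
Qed.

Lemma box_halve B : fat B ->
  box B.1 B.2 = box (halve true B).1 (halve true B).2 `|`
                box (halve false B).1 (halve false B).2.
Proof.
move=> [B0 _]; set j := longest B; have := B0 j; rewrite /side => Bj.
apply/seteqP; split => x /=.
  move=> xB; have /andP[x1 x2] := xB j.
  case: (ltP (tnth x j : R) ((B.1 j + B.2 j) / 2)) => xj; [left|right] => i /=.
    by rewrite -/j; case: eqVneq => [->|_]; [rewrite x1|exact: xB].
  by rewrite -/j; case: eqVneq => [->|_]; [rewrite xj|exact: xB].
move=> [] xB i; have := xB i; rewrite /= -/j; case: eqVneq => [->|//];
  move=> /andP[x1 x2]; apply/andP; split => //; lra.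
Qed.

Lemma box_halve_disj B : [disjoint box (halve true B).1 (halve true B).2 &
                                   box (halve false B).1 (halve false B).2].
Proof.
apply/disj_setPS => x /= -[/(_ (longest B)) + /(_ (longest B))] /=.
by rewrite eqxx => /andP[_ h] /andP[]; rewrite leNgt h.
Qed.

Definition volume B := \prod_(i < n) side B i.

Lemma volume_halve b B : volume (halve b B) = volume B / 2.
Proof.
rewrite /volume (bigD1 (longest B))//= [in RHS](bigD1 (longest B))//=.
rewrite side_halve eqxx -!mulrA [2^-1 * _]mulrC; congr (_ * (_ * _)).
by apply: eq_bigr => i /negbTE ij; rewrite side_halve ij.
Qed.

Lemma leb_fat B : fat B -> mu (box B.1 B.2) = (volume B)%:E.
Proof.
move=> [B0 _]; rewrite leb_box// => i; have := B0 i.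
by rewrite subr_gt0; exact: ltW.
Qed.

Lemma volume_gt0 B : fat B -> 0 < volume B.
Proof. by move=> [B0 _]; apply: prodr_gt0. Qed.

Lemma volume_ge B : fat B -> (side B (longest B) / 2) ^+ n <= volume B.
Proof.
move=> [B0 B2]; rewrite -[n in _ ^+ n]card_ord -prodr_const.
apply: ler_prod => i _; have := B2 (longest B) i; have := B0 (longest B).
by move=> h1 h2; apply/andP; split; lra.
Qed.

Lemma fat_sub_eball B : fat B -> exists a r, [/\ 0 < r,
  box B.1 B.2 `<=` eball a r &
  (mu (eball a r) <= ((4 * n.+1%:R) ^+ n * volume B)%:E)%E].
Proof.
move=> fB; have [B0 B2] := fB; set M := side B (longest B).
have M0 : 0 < M by exact: B0.
pose a : Rn := [tuple (B.1 i + B.2 i) / 2 | i < n].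
have ai i : tnth a i = (B.1 i + B.2 i) / 2 by rewrite tnth_mktuple.
exists a, (n.+1%:R * M); split.
- by rewrite mulr_gt0.
- move=> x xB; apply: edist_lt => // i; rewrite ai.
  have /andP[h1 h2] := xB i; have := side_le_longest B i.
  rewrite -/M /side => h3.
  by rewrite ler_norml; apply/andP; split; have := B0 i; rewrite /side; lra.
apply: le_trans (leb_eball_le a _) _; first by rewrite mulr_ge0// ltW.
rewrite lee_fin; have -> : 2 * (n.+1%:R * M) = 4 * n.+1%:R * (M / 2) by field.
rewrite exprMn ler_wpM2l ?exprn_ge0 ?mulr_ge0//; exact: volume_ge.
Qed.

Variable B : bounds.
Hypothesis fB : fat B.

Fixpoint node (s : seq bool) : bounds :=
  if s is b :: s' then halve b (node s') else B.

Definition nodebox s : set Rn := box (node s).1 (node s).2.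

Lemma fat_node s : fat (node s).
Proof. by elim: s => //= b s; exact: fat_halve. Qed.

Lemma volume_node s : volume (node s) = volume B * 2^-1 ^+ size s.
Proof.
elim: s => [|b s IH] /=; first by rewrite mulr1.
by rewrite volume_halve IH exprS; ring.
Qed.

Lemma nodebox_measurable s : measurable (nodebox s).
Proof. exact: measurable_box. Qed.

Lemma nodebox_split s :
  nodebox s = nodebox (true :: s) `|` nodebox (false :: s).
Proof. exact/box_halve/fat_node. Qed.

Lemma nodebox_disj s : [disjoint nodebox (true :: s) & nodebox (false :: s)].
Proof. exact: box_halve_disj. Qed.

Lemma leb_nodebox s : mu (nodebox s) = (volume (node s))%:E.
Proof. exact/leb_fat/fat_node. Qed.

Lemma nodebox_half b s : (mu (nodebox s) = 2%:E * mu (nodebox (b :: s)))%E.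
Proof.
by rewrite !leb_nodebox /= volume_halve -EFinM; congr EFin; field.
Qed.

Lemma nodebox_root : (0 < mu (nodebox [::]) < +oo)%E.
Proof. by rewrite leb_nodebox/= lte_fin ltry volume_gt0. Qed.

Lemma node_small (d : R) : 0 < d ->
  exists k, forall s i, size s = k -> side (node s) i < d.
Proof.
move=> d0; have dn : 0 < (d / 2) ^+ n by rewrite exprn_gt0// divr_gt0.
have : (fun k => volume B * 2^-1 ^+ k) @ \oo --> volume B * 0.
  apply: cvgM; first exact: cvg_cst.
  by apply: cvg_expr; rewrite ger0_norm ?invr_ge0// invf_lt1// ltr1n.
rewrite mulr0 => /cvgrPdist_lt /(_ _ dn) [k _ /(_ k (leqnn k))] /=.
rewrite sub0r normrN => hk; exists k => s i sk.
apply: le_lt_trans (side_le_longest _ _) _; rewrite ltNge; apply/negP => dM.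
have := volume_ge (fat_node s); rewrite volume_node sk => h.
have := le_lt_trans (ler_norm _) hk; rewrite ltNge => /negP; apply.
apply: le_trans h; rewrite ler_pXn2r// ?nnegrE.
- by rewrite ler_pM2r ?invr_gt0.
- by apply: leq_ltn_trans (ltn_ord i0).
- by rewrite divr_ge0// ltW.
- by rewrite divr_ge0// ltW//; apply: lt_le_trans dM.
Qed.

Local Notation approx := (approx mu nodebox).

Lemma approx_root E F : measurable F -> E `&` nodebox [::] = F `&` nodebox [::] ->
  approx E -> approx F.
Proof.
move=> mF EF [mE aE]; split => // e e0; have [k [P lt]] := aE e e0.
exists k, P; suff <- : symd nodebox E (sel nodebox k [::] P) =
                       symd nodebox F (sel nodebox k [::] P) by [].
rewrite /symd EF; congr (_ `|` _); apply/seteqP.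
have sub := @sel_sub _ _ _ nodebox_split k P.
split=> x [Vx nx]; split => // h; apply: nx.
  have : (F `&` nodebox [::]) x by split=> //; exact: sub.
  by rewrite -EF => -[].
have : (E `&` nodebox [::]) x by split=> //; exact: sub.
by rewrite EF => -[].
Qed.

Lemma approx_node s : approx (nodebox s).
Proof.
split; first exact: nodebox_measurable.
move=> e e0; exists (size s), (pred1 s).
suff -> : symd nodebox (nodebox s) (sel nodebox (size s) [::] (pred1 s)) = set0.
  by rewrite measure0.
rewrite -subset0 => x [[[sx _]]|[/selP [t] ]]; last first.
  by rewrite cats0 => -[[_ /eqP -> ?]].
by apply; apply/selP; exists s; rewrite cats0 /=.
Qed.

(** It is enough to treat the half spaces below a coordinate hyperplane; such a
    half space is, inside the root, the union of the nodes that it contains,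
    because the sides of the nodes shrink to zero. *)
Lemma approx_box_tree E : measurable E -> approx E.
Proof.
have sa : sigma_algebra setT approx.
  exact: (approx_sigma_algebra nodebox_measurable nodebox_split nodebox_disj
    nodebox_root).
apply: smallest_sub => // A; rewrite -bigcup_seq/= => -[i _ [C mC <-]].
rewrite setTI.
suff : [set C | approx ((fun x : Rn => tnth x i : R) @^-1` C)] C by [].
have mC' : (@RGenInftyO.G R).-sigma.-measurable C by rewrite -RGenInftyO.measurableE.
move: C mC' {mC}; apply: smallest_sub.
  case: sa => s0 sC sU; split => /=.
  - by rewrite preimage_set0.
  - move=> D /sC; rewrite !setTD preimage_setC//.
  - by move=> F aF; rewrite preimage_bigcup; exact: sU.
move=> _ [c ->] /=.
set H := _ @^-1` _.
pose U := \bigcup_k (if @unpickle (seq bool) k is Some s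
  then (if `[< nodebox s `<=` H >] then nodebox s else set0) else set0).
apply: (@approx_root U).
- by rewrite -[X in measurable X]setTI; exact: measurable_coord.
- apply/seteqP; split => x [Ux Qx]; split => //.
    move: Ux => [k _]; case: unpickle => // s.
    by case: asboolP => // sE /sE.
  have xc : 0 < c - (tnth x i : R).
    by move: Ux; rewrite /H/= in_itv/= subr_gt0.
  have [k small] := node_small xc.
  have [s sk sx] := node_ex nodebox_split k Qx.
  exists (pickle s) => //; rewrite pickleK asboolT// => y sy.
  rewrite /H/= in_itv/=; have := small s i sk; rewrite /side.
  by have /andP[] := sx i; have /andP[] := sy i; lra.
case: sa => s0 _ sU; apply: sU => k /=.
by case: asboolP => // _; exact: approx_node.
Qed.

End box_tree.

(** * The weighted John-Nirenberg inequality on balls *)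

Section real_integral_bounds.
Context d (X : measurableType d) (R : realType).
Variable mu : {measure set X -> \bar R}.

Lemma subset_Rintegral (E F : set X) (f : X -> R) : measurable E -> measurable F ->
  E `<=` F -> mu.-integrable F (EFin \o f) -> (forall x, 0 <= f x) ->
  \int[mu]_(x in E) f x <= \int[mu]_(x in F) f x.
Proof.
move=> mE mF EF fi f0; have fiE := integrableS mF mE EF fi.
rewrite /Rintegral fine_le//; [exact: integrable_fin_num..|].
apply: ge0_subset_integral => //; first exact: measurable_int fi.
by move=> x _; rewrite lee_fin.
Qed.

Lemma integrable_cst (E : set X) (b : R) : measurable E -> (mu E < +oo)%E ->
  mu.-integrable E (EFin \o cst b).
Proof.
move=> mE Eoo; apply: measurable_bounded_integrable => //.
exact: bounded_cst.
Qed.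

Lemma integrable_dev (E : set X) (f : X -> R) (b : R) :
  measurable E -> (mu E < +oo)%E -> mu.-integrable E (EFin \o f) ->
  mu.-integrable E (EFin \o (fun x => `|f x - b|)).
Proof.
move=> mE Eoo fi; apply: (@integrable_norm _ _ _ _ E (fun x => f x - b)).
exact: (integrableB mE fi (integrable_cst b mE Eoo)).
Qed.

Lemma dist_of_dev (E : set X) (f : X -> R) (b1 b2 : R) :
  measurable E -> (mu E < +oo)%E -> mu.-integrable E (EFin \o f) ->
  fine (mu E) * `|b1 - b2| <=
    \int[mu]_(x in E) `|f x - b1| + \int[mu]_(x in E) `|f x - b2|.
Proof.
move=> mE Eoo fi; rewrite mulrC -Rintegral_cst// -RintegralD//;
  [|exact: integrable_dev..].
apply: le_Rintegral => //.
- exact: integrable_cst.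
- exact: (integrableD mE (integrable_dev b1 mE Eoo fi) (integrable_dev b2 mE Eoo fi)).
move=> x _; have -> : b1 - b2 = (f x - b2) - (f x - b1) by ring.
by rewrite [leRHS]addrC ler_normB.
Qed.

End real_integral_bounds.

Lemma powR_le_expR (R : realType) (m y : R) : 0 < m -> 0 <= y ->
  y `^ m <= m `^ m * expR y.
Proof.
move=> m0 y0.
have -> : y = m * (y / m) by rewrite mulrC divfK// gt_eqF.
have ym0 : 0 <= y / m by rewrite divr_ge0// ltW.
rewrite powRM ?(ltW m0)// mulrC [m * _]mulrC [leRHS]mulrC ler_wpM2r ?powR_ge0//.
rewrite expRM ge0_ler_powR ?nnegrE ?expR_ge0 ?(ltW m0)//.
by apply: le_trans (expR_ge1Dx _); rewrite lerDr.
Qed.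

Lemma powRD_le (R : realType) (m x y : R) : 0 <= m -> 0 <= x -> 0 <= y ->
  (x + y) `^ m <= 2 `^ m * (x `^ m + y `^ m).
Proof.
move=> m0 x0 y0; wlog xy : x y x0 y0 / x <= y.
  move=> H; have [xy|yx] := leP x y; first exact: H.
  by rewrite addrC [x `^ _ + _]addrC; apply: H => //; exact: ltW.
apply: le_trans (_ : _ <= (2 * y) `^ m) _.
  by apply: ge0_ler_powR; rewrite ?nnegrE ?addr_ge0 ?mulr_ge0//; lra.
by rewrite powRM// ler_wpM2l ?powR_ge0// lerDr powR_ge0.
Qed.

Section john_nirenberg_balls.
Context (R : realType) (n : nat) (i0 : 'I_n).
Local Notation Rn := (Rn R n).
Local Notation mu := (leb R n).
Implicit Types (a x : Rn) (r : R) (g v w : Rn -> R).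

Lemma leb_eball_lty a r : (mu (eball a r) < +oo)%E.
Proof.
have [r0|r0] := leP 0 r; first by apply: le_lt_trans (leb_eball_le a r0) _; rewrite ltry.
suff -> : eball a r = set0 by rewrite measure0.
rewrite -subset0 => x; rewrite /eball/= => /(le_lt_trans (edist_ge0 _ _)).
by rewrite ltNge ltW.
Qed.

Definition ball_vol a r : R := fine (mu (eball a r)).

Lemma leb_eballE a r : mu (eball a r) = (ball_vol a r)%:E.
Proof. by rewrite fineK// ge0_fin_numE// leb_eball_lty. Qed.

Lemma ball_vol_le a r : 0 <= r -> ball_vol a r <= (2 * r) ^+ n.
Proof. by move=> r0; rewrite -lee_fin -leb_eballE leb_eball_le. Qed.

Lemma ball_vol_ge a r : 0 < r -> (2 * (r / n.+1%:R)) ^+ n <= ball_vol a r.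
Proof. by move=> r0; rewrite -lee_fin -leb_eballE leb_eball_ge. Qed.

Lemma ball_vol_gt0 a r : 0 < r -> 0 < ball_vol a r.
Proof.
by move=> r0; apply: lt_le_trans (ball_vol_ge a r0); rewrite exprn_gt0// mulr_gt0// divr_gt0.
Qed.

Lemma ball_vol_scale a r (k : R) : 0 < r -> 1 <= k ->
  ball_vol a (k * r) <= (k * n.+1%:R) ^+ n * ball_vol a r.
Proof.
move=> r0 k1; apply: le_trans (ball_vol_le _ _) _; first by rewrite mulr_ge0//; lra.
apply: le_trans (ler_wpM2l _ (ball_vol_ge a r0)); last first.
  by rewrite exprn_ge0// mulr_ge0//; lra.
rewrite -exprMn; have : n.+1%:R != 0 :> R by rewrite pnatr_eq0.
set N := n.+1%:R => N0; rewrite le_eqVlt; apply/orP; left; apply/eqP.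
by congr (_ ^+ _); field.
Qed.

Definition ball_integrable g :=
  forall a r, 0 < r -> mu.-integrable (eball a r) (EFin \o g).

(** A scale-invariant form of the A-infinity property. *)
Definition ball_Ainf K (th : R) v := forall a r F, 0 < r -> measurable F ->
  F `<=` eball a r ->
  fine (mu F) * (\int[mu]_(x in eball a r) v x) `^ th <=
    K * ball_vol a r * (\int[mu]_(x in F) v x) `^ th.

(** [b a r] plays the role of the mean of [g] over [eball a r]. *)
Definition ball_oscillation A g (b : Rn -> R -> R) := forall a r, 0 < r ->
  \int[mu]_(x in eball a r) `|g x - b a r| <= A * ball_vol a r.

(** On the smaller ball both constants approximate [g] in the mean. *)
Lemma oscillation_double A g b a r : ball_integrable g ->
  ball_oscillation A g b -> 0 < r ->
  `|b a (2 * r) - b a r| <= (1 + (2 * n.+1%:R) ^+ n) * A.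
Proof.
move=> gi osc r0; have r20 : 0 < 2 * r by rewrite mulr_gt0.
have V0 := ball_vol_gt0 a r0.
rewrite distrC -(ler_pM2l V0).
have h := dist_of_dev (b a r) (b a (2 * r)) (measurable_eball a r)
  (leb_eball_lty a r) (gi a r r0).
apply: le_trans h _.
have A0 : 0 <= A.
  have := osc a r r0; have : 0 <= \int[mu]_(x in eball a r) `|g x - b a r|.
    by apply: Rintegral_ge0.
  by move=> h1 h2; rewrite -(pmulr_lge0 _ V0); exact: le_trans h2.
have h1 : \int[mu]_(x in eball a r) `|g x - b a (2 * r)| <= A * ball_vol a (2 * r).
  apply: le_trans (osc a _ r20); apply: subset_Rintegral.
  - exact: measurable_eball.
  - exact: measurable_eball.
  - by apply: eballS; lra.
  - apply: integrable_dev => //; [exact: measurable_eball|exact: leb_eball_lty|].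
    exact: gi.
  - by move=> x.
have h2 := ball_vol_scale a r0 (ler1n R 2).
have := osc a r r0; have : A * ball_vol a (2 * r) <=
  A * ((2 * n.+1%:R) ^+ n * ball_vol a r) by rewrite ler_wpM2l.
by rewrite -/(ball_vol a r); lra.
Qed.

Variables (v : Rn -> R) (K th : R).
Hypothesis v0 : forall x, 0 <= v x.
Hypothesis vi : ball_integrable v.
Hypothesis K0 : 0 < K.
Hypothesis th0 : 0 < th.
Hypothesis vA : ball_Ainf K th v.
Local Notation V E := (\int[mu]_(x in E) v x).

Let V_ge0 E : 0 <= V E. Proof. by apply: Rintegral_ge0. Qed.

Lemma Ainf_fraction a r F k : 0 < r -> measurable F -> F `<=` eball a r ->
  0 < k -> ball_vol a r <= k * fine (mu F) ->
  V (eball a r) <= (K * k) `^ th^-1 * V F.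
Proof.
move=> r0 mF FB k0 kF; have B0 := ball_vol_gt0 a r0.
have F0 : 0 < fine (mu F).
  by rewrite -(pmulr_rgt0 _ k0); exact: lt_le_trans kF.
have h : V (eball a r) `^ th <= K * k * V F `^ th.
  rewrite -(ler_pM2l F0); apply: le_trans (vA r0 mF FB) _.
  rewrite [leRHS](_ : _ = K * (k * fine (mu F)) * V F `^ th); last by ring.
  by rewrite ler_wpM2r ?powR_ge0// ler_wpM2l// ltW.
have tV E : V E = (V E `^ th) `^ th^-1.
  by rewrite -powRrM divff ?gt_eqF// powRr1.
rewrite [leLHS]tV [V F]tV -powRM ?powR_ge0 ?mulr_ge0 ?(ltW K0) ?(ltW k0)//.
apply: ge0_ler_powR; rewrite ?nnegrE ?invr_ge0 ?(ltW th0) ?powR_ge0//.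
by rewrite !mulr_ge0 ?powR_ge0 ?(ltW K0) ?(ltW k0).
Qed.

Lemma Ainf_doubling a r : 0 < r ->
  V (eball a (2 * r)) <= (K * (2 * n.+1%:R) ^+ n) `^ th^-1 * V (eball a r).
Proof.
move=> r0; apply: Ainf_fraction.
- by rewrite mulr_gt0.
- exact: measurable_eball.
- by apply: eballS; lra.
- by rewrite exprn_gt0// mulr_gt0.
- exact: ball_vol_scale (ler1n R 2).
Qed.

(** The ball lies in the cube with the same centre, which is the root of a tree
    of boxes.  Each box lies in a ball of comparable measure, so the mean
    oscillation, the A-infinity property of [v] and the domination of [w] by [v]
    pass from balls to the nodes; the moments are then bounded by the exponential
    integral.  The constant [C] depends only on the weights and on [m]. *)
Lemma john_nirenberg_ball (w : Rn -> R) (C0 m : R) :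
  (forall x, 0 <= w x) -> ball_integrable w -> 0 < C0 ->
  (forall a r, 0 < r -> \int[mu]_(x in eball a r) w x <= C0 * V (eball a r)) ->
  0 < m ->
  exists2 C : R, 0 < C & forall g A b, ball_integrable g ->
    measurable_fun setT g -> 0 < A ->
    ball_oscillation A g b -> forall a r, 0 < r ->
    (\int[mu]_(x in eball a r) (`|g x - b a r| `^ m * w x)%:E <=
       (C * A `^ m * V (eball a r))%:E)%E.
Proof.
move=> w0 wi C00 wv m0.
pose k : R := (4 * n.+1%:R) ^+ n.
have k0 : 0 < k by rewrite exprn_gt0// mulr_gt0.
pose k1 : R := (n.+1%:R * n.+1%:R) ^+ n.
have k10 : 0 < k1 by rewrite exprn_gt0// mulr_gt0.
pose c := ((K * (2 * k)) `^ th^-1)^-1.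
have c0 : 0 < c by rewrite invr_gt0 powR_gt0// !mulr_gt0.
(* If a subset has at most half of the measure of a node, its complement keeps
   at least the fraction [c] of the weight. *)
pose q := Num.max 2^-1 (1 - c).
have q1 : 2^-1 <= q < 1.
  by rewrite le_max lexx /= gt_max; apply/andP; split; [lra|rewrite gtrDl oppr_lt0].
have /andP[q2 q3] := q1.
pose D := (K * k) `^ th^-1.
have D0 : 0 < D by rewrite powR_gt0// mulr_gt0.
pose D1 := (K * k1) `^ th^-1.
have D10 : 0 < D1 by rewrite powR_gt0// mulr_gt0.
(* The decay rate of the tree inequality for the oscillation [2 * k * A]. *)
pose e0 := ln ((1 + q) / (2 * q)) / (4 * (2 * k)).
have e00 : 0 < e0.
  by rewrite divr_gt0 ?ln_gt0 ?mulr_gt0// ltr_pdivlMr; lra.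
pose C1 := C0 * D * (4 / (1 - q)) * D1.
have q40 : 0 < 4 / (1 - q) by rewrite divr_gt0// subr_gt0.
have C10 : 0 < C1 := mulr_gt0 (mulr_gt0 (mulr_gt0 C00 D0) q40) D10.
pose E := (2 * k * k1 + 1).
have E0 : 0 < E by rewrite addr_gt0// !mulr_gt0.
exists (2 `^ m * ((m / e0) `^ m * C1 + E `^ m * C0)).
  have me0 : 0 < m / e0 by rewrite divr_gt0.
  have h1 := mulr_gt0 (powR_gt0 m me0) C10.
  have h2 := mulr_gt0 (powR_gt0 m E0) C00.
  by rewrite mulr_gt0 ?powR_gt0// addr_gt0.
move=> g A b gi mg A0 osc a r r0.
pose B := (fun i => (tnth a i : R) - r, fun i => (tnth a i : R) + r).
have fB : fat B.
  by split=> [i|i j]; rewrite /side /B /=; lra.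
pose S := nodebox i0 B.
have mS s : measurable (S s) by exact: nodebox_measurable.
have sub := @node_sub_root _ _ _ (nodebox_split i0 fB).
have QE : S [::] = cube a r by [].
have r1 : 0 < n.+1%:R * r by rewrite mulr_gt0.
have QB1 : S [::] `<=` eball a (n.+1%:R * r) by exact: cube_sub_eball.
have BQ : eball a r `<=` S [::] by exact: eball_sub_cube.
have mB := measurable_eball a r.
have gQ : mu.-integrable (S [::]) (EFin \o g).
  by apply: integrableS (gi a _ r1) => //; exact: measurable_eball.
have vQ : mu.-integrable (S [::]) (EFin \o v).
  by apply: integrableS (vi a r1) => //; exact: measurable_eball.
have wQ : mu.-integrable (S [::]) (EFin \o w).
  by apply: integrableS (wi a _ r1) => //; exact: measurable_eball.
have gS s : mu.-integrable (S s) (EFin \o g) by apply: integrableS gQ.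
have Soo s : (mu (S s) < +oo)%E by rewrite (leb_nodebox i0 fB) ltry.
have muS s : 0 < fine (mu (S s)).
  by rewrite (leb_nodebox i0 fB) /= volume_gt0//; exact: fat_node.
have inball s : exists a' r', [/\ 0 < r', S s `<=` eball a' r' &
    ball_vol a' r' <= k * fine (mu (S s))].
  have [a' [r' [r'0 h1 h2]]] := fat_sub_eball i0 (fat_node i0 fB s).
  exists a', r'; split => //; rewrite -lee_fin -leb_eballE.
  by rewrite (leb_nodebox i0 fB).
have oscS s : \int[mu]_(x in S s) `|g x - node_avg mu S g s| <=
    (2 * k * A) * fine (mu (S s)).
  have [a' [r' [r'0 SB Bk]]] := inball s.
  have h1 : \int[mu]_(x in S s) `|g x - b a' r'| <= A * (k * fine (mu (S s))).
    apply: le_trans (ler_wpM2l (ltW A0) Bk).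
    apply: le_trans (osc a' r' r'0); apply: subset_Rintegral => //.
      exact: measurable_eball.
    apply: integrable_dev; [exact: measurable_eball|exact: leb_eball_lty|exact: gi].
  have h2 := node_avg_dev mS (nodebox_split i0 fB)
    (nodebox_half i0 fB) (nodebox_root i0 fB) gQ (b a' r') s.
  have -> : 2 * k * A * fine (mu (S s)) =
    A * (k * fine (mu (S s))) + A * (k * fine (mu (S s))) by ring.
  apply: le_trans (lerD h1 (le_trans h2 h1)).
  have gSb := integrable_dev (b a' r') (mS s) (Soo s) (gS s).
  have cS := integrable_cst `|node_avg mu S g s - b a' r'| (mS s) (Soo s).
  rewrite [X in _ + X]mulrC -Rintegral_cst// -RintegralD//.
  apply: le_Rintegral => //.
  - exact: (integrable_dev _ (mS s) (Soo s) (gS s)).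
  - exact: (integrableD (mS s) gSb cS).
  move=> x _; have -> : g x - node_avg mu S g s =
    (g x - b a' r') - (node_avg mu S g s - b a' r') by ring.
  exact: ler_normB.
have vAS s F : measurable F -> F `<=` S s -> 2 * fine (mu F) <= fine (mu (S s)) ->
    V F <= q * V (S s).
  move=> mF FS F2; have [a' [r' [r'0 SB Bk]]] := inball s.
  have mD := measurableD (mS s) mF.
  have FDE : S s = (S s `\` F) `|` F by rewrite setUC setDUK.
  have muF : fine (mu (S s)) = fine (mu (S s `\` F)) + fine (mu F).
    rewrite {1}FDE measureU//; last by rewrite setDKI.
    have fin G : measurable G -> G `<=` S s -> mu G \is a fin_num.
      move=> mG GS; rewrite ge0_fin_numE//; apply: le_lt_trans (Soo s).
      by apply: le_measure; rewrite ?inE.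
    by rewrite fineD//; apply: fin => // x [].
  have VFE : V (S s) = V (S s `\` F) + V F.
    rewrite {1}FDE Rintegral_setU//.
      by rewrite -FDE; apply: integrableS vQ.
    by apply/disj_setPS => x [[_ nF] Fx].
  have k20 : 0 < 2 * k by rewrite mulr_gt0.
  have := @Ainf_fraction a' r' (S s `\` F) (2 * k) r'0 mD.
  move=> /(_ _ k20) h; have {}h : V (eball a' r') <= c^-1 * V (S s `\` F).
    rewrite /c invrK; apply: h; first by move=> x [/SB].
    apply: le_trans Bk _; rewrite -mulrA mulrCA ler_wpM2l// ?(ltW k0)//; lra.
  have SBv : V (S s) <= V (eball a' r').
    by apply: subset_Rintegral => //; [exact: measurable_eball|exact: vi].
  have : c * V (S s) <= V (S s `\` F).
    by rewrite mulrC -ler_pdivlMr// mulrC; apply: le_trans h.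
  have : (1 - c) * V (S s) <= q * V (S s).
    by rewrite ler_wpM2r// le_max lexx orbT.
  by rewrite VFE; lra.
have wvS s : \int[mu]_(x in S s) w x <= C0 * D * V (S s).
  have [a' [r' [r'0 SB Bk]]] := inball s.
  apply: le_trans (_ : _ <= \int[mu]_(x in eball a' r') w x) _.
    by apply: subset_Rintegral => //; [exact: measurable_eball|exact: wi].
  apply: le_trans (wv _ _ r'0) _; rewrite -mulrA ler_wpM2l ?(ltW C00)//.
  exact: Ainf_fraction.
have VQ : V (S [::]) <= D1 * V (eball a r).
  apply: le_trans (_ : _ <= V (eball a (n.+1%:R * r))) _.
    by apply: subset_Rintegral => //; [exact: measurable_eball|exact: vi].
  apply: Ainf_fraction => //.
  - by apply: eballS; rewrite ler_peMl ?ler1n// ltW.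
  - by apply: ball_vol_scale; rewrite ?ler1n.
have A20 : 0 < 2 * k * A by rewrite !mulr_gt0.
have JN := john_nirenberg_exp mS (nodebox_split i0 fB)
  (nodebox_disj i0 B) (nodebox_half i0 fB) (nodebox_root i0 fB)
  (approx_box_tree i0 fB) gQ w0 wQ A20 oscS v0 vQ q1 vAS
  (ltW (mulr_gt0 C00 D0)) wvS.
set h := node_avg _ _ _ [::] in JN.
have eE : ln ((1 + q) / (2 * q)) / (4 * (2 * k * A)) = e0 / A.
  have -> : 4 * (2 * k * A) = 4 * (2 * k) * A by ring.
  by rewrite (invfM (4 * (2 * k)) A) [LHS]mulrA.
rewrite eE in JN.
(* The tree inequality is centred at the average over the cube. *)
have hb : `|h - b a r| <= E * A.
  have V0 := ball_vol_gt0 a r0; rewrite -(ler_pM2l V0).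
  have gB := gi a r r0; have Boo := leb_eball_lty a r.
  apply: le_trans (dist_of_dev h (b a r) mB Boo gB) _.
  have h1 : \int[mu]_(x in eball a r) `|g x - h| <= 2 * k * A * fine (mu (S [::])).
    apply: le_trans (oscS [::]); apply: subset_Rintegral => //.
    exact: (integrable_dev _ (mS _) (Soo _) gQ).
  have h2 : fine (mu (S [::])) <= k1 * ball_vol a r.
    apply: le_trans (_ : _ <= ball_vol a (n.+1%:R * r)) _.
      rewrite fine_le//; last 1 first.
      - by apply: le_measure; rewrite ?inE//; exact: measurable_eball.
      - by rewrite ge0_fin_numE.
      - by rewrite leb_eballE.
    by apply: ball_vol_scale; rewrite ?ler1n.
  have h3 := osc a r r0.
  have h4 : 2 * k * A * fine (mu (S [::])) <= 2 * k * A * (k1 * ball_vol a r).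
    by rewrite ler_wpM2l// ltW.
  rewrite [leRHS](_ : _ = 2 * k * A * (k1 * ball_vol a r) + A * ball_vol a r);
    last by rewrite /E; ring.
  by rewrite lerD// (le_trans h1).
have mg' : measurable_fun (eball a r) g by exact: measurable_funTS.
have mw : measurable_fun (eball a r) w.
  by have /measurable_int/measurable_EFinP := wi a r r0.
have mwQ : measurable_fun (S [::]) w by have /measurable_int/measurable_EFinP := wQ.
have mgQ : measurable_fun (S [::]) g by exact: measurable_funTS.
have ptw x : `|g x - b a r| `^ m <= 2 `^ m * ((m / e0) `^ m * A `^ m *
    expR (e0 / A * `|g x - h|) + E `^ m * A `^ m).
  apply: le_trans (_ : _ <= (`|g x - h| + E * A) `^ m) _.
    apply: ge0_ler_powR; rewrite ?nnegrE ?(ltW m0)// ?addr_ge0 ?mulr_ge0 ?(ltW E0) ?(ltW A0)//.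
    have -> : g x - b a r = (g x - h) + (h - b a r) by ring.
    by apply: le_trans (ler_normD _ _) _; rewrite lerD2l.
  apply: le_trans (powRD_le (ltW m0) _ _) _ => //.
    by rewrite mulr_ge0 ?(ltW E0) ?(ltW A0).
  rewrite ler_wpM2l ?powR_ge0// powRM ?(ltW E0) ?(ltW A0)// lerD2r.
  set Y := e0 / A * `|g x - h|.
  have Y0 : 0 <= Y by rewrite mulr_ge0// divr_ge0 ?(ltW A0) ?(ltW e00).
  have Ae0 : 0 <= A / e0 by rewrite divr_ge0 ?(ltW A0) ?(ltW e00).
  have me0 : 0 <= m / e0 by rewrite divr_ge0 ?(ltW m0) ?(ltW e00).
  have zE : `|g x - h| = A / e0 * Y.
    rewrite mulrA mulf_div [e0 * A]mulrC divff ?mul1r//.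
    by rewrite mulf_neq0// gt_eqF.
  rewrite [X in X `^ m <= _]zE (powRM _ Ae0 Y0).
  apply: le_trans (ler_wpM2l (powR_ge0 _ _) (powR_le_expR m0 Y0)) _.
  rewrite mulrA -(powRM _ Ae0 (ltW m0)).
  have -> : A / e0 * m = m / e0 * A by ring.
  by rewrite (powRM _ me0 (ltW A0)).
pose F x := expR (e0 / A * `|g x - h|) * w x.
have mF D' : measurable D' -> measurable_fun D' w -> measurable_fun D' F.
  move=> mD' mwD; apply: measurable_funM => //; apply: measurableT_comp => //.
  apply: measurable_funM => //; apply: measurableT_comp => //.
  by apply: measurable_funB => //; exact: measurable_funTS.
have F0 x : 0 <= F x by rewrite mulr_ge0// expR_ge0.
pose c1 := 2 `^ m * ((m / e0) `^ m * A `^ m).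
pose c2 := 2 `^ m * (E `^ m * A `^ m).
have c10 : 0 <= c1 by rewrite !mulr_ge0// powR_ge0.
have c20 : 0 <= c2 by rewrite !mulr_ge0// powR_ge0.
apply: le_trans (_ : _ <= \int[mu]_(x in eball a r)
    (c1%:E * (F x)%:E + c2%:E * (w x)%:E))%E _.
  apply: ge0_le_integral => //.
  - by move=> x _; rewrite lee_fin mulr_ge0// powR_ge0.
  - apply/measurable_EFinP; apply: measurable_funM => //.
    apply: (measurableT_comp (measurable_powR m)); apply: measurableT_comp => //.
    exact: measurable_funB.
  - apply: emeasurable_funD; apply: measurable_funeM; apply/measurable_EFinP => //.
    exact: mF.
  move=> x _; rewrite -!EFinM -EFinD lee_fin.
  apply: le_trans (ler_wpM2r (w0 x) (ptw x)) _.
  by rewrite le_eqVlt; apply/orP; left; apply/eqP; rewrite /c1 /c2 /F; ring.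
rewrite ge0_integralD//; last 4 first.
- by move=> x _; rewrite -EFinM lee_fin mulr_ge0.
- by apply: measurable_funeM; apply/measurable_EFinP; exact: mF.
- by move=> x _; rewrite -EFinM lee_fin mulr_ge0.
- by apply: measurable_funeM; apply/measurable_EFinP.
rewrite !ge0_integralZl_EFin//; last 4 first.
- by move=> x _; rewrite lee_fin.
- by apply/measurable_EFinP.
- by move=> x _; rewrite lee_fin.
- by apply/measurable_EFinP; exact: mF.
have I1 : (\int[mu]_(x in eball a r) (F x)%:E <= (C1 * V (eball a r))%:E)%E.
  apply: le_trans (_ : _ <= \int[mu]_(x in S [::]) (F x)%:E)%E _.
    apply: ge0_subset_integral => //.
    - by apply/measurable_EFinP; exact: mF.
    - by move=> x _; rewrite lee_fin.
  apply: le_trans JN _; rewrite lee_fin /C1 -!mulrA !ler_wpM2l ?(ltW C00) ?(ltW D0)//.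
  by rewrite ltW// invr_gt0 subr_gt0.
have I2 : (\int[mu]_(x in eball a r) (w x)%:E <= (C0 * V (eball a r))%:E)%E.
  have := wv a r r0; rewrite -lee_fin; apply: le_trans.
  by rewrite /Rintegral fineK//; exact: integrable_fin_num (wi a r r0).
apply: le_trans (leeD (lee_wpmul2l _ I1) (lee_wpmul2l _ I2)) _; rewrite ?lee_fin//.
rewrite le_eqVlt; apply/orP; left; apply/eqP.
by rewrite /c1 /c2; ring.
Qed.

End john_nirenberg_balls.

(** * The time integral of the Gaussian *)

Section powers_on_half_lines.
Context (R : realType).
Local Notation leb1 := (@lebesgue_measure R).

Lemma measurable_invr : measurable_fun setT (@GRing.inv R).
Proof.
rewrite (_ : @GRing.inv R = fun t => t * (t ^+ 2) `^ (-1)).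
  apply: measurable_funM => //; apply: (measurableT_comp (measurable_powR _)).
  exact: measurable_funX.
apply/funext => t; rewrite powR_inv1 ?sqr_ge0//.
have [->|t0] := eqVneq t 0; first by rewrite invr0 mul0r.
by rewrite expr2 invfM mulrA divff// mul1r.
Qed.

(** Monotone convergence, as a bound. *)
Lemma integral_bigcup_le d (X : measurableType d) (mu : {measure set X -> \bar R})
    (F : (set X)^nat) (f : X -> \bar R) (C : \bar R) :
  nondecreasing_seq F -> (forall i, measurable (F i)) ->
  measurable_fun setT f -> (forall x, 0 <= f x)%E ->
  (forall i, \int[mu]_(x in F i) f x <= C)%E ->
  (\int[mu]_(x in \bigcup_i F i) f x <= C)%E.
Proof.
move=> ndF mF mf f0 le.
have mfi i : measurable_fun (F i) f by exact: measurable_funTS.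
have h := ge0_nondecreasing_set_cvg_integral (mu := mu) ndF mF mfi (fun i x _ => f0 x).
rewrite -(cvg_lim _ h)//; apply: lime_le; first by apply/cvg_ex; eexists; exact: h.
exact: nearW.
Qed.

Lemma integral_powR_segment (r a b : R) : r != 0 -> 0 < a -> a < b ->
  (\int[leb1]_(t in `[a, b]) (t `^ (r - 1))%:E = ((b `^ r - a `^ r) / r)%:E)%E.
Proof.
move=> r0 a0 ab.
have cont (e x : R) : 0 < x -> {for x, continuous (fun t : R => t `^ e)}.
  move=> x0; apply: differentiable_continuous; apply/derivable1_diffP.
  by apply: derivable_powR; rewrite in_itv/= x0.
have dF (x : R) : 0 < x -> derivable (fun t => r^-1 * t `^ r) x 1.
  move=> x0; apply: derivableM; first exact: derivable_cst.
  by apply: derivable_powR; rewrite in_itv/= x0.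
have cF (x : R) : 0 < x -> {for x, continuous (fun t => r^-1 * t `^ r)}.
  by move=> x0; apply: differentiable_continuous; apply/derivable1_diffP; exact: dF.
rewrite (@continuous_FTC2 _ _ (fun t => r^-1 * t `^ r) _ _ ab).
- by rewrite -EFinB; congr EFin; rewrite mulrBl ![_ * r^-1]mulrC.
- apply: derivable_within_continuous => x; rewrite in_itv/= => /andP[ax _].
  by apply: derivable_powR; rewrite in_itv/= (lt_le_trans a0 ax).
- split.
  + by move=> x; rewrite in_itv/= => /andP[ax _]; apply: dF; exact: lt_trans ax.
  + by apply: cvg_at_right_filter; exact: cF.
  + by apply: cvg_at_left_filter; apply: cF; exact: lt_trans ab.
move=> x; rewrite in_itv/= => /andP[ax _]; have x0 := lt_trans a0 ax.
rewrite derive1E deriveM//; last first.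
  by apply: derivable_powR; rewrite in_itv/= x0.
rewrite derive_cst scaler0 addr0 -derive1E powR_derive1 ?in_itv/= ?x0//.
by rewrite /GRing.scale/= mulrA mulVf// mul1r.
Qed.

Lemma integral_powR_near0 (b s : R) : 0 < b -> 0 < s ->
  (\int[leb1]_(t in `]0%R, s]) (t `^ (b - 1))%:E <= (s `^ b / b)%:E)%E.
Proof.
move=> b0 s0.
have E : `]0, s]%classic = \bigcup_i `[s / i.+2%:R, s]%classic :> set R.
  apply/seteqP; split => x /=; rewrite ?in_itv/=.
    move=> /andP[x0 xs]; have := archi_boundP (ltW (divr_gt0 s0 x0)).
    set N := Num.bound _ => sN; exists N => //=; rewrite in_itv/= xs andbT.
    rewrite ler_pdivrMr// mulrC -ler_pdivrMr//; apply: le_trans (ltW sN) _.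
    by rewrite ler_nat -addn2 leq_addr.
  move=> [i _ /=]; rewrite in_itv/= => /andP[h ->]; rewrite andbT.
  by apply: lt_le_trans h; rewrite divr_gt0.
rewrite E; apply: integral_bigcup_le.
- apply/nondecreasing_seqP => i; apply/subsetPset => x /=.
  rewrite !in_itv/= => /andP[h ->]; rewrite andbT; apply: le_trans h.
  by rewrite ler_pM2l// lef_pV2 ?posrE// ler_nat.
- by move=> i.
- by apply/measurable_EFinP; exact: measurable_powR.
- by move=> x; rewrite lee_fin powR_ge0.
move=> i; rewrite integral_powR_segment.
- by rewrite lee_fin ler_pM2r ?invr_gt0// lerBlDr lerDl powR_ge0.
- by rewrite gt_eqF.
- by rewrite divr_gt0.
- by rewrite ltr_pdivrMr// ltr_pMr// ltr1n.
Qed.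

Lemma integral_powR_nearoo (g s : R) : 0 < g -> 0 < s ->
  (\int[leb1]_(t in `[s, +oo[) (t `^ (- g - 1))%:E <= (s `^ (- g) / g)%:E)%E.
Proof.
move=> g0 s0.
have E : `[s, +oo[%classic = \bigcup_i `[s, s + i.+1%:R]%classic :> set R.
  apply/seteqP; split => x /=; rewrite ?in_itv/= ?andbT.
    move=> sx; have xs : 0 <= x - s by rewrite subr_ge0.
    have := archi_boundP xs; set N := Num.bound _ => h; exists N => //=.
    rewrite in_itv/= sx/= -lerBlDl; apply: le_trans (ltW h) _.
    by rewrite ler_nat.
  by move=> [i _ /=]; rewrite in_itv/= => /andP[].
rewrite E; apply: integral_bigcup_le.
- apply/nondecreasing_seqP => i; apply/subsetPset => x /=.
  rewrite !in_itv/= => /andP[-> h]; apply: le_trans h _.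
  by rewrite lerD2l ler_nat.
- by move=> i.
- by apply/measurable_EFinP; exact: measurable_powR.
- by move=> x; rewrite lee_fin powR_ge0.
move=> i; rewrite integral_powR_segment//; last 2 first.
- by rewrite oppr_eq0 gt_eqF.
- by rewrite ltrDl.
rewrite lee_fin invrN mulrN -mulNr opprB ler_pM2r ?invr_gt0//.
by rewrite lerBlDr lerDl powR_ge0.
Qed.

(** With [y = c * rho ^+ 2 / t], the exponential is dominated by a power of
    [t] near the origin and by 1 for large [t]. *)
Lemma gaussian_time_integral (N al c : R) : 0 < al -> al < N -> 0 < c ->
  exists2 G : R, 0 < G & forall rho, 0 < rho ->
  (\int[leb1]_(t in `]0%R, +oo[) (t `^ (- (N / 2)) * expR (- (c * (rho ^+ 2 / t))) *
      (t `^ (- (al / 2) + 1))^-1)%:E <= (G * rho `^ (al - N))%:E)%E.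
Proof.
move=> al0 alN c0; have N0 : 0 < N by exact: lt_trans alN.
pose m := N / 2; have m0 : 0 < m by rewrite divr_gt0.
pose b := al / 2; have b0 : 0 < b by rewrite divr_gt0.
pose g := (N - al) / 2; have g0 : 0 < g by rewrite divr_gt0// subr_gt0.
pose M := m `^ m * c `^ (- m).
have M0 : 0 < M by rewrite mulr_gt0// powR_gt0.
exists (M / b + g^-1); first by rewrite addr_gt0 ?divr_gt0// invr_gt0.
move=> rho rho0; set s := rho ^+ 2; have s0 : 0 < s by rewrite exprn_gt0.
have sE (e : R) : s `^ e = rho `^ (2 * e).
  by rewrite /s -powR_mulrn ?(ltW rho0)// powRrM.
pose f (t : R) := t `^ (- (N / 2)) * expR (- (c * (s / t))) *
  (t `^ (- (al / 2) + 1))^-1.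
rewrite -[X in (X <= _)%E]/(\int[leb1]_(t in `]0%R, +oo[) (f t)%:E)%E.
have f0 t : (0 <= (f t)%:E)%E.
  by rewrite lee_fin !mulr_ge0 ?powR_ge0 ?expR_ge0 ?invr_ge0 ?powR_ge0.
have mf : measurable_fun setT (EFin \o f).
  apply/measurable_EFinP; apply: measurable_funM; first apply: measurable_funM.
  - exact: measurable_powR.
  - apply: measurableT_comp => //; apply: measurableT_comp => //.
    apply: measurable_funM => //; apply: measurable_funM => //.
    exact: measurable_invr.
  - rewrite (_ : (fun _ => _) = (fun t : R => t `^ (- (- (al / 2) + 1)))).
      exact: measurable_powR.
    by apply/funext => t; rewrite powRN.
have -> : `]0, +oo[%classic = `]0, s] `|` `]s, +oo[ :> set R.
  apply/seteqP; split => x /=; rewrite !in_itv/= !andbT.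
    by move=> x0; have [xs|sx] := leP x s; [left; rewrite x0|right].
  by move=> [/andP[]//|]; exact: lt_trans.
rewrite ge0_integral_setU//=; last 2 first.
- exact: measurable_funTS.
- apply/disj_setPS => x [/=]; rewrite !in_itv/= andbT => /andP[_ h].
  by rewrite ltNge h.
rewrite mulrDl EFinD; apply: leeD.
- apply: le_trans (_ : _ <= \int[leb1]_(t in `]0%R, s])
    ((M * s `^ (- m))%:E * (t `^ (b - 1))%:E))%E _.
    apply: ge0_le_integral => //.
    + exact: measurable_funTS.
    + apply: measurable_funTS; apply: measurable_funeM; apply/measurable_EFinP.
      exact: measurable_powR.
    move=> t /=; rewrite in_itv/= => /andP[t0 _]; rewrite -EFinM lee_fin /f.
    have y0 : 0 < c * (s / t) by rewrite mulr_gt0// divr_gt0.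
    have := powR_le_expR m0 (ltW y0); rewrite expRN -/m => h.
    rewrite -powRN; have -> : - (- (al / 2) + 1) = b - 1 by rewrite /b; ring.
    rewrite ler_wpM2r ?powR_ge0//.
    have -> : M * s `^ (- m) = t `^ (- m) * (m `^ m * (c * (s / t)) `^ (- m)).
      have t10 : 0 <= t^-1 by rewrite invr_ge0 ltW.
      have st0 : 0 <= s / t by rewrite mulr_ge0// ltW.
      rewrite /M (powRM (- m) (ltW c0) st0) (powRM (- m) (ltW s0) t10).
      have -> : t^-1 `^ (- m) = t `^ m.
        by rewrite -powR_inv1 ?(ltW t0)// -powRrM mulN1r opprK.
      have : t `^ (- m) * t `^ m = 1 by rewrite powRN mulVf// gt_eqF// powR_gt0.
      move: (t `^ (- m)) (t `^ m) => u u' uu'.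
      rewrite [RHS](_ : _ = (u * u') * (m `^ m * c `^ (- m) * s `^ (- m))); last by ring.
      by rewrite uu' mul1r.
    rewrite ler_wpM2l ?powR_ge0// powRN ler_pdivlMr ?powR_gt0//.
    by rewrite mulrC ler_pdivrMr ?expR_gt0.
  rewrite ge0_integralZl_EFin//; last 3 first.
  + by move=> x _; rewrite lee_fin powR_ge0.
  + by apply: measurable_funTS; apply/measurable_EFinP; exact: measurable_powR.
  + by rewrite mulr_ge0 ?powR_ge0 ?(ltW M0).
  apply: le_trans (lee_wpmul2l _ (integral_powR_near0 b0 s0)) _.
    by rewrite lee_fin mulr_ge0 ?powR_ge0 ?(ltW M0).
  rewrite -EFinM lee_fin le_eqVlt; apply/orP; left; apply/eqP.
  have -> : al - N = 2 * (- m) + 2 * b by rewrite /m /b; field.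
  rewrite powRD; last by rewrite (gt_eqF rho0) implybT.
  by rewrite -!sE; ring.
apply: le_trans (_ : _ <= \int[leb1]_(t in `[s, +oo[) (t `^ (- g - 1))%:E)%E _.
  apply: le_trans (_ : _ <= \int[leb1]_(t in `]s, +oo[) (t `^ (- g - 1))%:E)%E _.
    apply: ge0_le_integral => //.
    + exact: measurable_funTS.
    + by apply: measurable_funTS; apply/measurable_EFinP; exact: measurable_powR.
    move=> t /=; rewrite in_itv/= andbT => st; rewrite lee_fin /f.
    have t0 := lt_trans s0 st.
    rewrite -powRN [leRHS](_ : _ = t `^ (- m) * t `^ (- (- (al / 2) + 1))); last first.
      rewrite -powRD ?(gt_eqF t0) ?implybT//; congr (_ `^ _).
      by rewrite /g /m; field.
    rewrite ler_wpM2r ?powR_ge0// ler_piMr ?powR_ge0//.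
    by rewrite -expR0 ler_expR oppr_le0 mulr_ge0 ?(ltW c0)// divr_ge0 ?(ltW s0) ?(ltW t0).
  apply: ge0_subset_integral => //.
  + by apply: measurable_funTS; apply/measurable_EFinP; exact: measurable_powR.
  + by move=> x _; rewrite lee_fin powR_ge0.
  by move=> x /=; rewrite !in_itv/= !andbT => /ltW.
apply: le_trans (integral_powR_nearoo g0 s0) _.
rewrite lee_fin sE mulrC (_ : 2 * - g = al - N)//.
by rewrite /g; field.
Qed.

End powers_on_half_lines.

(** * Complex-valued integrals *)

Section complex_integrals.
Local Open Scope complex_scope.
Context (R : realType).
Local Notation C := R[i].
Local Notation Re := (@complex.Re R).
Local Notation Im := (@complex.Im R).
Local Notation normc := (@Normc.normc R).

Lemma normcE (z : C) : normc z = Num.sqrt (Re z ^+ 2 + Im z ^+ 2).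
Proof. by case: z. Qed.

Lemma normc_ge0 (z : C) : 0 <= normc z.
Proof. by rewrite normcE sqrtr_ge0. Qed.

Lemma Re_le_normc (z : C) : `|Re z| <= normc z.
Proof. by rewrite normcE -sqrtr_sqr ler_wsqrtr// lerDl sqr_ge0. Qed.

Lemma Im_le_normc (z : C) : `|Im z| <= normc z.
Proof. by rewrite normcE -sqrtr_sqr ler_wsqrtr// lerDr sqr_ge0. Qed.

Lemma normc_le (z : C) : normc z <= `|Re z| + `|Im z|.
Proof.
rewrite normcE -[leRHS]ger0_norm ?addr_ge0// -sqrtr_sqr ler_wsqrtr//.
rewrite sqrrD !real_normK ?num_real// lerD2r lerDl.
by rewrite mulrn_wge0// mulr_ge0.
Qed.

Lemma normc_real (r : R) : normc r%:C = `|r|.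
Proof. by rewrite normcE /= expr0n/= addr0 sqrtr_sqr. Qed.

Lemma normcD (z w : C) : normc (z + w) <= normc z + normc w.
Proof. exact: (@le_normcD R z w). Qed.

Lemma normcB (z w : C) : normc (z - w) <= normc z + normc w.
Proof. by apply: le_trans (normcD z (- w)) _; rewrite [normc (- w)](@normcN R w). Qed.

Lemma ReM (z w : C) : Re (z * w) = Re z * Re w - Im z * Im w.
Proof. by case: z w => [a b] [c d]. Qed.

Lemma ImM (z w : C) : Im (z * w) = Re z * Im w + Im z * Re w.
Proof. by case: z w => [a b] [c d]. Qed.

Lemma ReD (z w : C) : Re (z + w) = Re z + Re w.
Proof. by case: z w => [a b] [c d]. Qed.

Lemma ImD (z w : C) : Im (z + w) = Im z + Im w.
Proof. by case: z w => [a b] [c d]. Qed.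

Lemma eqC (z w : C) : Re z = Re w -> Im z = Im w -> z = w.
Proof. by case: z w => [a b] [c d] /= -> ->. Qed.

Context d (X : measurableType d) (m : {measure set X -> \bar R}).
Implicit Types (D : set X) (f g : X -> C).

Lemma measurable_normc D f : cmeasurable D f ->
  measurable_fun D (fun x => normc (f x)).
Proof.
move=> [mr mi]; under eq_fun do rewrite normcE.
apply: (measurableT_comp (@measurable_sqrtr R)).
by apply: measurable_funD; apply: measurable_funX.
Qed.

Lemma cmeasurableM D f g : cmeasurable D f -> cmeasurable D g ->
  cmeasurable D (fun x => f x * g x).
Proof.
move=> [fr fi] [gr gi]; split.
  rewrite (_ : _ \o _ = fun x => Re (f x) * Re (g x) - Im (f x) * Im (g x)).
    by apply: measurable_funB; apply: measurable_funM.
  by apply/funext => x /=; rewrite ReM.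
rewrite (_ : _ \o _ = fun x => Re (f x) * Im (g x) + Im (f x) * Re (g x)).
  by apply: measurable_funD; apply: measurable_funM.
by apply/funext => x /=; rewrite ImM.
Qed.

Lemma cmeasurableD D f g : cmeasurable D f -> cmeasurable D g ->
  cmeasurable D (fun x => f x + g x).
Proof.
move=> [fr fi] [gr gi]; split.
  rewrite (_ : _ \o _ = fun x => Re (f x) + Re (g x)).
    exact: measurable_funD.
  by apply/funext => x /=; rewrite ReD.
rewrite (_ : _ \o _ = fun x => Im (f x) + Im (g x)).
  exact: measurable_funD.
by apply/funext => x /=; rewrite ImD.
Qed.

Lemma cmeasurable_cst D (z : C) : cmeasurable D (cst z).
Proof. by split; exact: measurable_cst. Qed.

Lemma cmeasurableB D f g : cmeasurable D f -> cmeasurable D g ->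
  cmeasurable D (fun x => f x - g x).
Proof.
move=> mf mg; rewrite (_ : (fun _ => _) = fun x => f x + (-1) * g x).
  by apply: cmeasurableD => //; apply: cmeasurableM => //; exact: cmeasurable_cst.
by apply/funext => x; rewrite mulN1r.
Qed.

Lemma cmeasurable_real D (h : X -> R) : measurable_fun D h ->
  cmeasurable D (fun x => (h x)%:C).
Proof. by move=> mh; split => //; exact: measurable_cst. Qed.

Lemma cintegrable_normc D f : measurable D -> cmeasurable D f ->
  (\int[m]_(x in D) (normc (f x))%:E < +oo)%E -> cintegrable m D f.
Proof.
move=> mD mf foo; have [mr mi] := mf; have mn := measurable_normc mf.
have ni : m.-integrable D (EFin \o (fun x => normc (f x))).
  apply/integrableP; split; first exact/measurable_EFinP.
  apply: le_lt_trans foo; rewrite le_eqVlt; apply/orP; left; apply/eqP.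
  by apply: eq_integral => x _ /=; rewrite ger0_norm ?normc_ge0.
split; apply: le_integrable ni => //.
- exact/measurable_EFinP.
- by move=> x _ /=; rewrite lee_fin [leRHS]ger0_norm ?normc_ge0 ?Re_le_normc.
- exact/measurable_EFinP.
- by move=> x _ /=; rewrite lee_fin [leRHS]ger0_norm ?normc_ge0 ?Im_le_normc.
Qed.

Lemma le_fine_integral D (h : X -> R) (g : X -> R) : measurable D ->
  measurable_fun D h -> measurable_fun D g ->
  (forall x, D x -> `|h x| <= g x) ->
  (`|\int[m]_(x in D) h x|%:E <= \int[m]_(x in D) (g x)%:E)%E.
Proof.
move=> mD mh mg hg; rewrite /Rintegral.
apply: le_trans (_ : _ <= `|\int[m]_(x in D) (h x)%:E|)%E _.
  by case: (\int[m]_(x in D) (h x)%:E)%E => [r| |] //=; rewrite normr0 leey.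
apply: le_trans (le_abse_integral m mD _) _; first exact/measurable_EFinP.
apply: ge0_le_integral => //.
- by apply/measurable_EFinP; exact: measurableT_comp.
- exact/measurable_EFinP.
Qed.

Lemma normc_cintegral_le D f (g : X -> R) : measurable D -> cmeasurable D f ->
  measurable_fun D g -> (forall x, D x -> normc (f x) <= g x) ->
  ((normc (cintegral m D f))%:E <= 2%:E * \int[m]_(x in D) (g x)%:E)%E.
Proof.
move=> mD [mr mi] mg fg.
have h1 : (`|\int[m]_(x in D) Re (f x)|%:E <= \int[m]_(x in D) (g x)%:E)%E.
  by apply: le_fine_integral => // x Dx; exact: le_trans (Re_le_normc _) (fg x Dx).
have h2 : (`|\int[m]_(x in D) Im (f x)|%:E <= \int[m]_(x in D) (g x)%:E)%E.
  by apply: le_fine_integral => // x Dx; exact: le_trans (Im_le_normc _) (fg x Dx).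
apply: le_trans (_ : _ <= \int[m]_(x in D) (g x)%:E + \int[m]_(x in D) (g x)%:E)%E _.
  apply: le_trans (leeD h1 h2); rewrite -EFinD lee_fin.
  exact: normc_le.
by rewrite -[X in (X + X <= _)%E]mul1e -ge0_muleDl.
Qed.

Lemma cintegral_lin D (c : C) f g : measurable D ->
  cintegrable m D f -> cintegrable m D g ->
  cintegrable m D (fun x => c * f x + g x) /\
  cintegral m D (fun x => c * f x + g x) = c * cintegral m D f + cintegral m D g.
Proof.
move=> mD [fr fi] [gr gi].
have Zi (r : R) (h : X -> R) : m.-integrable D (EFin \o h) ->
    m.-integrable D (EFin \o (fun x => r * h x)).
  by move=> hi; exact: (integrableZl mD r hi).
have Ai (h h' : X -> R) : m.-integrable D (EFin \o h) ->
    m.-integrable D (EFin \o h') ->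
    m.-integrable D (EFin \o (fun x => h x + h' x)).
  by move=> hi h'i; exact: (integrableD mD hi h'i).
have rE : Re \o (fun x => c * f x + g x) =
    fun x => (Re c * Re (f x) + (- Im c) * Im (f x)) + Re (g x).
  by apply/funext => x /=; rewrite ReD ReM mulNr.
have iE : Im \o (fun x => c * f x + g x) =
    fun x => (Re c * Im (f x) + Im c * Re (f x)) + Im (g x).
  by apply/funext => x /=; rewrite ImD ImM.
split.
  by split; rewrite -compA ?rE ?iE; apply: (Ai) => //; apply: Ai; exact: Zi.
apply: eqC.
  transitivity (\int[m]_(x in D) ((Re c * Re (f x) + (- Im c) * Im (f x)) + Re (g x))).
    by apply: eq_Rintegral => x _; have := congr1 (@^~ x) rE.
  rewrite !RintegralD ?RintegralZl//; [|exact: Zi|exact: Zi|].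
    by rewrite ReD ReM mulNr.
  by apply: Ai; exact: Zi.
transitivity (\int[m]_(x in D) ((Re c * Im (f x) + Im c * Re (f x)) + Im (g x))).
  by apply: eq_Rintegral => x _; have := congr1 (@^~ x) iE.
rewrite !RintegralD ?RintegralZl//; [|exact: Zi|exact: Zi|].
  by rewrite ImD ImM.
by apply: Ai; exact: Zi.
Qed.

End complex_integrals.

Lemma measurable_Rintegral_param d1 d2 (X : measurableType d1)
    (Y : measurableType d2) (R : realType)
    (m : {sigma_finite_measure set Y -> \bar R}) (F : X * Y -> R) :
  measurable_fun setT F -> measurable_fun setT (fun x => \int[m]_y F (x, y)).
Proof.
move=> mF; rewrite /Rintegral.
apply: measurableT_comp; first exact: fine_measurable.
rewrite (_ : (fun _ => _) = fun x =>
  ((\int[m]_y ((EFin \o F)^\+ (x, y))) -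
   (\int[m]_y ((EFin \o F)^\- (x, y))))%E); last first.
  apply/funext => x; rewrite [LHS]integralE.
  congr (_ - _)%E; apply: eq_integral => y _;
  by [rewrite !funeposE|rewrite !funenegE].
have mEF : measurable_fun setT (EFin \o F) by exact/measurable_EFinP.
apply: emeasurable_funB.
- apply: (@measurable_fun_fubini_tonelli_F _ _ X Y R m (EFin \o F)^\+%E) => //.
  exact: measurable_funepos.
- apply: (@measurable_fun_fubini_tonelli_F _ _ X Y R m (EFin \o F)^\-%E) => //.
  exact: measurable_funeneg.
Qed.

(** * Convergence and decay of the fractional power *)

Section fractional_power.
Local Open Scope complex_scope.
Context (R : realType) (n : nat).
Local Notation Rn := (Rn R n).
Local Notation C := R[i].
Local Notation Re := (@complex.Re R).
Local Notation Im := (@complex.Im R).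
Local Notation normc := (@Normc.normc R).
Local Notation mu := (leb R n).
Local Notation leb1 := (@lebesgue_measure R).
Variables (k : R -> Rn -> Rn -> C) (al : R).
Implicit Types (f g : Rn -> C) (x y a : Rn).

Local Notation tpow t := ((t `^ (- (al / 2) + 1))^-1).

(** The condition at [x] that defines almost everywhere the domain of
    [frac_power k al]. *)
Definition converges f x :=
  (forall t, 0 < t -> cintegrable mu setT (fun y => k t x y * f y)) /\
  cintegrable leb1 `]0, +oo[ (fun t => kernel_op k t f x * (tpow t)%:C).

Lemma converges_lin (c : C) f g x : converges f x -> converges g x ->
  converges (fun y => c * f y + g y) x /\
  frac_power k al (fun y => c * f y + g y) x =
    c * frac_power k al f x + frac_power k al g x.
Proof.
move=> [fx fi] [gx gi].
have kE t : 0 < t ->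
    cintegrable mu setT (fun y => k t x y * (c * f y + g y)) /\
    kernel_op k t (fun y => c * f y + g y) x =
      c * kernel_op k t f x + kernel_op k t g x.
  move=> t0; have [h1 h2] := cintegral_lin c measurableT (fx t t0) (gx t t0).
  have E : (fun y => k t x y * (c * f y + g y)) =
    (fun y => c * (k t x y * f y) + k t x y * g y).
    by apply/funext => y; ring.
  by rewrite /kernel_op E.
have mI : measurable (`]0, +oo[%classic : set (measurableTypeR R)) by [].
have [h1 h2] := cintegral_lin c mI fi gi.
have E t : t \in `]0, +oo[%classic ->
    c * (kernel_op k t f x * (tpow t)%:C) + kernel_op k t g x * (tpow t)%:C =
    kernel_op k t (fun y => c * f y + g y) x * (tpow t)%:C.
  rewrite inE/= in_itv/= andbT => t0; have [_ ->] := kE t t0.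
  by ring.
split; first split.
- by move=> t t0; have [] := kE t t0.
- case: h1 => hr hi; split.
    by apply: eq_integrable hr => // t tI /=; rewrite E.
  by apply: eq_integrable hi => // t tI /=; rewrite E.
rewrite /frac_power/=; set G := (_^-1)%:C.
have -> : cintegral leb1 `]0, +oo[
    (fun t => kernel_op k t (fun y => c * f y + g y) x * (tpow t)%:C) =
  cintegral leb1 `]0, +oo[ (fun t => c * (kernel_op k t f x * (tpow t)%:C) +
    kernel_op k t g x * (tpow t)%:C).
  by rewrite /cintegral; congr (_ +i* _); apply: eq_Rintegral => t tI; rewrite E.
by rewrite h2 mulrDr mulrCA.
Qed.

Hypothesis mk : cmeasurable [set z : measurableTypeR R * (Rn * Rn) | 0 < (z.1 : R)]
    (fun z : measurableTypeR R * (Rn * Rn) => k z.1 z.2.1 z.2.2).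

Let D0 := [set z : measurableTypeR R * (Rn * Rn) | 0 < (z.1 : R)].

Let mD0 : measurable D0.
Proof.
have -> : D0 = `]0, +oo[ `*` setT.
  by apply/seteqP; split => z /=; rewrite /D0/= in_itv/= andbT => // -[].
exact: measurableX.
Qed.

(** The kernel is only measurable for positive times; extended by zero it can be
   composed with measurable maps. *)
Let kp t x y : C := if 0 < t then k t x y else 0.

Let mkp d (X : measurableType d) (T : X -> measurableTypeR R) (F G : X -> Rn) :
  measurable_fun setT T -> measurable_fun setT F -> measurable_fun setT G ->
  cmeasurable setT (fun z => kp (T z) (F z) (G z)).
Proof.
move=> mT mF mG; have [mr mi] := mk.
have mphi : measurable_fun setT (fun z => (T z, (F z, G z))).
  by apply: measurable_fun_pair => //; exact: measurable_fun_pair.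
split.
  have /measurable_restrictT := mr => /(_ mD0) h.
  apply: eq_measurable_fun (measurableT_comp h mphi) => z _ /=.
  rewrite patchE /kp; case: ifPn => [|/negP]; rewrite inE/= => zD.
    by rewrite zD.
  by case: ifP zD.
have /measurable_restrictT := mi => /(_ mD0) h.
apply: eq_measurable_fun (measurableT_comp h mphi) => z _ /=.
rewrite patchE /kp; case: ifPn => [|/negP]; rewrite inE/= => zD.
  by rewrite zD.
by case: ifP zD.
Qed.

Let kernel_opE t f x : 0 < t ->
  kernel_op k t f x = cintegral mu setT (fun y => kp t x y * f y).
Proof. by move=> t0; rewrite /kernel_op /kp t0. Qed.

Lemma measurable_kernel_op d (X : measurableType d) (T : X -> measurableTypeR R)
    (F : X -> Rn) f : measurable_fun setT T -> measurable_fun setT F ->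
  cmeasurable setT f ->
  cmeasurable setT (fun z => cintegral mu setT (fun y => kp (T z) (F z) y * f y)).
Proof.
move=> mT mF [fr fi].
have mf2 : cmeasurable setT (fun z : X * Rn => f z.2).
  by split; [exact: (measurableT_comp fr measurable_snd)|
             exact: (measurableT_comp fi measurable_snd)].
have m2 : cmeasurable setT (fun z : X * Rn => kp (T z.1) (F z.1) z.2).
  by apply: mkp => //; [exact: (measurableT_comp mT measurable_fst)|
                        exact: (measurableT_comp mF measurable_fst)].
have [mr mi] := cmeasurableM m2 mf2.
by split; [exact: (measurable_Rintegral_param mu mr)|
           exact: (measurable_Rintegral_param mu mi)].
Qed.

Lemma measurable_tpow : measurable_fun setT (fun t : R => tpow t).
Proof.
rewrite (_ : (fun _ => _) = (fun t : R => t `^ (- (- (al / 2) + 1)))).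
  exact: measurable_powR.
by apply/funext => t; rewrite powRN.
Qed.

Lemma cmeasurable_frac_power f : cmeasurable setT f ->
  cmeasurable setT (frac_power k al f).
Proof.
move=> mf.
have mK : cmeasurable setT (fun z : Rn * measurableTypeR R =>
    cintegral mu setT (fun y => kp z.2 z.1 y * f y)).
  exact: measurable_kernel_op.
have mH : cmeasurable setT (fun z : Rn * measurableTypeR R =>
    (if 0 < (z.2 : R) then tpow (z.2 : R) else 0 : R)%:C).
  suff h : measurable_fun setT (fun t : measurableTypeR R =>
      if 0 < (t : R) then tpow (t : R) else 0 : R).
    by apply: cmeasurable_real; exact: (measurableT_comp h measurable_snd).
  apply: measurable_fun_ifT => //; last exact: measurable_tpow.
  exact: measurable_fun_ltr.
have [mr mi] := cmeasurableM mK mH.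
have mc : cmeasurable setT (cst ((Gamma (al / 2))^-1)%:C : Rn -> C).
  exact: cmeasurable_cst.
rewrite /frac_power/=; apply: (cmeasurableM mc).
split.
  apply: eq_measurable_fun (measurable_Rintegral_param leb1 mr) => x _ /=.
  rewrite [RHS]Rintegral_mkcond; apply: eq_Rintegral => t _.
  rewrite patchE; have [t0|t0] := ltP 0 (t : R).
    rewrite mem_set; last by rewrite /= in_itv/= t0.
    by rewrite /= /kp t0.
  rewrite memNset; last by rewrite /= in_itv/= andbT; apply/negP; rewrite -leNgt.
  by rewrite /= !mulr0 ?subr0 ?addr0.
apply: eq_measurable_fun (measurable_Rintegral_param leb1 mi) => x _ /=.
rewrite [RHS]Rintegral_mkcond; apply: eq_Rintegral => t _.
rewrite patchE; have [t0|t0] := ltP 0 (t : R).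
  rewrite mem_set; last by rewrite /= in_itv/= t0.
  by rewrite /= /kp t0.
rewrite memNset; last by rewrite /= in_itv/= andbT; apply/negP; rewrite -leNgt.
by rewrite /= !mulr0 ?subr0 ?addr0.
Qed.

Hypothesis alN : 0 < al < n%:R.
Hypothesis gb : gaussian_bound k.

(** Off the doubled ball the kernel at [x] is controlled by the Gaussian
    centred at [a]; exchanging the two integrals turns it into the Riesz
    kernel. *)
Lemma frac_power_tail : exists2 K : R, 0 < K &
  forall a r f (S : R), 0 < r -> cmeasurable setT f ->
    (forall y, eball a (2 * r) y -> f y = 0) -> 0 <= S ->
    (\int[mu]_y (normc (f y) * edist y a `^ (al - n%:R))%:E <= S%:E)%E ->
    forall x, eball a r x ->
      converges f x /\ normc (frac_power k al f x) <= K * S.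
Proof.
have [K0 [c [K00 c0 kb]]] := gb; have /andP[al0 aln] := alN.
have [G G0 HG] := gaussian_time_integral al0 aln c0.
pose L := `|(Gamma (al / 2))^-1| * (2 * (2 * (K0 * G * 2 `^ (n%:R - al)))).
have L0 : 0 <= L.
  by rewrite mulr_ge0// !mulr_ge0 ?powR_ge0 ?(ltW K00) ?(ltW G0).
exists (L + 1); first by rewrite ltr_wpDl.
move=> a r f S r0 mf fv S0 fS x xB.
pose m := (n%:R - al) / 2; have m0 : 0 < m by rewrite divr_gt0// subr_gt0.
have yfar y : f y != 0 -> 2 * r <= edist y a.
  by move=> fy; rewrite leNgt; apply/negP => /fv fy0; rewrite fy0 eqxx in fy.
(* A lower bound for the distance from [x] to the points of the support of [f]. *)
pose rho y := edist y a / 2.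
have rho0 y : f y != 0 -> 0 < rho y.
  by move=> /yfar h; rewrite divr_gt0//; apply: lt_le_trans h; rewrite mulr_gt0.
pose gs (t : R) y := K0 * (t `^ (- (n%:R / 2)) * expR (- (c * (rho y ^+ 2 / t)))).
have gs0 t y : 0 <= gs t y by rewrite !mulr_ge0 ?powR_ge0 ?expR_ge0 ?(ltW K00).
have kle t y : 0 < t -> normc (k t x y * f y) <= gs t y * normc (f y).
  move=> t0; rewrite Normc.normcM; have [fy0|fy] := eqVneq (f y) 0.
    by rewrite fy0 normcE/= expr0n/= addr0 sqrtr0 !mulr0.
  rewrite ler_wpM2r ?normc_ge0//; apply: le_trans (kb t x y t0) _.
  rewrite /gs -mulrA ler_wpM2l ?(ltW K00)// ler_wpM2l ?powR_ge0//.
  rewrite ler_expR lerN2 ler_wpM2l ?(ltW c0)// ler_wpM2r ?invr_ge0 ?(ltW t0)//.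
  rewrite ler_pXn2r// ?nnegrE ?edist_ge0 ?(ltW (rho0 _ fy))//.
  exact: edist_far xB (yfar y fy).
have mn := measurable_normc mf.
have mrho : measurable_fun setT rho.
  by apply: measurable_funM => //; exact: measurable_edist.
have mgs2 : measurable_fun setT (fun z : measurableTypeR R * Rn =>
    gs (z.1 : R) z.2 * normc (f z.2)).
  apply: measurable_funM; last exact: (measurableT_comp mn measurable_snd).
  apply: measurable_funM => //; apply: measurable_funM.
    exact: (measurableT_comp (measurable_powR _) measurable_fst).
  apply: measurableT_comp => //; apply: measurableT_comp => //.
  apply: measurable_funM => //; apply: measurable_funM.
    by apply: measurable_funX; exact: (measurableT_comp mrho measurable_snd).
  exact: (measurableT_comp (@measurable_invr R) measurable_fst).
have mgs t : measurable_fun setT (fun y => gs t y * normc (f y)).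
  exact: (measurableT_comp mgs2 (measurable_pair1 (t : measurableTypeR R))).
have mkt t : 0 < t -> cmeasurable setT (fun y => k t x y * f y).
  move=> t0; apply: cmeasurableM => //.
  suff h : cmeasurable setT (fun z : Rn =>
      kp (cst (t : measurableTypeR R) z) (cst x z) (id z)).
    by move: h; rewrite /kp /= t0.
  by apply: mkp; [exact: measurable_cst|exact: measurable_cst|exact: measurable_id].
have kint t : 0 < t -> cintegrable mu setT (fun y => k t x y * f y).
  move=> t0; apply: cintegrable_normc => //; first exact: mkt.
  (* For a fixed time the Gaussian is dominated by the [- 2 * m]-th power of the
     distance. *)
  pose Ct := K0 * (t `^ (- (n%:R / 2)) * (m `^ m * (c * (4^-1 / t)) `^ (- m))).
  have Ct0 : 0 <= Ct by rewrite !mulr_ge0 ?powR_ge0 ?(ltW K00).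
  apply: le_lt_trans (_ : _ <= \int[mu]_y (Ct%:E *
      (normc (f y) * edist y a `^ (al - n%:R))%:E))%E _.
    apply: ge0_le_integral => //.
    - by move=> y _; rewrite lee_fin normc_ge0.
    - by apply/measurable_EFinP; apply: measurable_normc; exact: mkt.
    - apply: measurable_funeM; apply/measurable_EFinP; apply: measurable_funM => //.
      apply: (measurableT_comp (measurable_powR _)); exact: measurable_edist.
    move=> y _; rewrite -EFinM lee_fin; apply: le_trans (kle t y t0) _.
    have [fy0|fy] := eqVneq (f y) 0.
      by rewrite fy0 normcE/= expr0n/= addr0 sqrtr0 mulr0 mul0r mulr0.
    rewrite [leRHS]mulrCA [leLHS]mulrC ler_wpM2l ?normc_ge0//.
    have ry := rho0 y fy.
    have d0 : 0 < edist y a by have := ry; rewrite /rho; lra.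
    have y0 : 0 < c * (rho y ^+ 2 / t) by rewrite mulr_gt0// divr_gt0// exprn_gt0.
    have h := powR_le_expR m0 (ltW y0).
    rewrite /gs /Ct -[leRHS]mulrA ler_wpM2l ?(ltW K00)//.
    rewrite -[leRHS]mulrA ler_wpM2l ?powR_ge0// -[leRHS]mulrA.
    rewrite expRN.
    have -> : m `^ m * ((c * (4^-1 / t)) `^ (- m) * edist y a `^ (al - n%:R)) =
        m `^ m * (c * (rho y ^+ 2 / t)) `^ (- m).
      congr (_ * _).
      have -> : al - n%:R = 2 * (- m) by rewrite /m; field.
      rewrite powRrM powR_mulrn ?edist_ge0//.
      rewrite -powRM ?mulr_ge0 ?invr_ge0 ?(ltW c0) ?(ltW t0) ?sqr_ge0 ?edist_ge0//.
      by congr (_ `^ _); rewrite /rho; field; rewrite gt_eqF.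
    rewrite powRN ler_pdivlMr ?powR_gt0//.
    by rewrite mulrC ler_pdivrMr ?expR_gt0.
  rewrite ge0_integralZl_EFin//.
  - by apply: le_lt_trans (lee_wpmul2l _ fS) _; rewrite ?lee_fin// -EFinM ltry.
  - by move=> y _; rewrite lee_fin mulr_ge0 ?normc_ge0 ?powR_ge0.
  - apply/measurable_EFinP; apply: measurable_funM => //.
    apply: (measurableT_comp (measurable_powR _)); exact: measurable_edist.
pose H (z : measurableTypeR R * Rn) : \bar R :=
  (if 0 < (z.1 : R) then gs z.1 z.2 * normc (f z.2) * tpow (z.1 : R) else 0 : R)%:E.
have H0 z : (0 <= H z)%E.
  rewrite lee_fin; case: ifP => // _.
  by rewrite !mulr_ge0 ?normc_ge0 ?invr_ge0 ?powR_ge0 ?expR_ge0 ?(ltW K00).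
have mH : measurable_fun setT H.
  apply/measurable_EFinP; apply: measurable_fun_ifT => //.
    by apply: measurable_fun_ltr => //; exact: measurable_fst.
  apply: measurable_funM => //; exact: (measurableT_comp measurable_tpow measurable_fst).
have mP := @measurable_fun_fubini_tonelli_F _ _ _ _ R mu H mH H0.
have mDD : measurable (`]0, +oo[%classic : set (measurableTypeR R)) by [].
have kop (t : R) : 0 < t ->
    ((normc (kernel_op k t f x * (tpow t)%:C))%:E <= 2%:E * \int[mu]_y H (t, y))%E.
  move=> t0; have p0 : 0 <= tpow t by rewrite invr_ge0 powR_ge0.
  rewrite Normc.normcM normc_real ger0_norm// mulrC EFinM.
  have h : ((normc (kernel_op k t f x))%:E <=
      2%:E * \int[mu]_y (gs t y * normc (f y))%:E)%E.
    apply: normc_cintegral_le => //; first exact: mkt.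
    by move=> y _; exact: kle.
  apply: le_trans (lee_wpmul2l _ h) _; first by rewrite lee_fin.
  rewrite muleCA lee_wpmul2l// -ge0_integralZl_EFin//.
  - rewrite le_eqVlt; apply/orP; left; apply/eqP; apply: eq_integral => y _.
    by rewrite /H/= t0 -EFinM mulrC.
  - by move=> y _; rewrite lee_fin mulr_ge0 ?normc_ge0.
  - exact/measurable_EFinP.
pose B := K0 * G * 2 `^ (n%:R - al) * S.
have HB : (\int[leb1]_(t in `]0%R, +oo[) \int[mu]_y H (t, y) <= B%:E)%E.
  apply: le_trans (_ : _ <= \int[leb1]_t \int[mu]_y H (t, y))%E _.
    apply: ge0_subset_integral => //.
    by move=> t _; apply: integral_ge0.
  rewrite (@fubini_tonelli _ _ _ _ R leb1 mu H mH H0).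
  apply: le_trans (_ : _ <= \int[mu]_y ((K0 * G * 2 `^ (n%:R - al))%:E *
      (normc (f y) * edist y a `^ (al - n%:R))%:E))%E _.
    apply: ge0_le_integral => //.
    - by move=> y _; apply: integral_ge0.
    - exact: (@measurable_fun_fubini_tonelli_G _ _ _ _ R leb1 H mH H0).
    - apply: measurable_funeM; apply/measurable_EFinP; apply: measurable_funM => //.
      apply: (measurableT_comp (measurable_powR _)); exact: measurable_edist.
    move=> y _; have [fy0|fy] := eqVneq (f y) 0.
      rewrite integral0_eq.
        by rewrite fy0 normcE/= expr0n/= addr0 sqrtr0 mul0r mule0.
      move=> t _; rewrite /H/= fy0 normcE/= expr0n/= addr0 sqrtr0 mulr0 mul0r.
      by case: ifP.
    have ry := rho0 y fy.
    have -> : (\int[leb1]_t H (t, y) = (K0 * normc (f y))%:E *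
      \int[leb1]_(t in `]0%R, +oo[) (t `^ (- (n%:R / 2)) *
        expR (- (c * (rho y ^+ 2 / t))) * tpow t)%:E)%E.
      rewrite -ge0_integralZl_EFin//; last 3 first.
      - by move=> t _; rewrite lee_fin !mulr_ge0 ?invr_ge0 ?powR_ge0 ?expR_ge0.
      - apply: measurable_funTS; apply/measurable_EFinP; apply: measurable_funM.
          apply: measurable_funM; first exact: measurable_powR.
          apply: measurableT_comp => //; apply: measurableT_comp => //.
          apply: measurable_funM => //; apply: measurable_funM => //.
          exact: measurable_invr.
        exact: measurable_tpow.
      - by rewrite mulr_ge0 ?normc_ge0 ?(ltW K00).
      rewrite [RHS]integral_mkcond; apply: eq_integral => t _.
      rewrite patchE /H/=; have [t0|t0] := ltP 0 (t : R).
        rewrite mem_set; last by rewrite /= in_itv/= t0.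
        by rewrite -EFinM /gs; congr EFin; ring.
      by rewrite memNset// /= in_itv/= andbT; apply/negP; rewrite -leNgt.
    apply: le_trans (lee_wpmul2l _ (HG _ ry)) _.
      by rewrite lee_fin mulr_ge0 ?normc_ge0 ?(ltW K00).
    rewrite -!EFinM lee_fin le_eqVlt; apply/orP; left; apply/eqP.
    have -> : rho y `^ (al - n%:R) = edist y a `^ (al - n%:R) * 2 `^ (n%:R - al).
      rewrite /rho powRM ?edist_ge0 ?invr_ge0//; congr (_ * _).
      by rewrite -{1}(powR_inv1 (ler0n R 2)) -powRrM; congr (_ `^ _); ring.
    by ring.
  rewrite ge0_integralZl_EFin//.
  - apply: le_trans (lee_wpmul2l _ fS) _; rewrite ?lee_fin//.
    by rewrite !mulr_ge0 ?powR_ge0 ?(ltW K00) ?(ltW G0).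
  - by move=> y _; rewrite lee_fin mulr_ge0 ?normc_ge0 ?powR_ge0.
  - apply/measurable_EFinP; apply: measurable_funM => //.
    apply: (measurableT_comp (measurable_powR _)); exact: measurable_edist.
  - by rewrite !mulr_ge0 ?powR_ge0 ?(ltW K00) ?(ltW G0).
pose W (t : measurableTypeR R) : C := kernel_op k t f x * (tpow (t : R))%:C.
have mW : cmeasurable (`]0, +oo[%classic : set (measurableTypeR R)) W.
  apply: cmeasurableM; last first.
    by apply: cmeasurable_real; apply: measurable_funTS; exact: measurable_tpow.
  have mK : cmeasurable setT (fun t : measurableTypeR R =>
      cintegral mu setT (fun y => kp (id t) (cst x t) y * f y)).
    exact: measurable_kernel_op.
  have E t : t \in `]0, +oo[%classic -> cintegral mu setT
      (fun y => kp (id t) (cst x t) y * f y) = kernel_op k t f x.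
    by rewrite inE/= in_itv/= andbT => t0; rewrite kernel_opE.
  case: mK => mr mi; split.
    apply: eq_measurable_fun (measurable_funTS mr) => t tD.
    exact: (congr1 Re (E t tD)).
  apply: eq_measurable_fun (measurable_funTS mi) => t tD.
  exact: (congr1 Im (E t tD)).
have WB : (\int[leb1]_(t in `]0%R, +oo[) (normc (W t))%:E <= (2 * B)%:E)%E.
  apply: le_trans (_ : _ <= \int[leb1]_(t in `]0%R, +oo[)
      (2%:E * \int[mu]_y H (t, y)))%E _.
    apply: ge0_le_integral => //.
    - by move=> t _; rewrite lee_fin normc_ge0.
    - by apply/measurable_EFinP; exact: measurable_normc mW.
    - by apply: measurable_funeM; exact: measurable_funTS mP.
    - by move=> t; rewrite /= in_itv/= andbT => t0; exact: kop.
  rewrite ge0_integralZl_EFin//.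
  - by rewrite EFinM lee_wpmul2l.
  - by move=> t _; apply: integral_ge0.
  - exact: measurable_funTS mP.
split; first split => //.
  by apply: cintegrable_normc => //; apply: le_lt_trans WB _; rewrite ltry.
have -> : frac_power k al f x =
  ((Gamma (al / 2))^-1)%:C * cintegral leb1 `]0, +oo[ W by [].
rewrite Normc.normcM normc_real -lee_fin EFinM.
have h : ((normc (cintegral leb1 `]0, +oo[ W))%:E <=
    2%:E * \int[leb1]_(t in `]0%R, +oo[) (normc (W t))%:E)%E.
  by apply: normc_cintegral_le => //; exact: measurable_normc.
have {}h : ((normc (cintegral leb1 `]0, +oo[ W))%:E <= 2%:E * (2 * B)%:E)%E.
  by apply: le_trans h _; rewrite lee_wpmul2l.
apply: le_trans (lee_wpmul2l _ h) _ => //.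
rewrite -!EFinM lee_fin /B [leRHS]mulrDl mul1r ler_wpDr//.
by rewrite /L le_eqVlt; apply/orP; left; apply/eqP; ring.
Qed.

End fractional_power.
(** * Integral inequalities with real bounds *)
Section integral_inequalities.
Context d (X : measurableType d) (R : realType) (mu : {measure set X -> \bar R}).
Implicit Types (E : set X) (F G g : X -> R).

Lemma powR_homo (r x y : R) : 0 <= r -> 0 <= x -> x <= y -> x `^ r <= y `^ r.
Proof.
by move=> r0 x0 xy; rewrite ge0_ler_powR// nnegrE// (le_trans x0).
Qed.

Lemma powR_inv_cancel (r x : R) : r != 0 -> 0 <= x -> (x `^ r) `^ r^-1 = x.
Proof. by move=> r0 x0; rewrite -powRrM divff// powRr1. Qed.

Lemma hoelder_le E F G (p q Y Z : R) : measurable E ->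
  measurable_fun setT F -> measurable_fun setT G ->
  (forall x, 0 <= F x) -> (forall x, 0 <= G x) ->
  0 < p -> 0 < q -> p^-1 + q^-1 = 1 ->
  (\int[mu]_(x in E) (F x `^ p)%:E <= Y%:E)%E ->
  (\int[mu]_(x in E) (G x `^ q)%:E <= Z%:E)%E ->
  (\int[mu]_(x in E) (F x * G x)%:E <= (Y `^ p^-1 * Z `^ q^-1)%:E)%E.
Proof.
move=> mE mF mG F0 G0 p0 q0 pq FY GZ.
have NE (H : X -> R) r W : (forall x, 0 <= H x) -> 0 < r ->
    (\int[mu]_(x in E) (H x `^ r)%:E <= W%:E)%E ->
    ('N[mu]_r%:E[EFin \o (H \_ E)%R] <= (W `^ r^-1)%:E)%E.
  move=> H0 r0 HW; rewrite unlock.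
  have -> : (\int[mu]_x `|(EFin \o (H \_ E)) x| `^ r)%E =
      (\int[mu]_(x in E) (H x `^ r)%:E)%E.
    rewrite [RHS]integral_mkcond; apply: eq_integral => x _.
    rewrite /patch/=; case: ifPn => _.
      by rewrite ger0_norm// poweR_EFin.
    by rewrite normr0 powR0// gt_eqF.
  rewrite -poweR_EFin gt0_ler_poweR ?invr_ge0 ?(ltW r0)// in_itv/= leey andbT.
    by apply: integral_ge0 => x _; rewrite lee_fin powR_ge0.
  by apply: le_trans HW; apply: integral_ge0 => x _; rewrite lee_fin powR_ge0.
have mr (H : X -> R) : measurable_fun setT H -> measurable_fun setT (H \_ E).
  by move=> mH; apply/(measurable_restrictT _ mE); exact: measurable_funTS.
have := hoelder mu (mr _ mF) (mr _ mG) p0 q0 pq.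
have -> : ('N[mu]_1[EFin \o (F \_ E \* G \_ E)%R])%E =
    (\int[mu]_(x in E) (F x * G x)%:E)%E.
  rewrite Lnorm1 [RHS]integral_mkcond; apply: eq_integral => x _.
  rewrite /patch/=; case: ifPn => _; last by rewrite mul0r normr0.
  by rewrite ger0_norm// mulr_ge0.
move=> /le_trans; apply; rewrite EFinM lee_pmul ?Lnorm_ge0//; exact: NE.
Qed.

Lemma power_mean_le E g (e e' Y : R) : measurable E -> (mu E < +oo)%E ->
  measurable_fun setT g -> (forall x, 0 <= g x) -> 0 < e -> e <= e' ->
  (\int[mu]_(x in E) (g x `^ e')%:E <= Y%:E)%E ->
  (\int[mu]_(x in E) (g x `^ e)%:E <=
    (Y `^ (e / e') * fine (mu E) `^ (1 - e / e'))%:E)%E.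
Proof.
move=> mE Eoo mg g0 e0; rewrite le_eqVlt => /predU1P[<-|ee'] gY.
  rewrite divff ?gt_eqF// subrr powRr0 mulr1 powRr1//.
  by rewrite -lee_fin (le_trans _ gY)// integral_ge0// => x _; rewrite lee_fin powR_ge0.
have e'0 := lt_trans e0 ee'.
have k0 : 0 < 1 - e / e' by rewrite subr_gt0 ltr_pdivrMr// mul1r.
have := @hoelder_le E (fun x => g x `^ e) (cst 1) (e' / e) (1 - e / e')^-1
  Y (fine (mu E)) mE _ _ _ _ _ _ _ _ _.
rewrite invrK invf_div.
have -> : (\int[mu]_(x in E) (g x `^ e)%:E)%E =
    (\int[mu]_(x in E) (g x `^ e * cst 1 x)%:E)%E.
  by apply: eq_integral => x _; rewrite mulr1.
move=> H; apply: H.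
- exact: (measurableT_comp (measurable_powR e)).
- exact: measurable_cst.
- by move=> x; rewrite powR_ge0.
- by move=> x; exact: ler01.
- by rewrite divr_gt0.
- by rewrite invr_gt0.
- by rewrite addrC subrK.
- by under eq_integral do rewrite -powRrM mulrCA divff ?gt_eqF// mulr1.
- under eq_integral do rewrite powR1.
  by rewrite integral_cst// mul1e fineK// ge0_fin_numE.
Qed.

Lemma integral_gt0 E g : measurable E -> (0 < mu E)%E ->
  measurable_fun setT g -> (forall x, 0 <= g x) -> {ae mu, forall x, 0 < g x} ->
  (0 < \int[mu]_(x in E) (g x)%:E)%E.
Proof.
move=> mE E0 mg g0 gpos; rewrite lt_neqAle integral_ge0 ?andbT; last first.
  by move=> x _; rewrite lee_fin.
apply/eqP => I0.
have : (\int[mu]_(x in E) `|(g x)%:E|)%E = 0.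
  by rewrite I0; apply: eq_integral => x _; rewrite gee0_abs// lee_fin.
move/ae_eq_integral_abs => /(_ mE _) H.
have {}H := H (measurable_funTS (proj2 (measurable_EFinP _ _) mg)).
have : {ae mu, forall x, ~ E x}.
  apply: filterS2 gpos H => x gx Hx Ex; move: (Hx Ex) => [gx0].
  by rewrite gx0 ltxx in gx.
case=> N [mN N0 EN]; move: E0.
suff -> : mu E = 0 by rewrite ltxx.
apply/eqP; rewrite eq_le measure_ge0 andbT -N0 le_measure ?inE//.
by move=> x Ex; apply: EN => /=; apply.
Qed.

End integral_inequalities.
(** * Two-weight conditions *)
Section weight_conditions.
Context (R : realType) (n : nat).
Local Notation Rn := (Rn R n).
Local Notation mu := (leb R n).
Implicit Types (a x : Rn) (r : R) (g u v w : Rn -> R).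

Lemma measurable_wpow w s : measurable_fun setT w -> measurable_fun setT (wpow w s).
Proof. by move=> mw; exact: (measurableT_comp (measurable_powR s)). Qed.

Lemma wpow_ge0 w s x : 0 <= wpow w s x.
Proof. exact: powR_ge0. Qed.

Lemma wpow_gt0 w s : weight w -> {ae mu, forall x, 0 < wpow w s x}.
Proof. by move=> [_ _ + _]; apply: filterS => x; exact: powR_gt0. Qed.

Lemma wpow_wpow w s e : wpow (wpow w s) e = wpow w (s * e).
Proof. by apply/funext => x; rewrite /wpow powRrM. Qed.

Lemma integral_ball_gt0 g a r : 0 < r -> measurable_fun setT g ->
  (forall x, 0 <= g x) -> {ae mu, forall x, 0 < g x} ->
  (0 < \int[mu]_(x in eball a r) (g x)%:E)%E.
Proof.
move=> r0 mg g0 gp; apply: integral_gt0 => //; first exact: measurable_eball.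
by have := ball_vol_gt0 a r0; rewrite -lte_fin -leb_eballE.
Qed.

Lemma avgE g a r : 0 < r ->
  avg g a r = ((ball_vol a r)^-1%:E * \int[mu]_(x in eball a r) (g x)%:E)%E.
Proof. by move=> r0; rewrite /avg leb_eballE inver gt_eqF// ball_vol_gt0. Qed.

Lemma avg_fin g a r : 0 < r -> measurable_fun setT g -> (forall x, 0 <= g x) ->
  (avg g a r < +oo)%E ->
  mu.-integrable (eball a r) (EFin \o g) /\
  avg g a r = ((ball_vol a r)^-1 * \int[mu]_(x in eball a r) g x)%:E.
Proof.
move=> r0 mg g0; rewrite avgE// => goo.
have V0 : 0 < (ball_vol a r)^-1 by rewrite invr_gt0 ball_vol_gt0.
have I0 : (0 <= \int[mu]_(x in eball a r) (g x)%:E)%E.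
  by apply: integral_ge0 => x _; rewrite lee_fin.
have Ioo : (\int[mu]_(x in eball a r) (g x)%:E < +oo)%E.
  rewrite ltNge leye_eq; apply/negP => /eqP gE.
  by move: goo; rewrite gE gt0_muley ?lte_fin// ltxx.
split.
  apply/integrableP; split; first exact/measurable_EFinP/measurable_funTS.
  by under eq_integral do rewrite /= ger0_norm//.
by rewrite EFinM /Rintegral fineK// ge0_fin_numE.
Qed.

Lemma poweR_mul_le (Y Z : \bar R) (e1 e2 K : R) : (0 < Y)%E -> (0 < Z)%E ->
  0 < e1 -> 0 < e2 -> (Y `^ e1 * Z `^ e2 <= K%:E)%E ->
  [/\ (Y < +oo)%E, (Z < +oo)%E & fine Y `^ e1 * fine Z `^ e2 <= K].
Proof.
move=> Y0 Z0 e10 e20 YZ.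
have Y1 := poweR_gt0 e1 Y0; have Z1 := poweR_gt0 e2 Z0.
have Yoo : (Y < +oo)%E.
  rewrite ltNge leye_eq; apply/negP => /eqP YE.
  by move: YZ; rewrite YE poweRyr ?gt_eqF// gt0_mulye// leye_eq.
have Zoo : (Z < +oo)%E.
  rewrite ltNge leye_eq; apply/negP => /eqP ZE.
  by move: YZ; rewrite ZE poweRyr ?gt_eqF// gt0_muley// leye_eq.
split => //; rewrite -lee_fin EFinM -!poweR_EFin !fineK//.
  by rewrite ge0_fin_numE// ltW.
by rewrite ge0_fin_numE// ltW.
Qed.

Lemma powRDp (x e1 e2 : R) : 0 < x -> x `^ (e1 + e2) = x `^ e1 * x `^ e2.
Proof. by move=> x0; apply: powRD; rewrite (gt_eqF x0) implybT. Qed.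

Lemma powR_mul_powR (x y e1 e2 z : R) :
  (x `^ e1 * y `^ e2) `^ z = x `^ (e1 * z) * y `^ (e2 * z).
Proof. by rewrite powRM ?powR_ge0// -!powRrM. Qed.

Lemma average_powers_le (V U T K s e1 e2 : R) : 0 < V -> 0 <= U -> 0 <= T -> 0 < s ->
  (V^-1 * U) `^ (e1 * s) * (V^-1 * T) `^ (e2 * s) <= K ->
  U `^ e1 * T `^ e2 <= K `^ s^-1 * V `^ (e1 + e2).
Proof.
move=> V0 U0 T0 s0 le_K.
have VU : 0 <= V^-1 * U by rewrite mulr_ge0// invr_ge0 ltW.
have VT : 0 <= V^-1 * T by rewrite mulr_ge0// invr_ge0 ltW.
have sV0 : 0 <= s^-1 by rewrite invr_ge0 ltW.
have L0 : 0 <= (V^-1 * U) `^ (e1 * s) * (V^-1 * T) `^ (e2 * s).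
  by rewrite mulr_ge0// powR_ge0.
have := powR_homo sV0 L0 le_K.
rewrite powR_mul_powR !mulfK ?gt_eqF//.
have E z e : 0 <= z -> z `^ e = V `^ e * (V^-1 * z) `^ e.
  move=> z0; rewrite -powRM ?(ltW V0)//; last by rewrite mulr_ge0// invr_ge0 ltW.
  by rewrite mulrA divff ?mul1r// gt_eqF.
move=> H; rewrite (E U)// (E T)// powRDp//.
rewrite mulrACA mulrC; apply: ler_wpM2r => //.
by rewrite mulr_ge0// powR_ge0.
Qed.

(** Averages of higher powers dominate averages of lower ones, so the condition
    on the powers [w1^s] and [w2^s] implies the one on the pair itself. *)
Lemma A_pq_product w1 w2 (p q s : R) : weight w1 -> weight w2 ->
  1 < p -> 0 < q -> 1 <= s < p ->
  A_pq (p / s) (q / s) (wpow w1 s) (wpow w2 s) ->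
  exists2 K : R, 0 < K & forall a r, 0 < r ->
    [/\ mu.-integrable (eball a r) (EFin \o wpow w2 q),
        mu.-integrable (eball a r) (EFin \o wpow w1 (- conj_exp p)) &
        (\int[mu]_(x in eball a r) wpow w2 q x) `^ q^-1 *
        (\int[mu]_(x in eball a r) wpow w1 (- conj_exp p) x) `^ (conj_exp p)^-1
        <= K * ball_vol a r `^ (q^-1 + (conj_exp p)^-1)].
Proof.
move=> W1 W2 p1 q0 /andP[s1 sp] [K K0 HK].
have p0 : 0 < p by exact: lt_trans p1.
have s0 : 0 < s by exact: lt_le_trans s1.
have [mw1 w10 w1p _] := W1; have [mw2 w20 w2p _] := W2.
have ps1 : (p / s == 1) = false by rewrite gt_eqF// ltr_pdivlMr// mul1r.
set P := conj_exp p; set e := s * conj_exp (p / s).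
have PV : P^-1 = 1 - p^-1 by rewrite /P /conj_exp invrK.
have eV : e^-1 = s^-1 - p^-1.
  by rewrite /e /conj_exp invfM invrK invf_div; field; rewrite !gt_eqF.
have PV0 : 0 < P^-1 by rewrite PV subr_gt0 invf_lt1.
have eV0 : 0 < e^-1 by rewrite eV subr_gt0 ltf_pV2 ?posrE.
have P0 : 0 < P by rewrite -invr_gt0.
have e0 : 0 < e by rewrite -invr_gt0.
have Pe : P <= e.
  by rewrite -[P]invrK -[e]invrK lef_pV2 ?posrE// PV eV lerD2r invf_le1.
exists (K `^ s^-1); first exact: powR_gt0.
move=> a r r0; have V0 := ball_vol_gt0 a r0.
have mB := measurable_eball a r.
have := HK a r r0; rewrite ps1 !wpow_wpow.
have -> : s * (q / s) = q by rewrite mulrCA divff ?gt_eqF// mulr1.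
have -> : s * (- conj_exp (p / s)) = - e by rewrite mulrN.
have pos w z : weight w -> (0 < avg (wpow w z) a r)%E.
  move=> Ww; rewrite avgE// mule_gt0// ?lte_fin ?invr_gt0//.
  apply: integral_ball_gt0 => //; last exact: wpow_gt0.
    by apply: measurable_wpow; case: Ww.
  exact: wpow_ge0.
have pc0 : 0 < (conj_exp (p / s))^-1.
  by rewrite /conj_exp invrK subr_gt0 invf_div ltr_pdivrMr// mul1r.
move=> /(poweR_mul_le (pos _ _ W2) (pos _ _ W1) _ pc0) [].
  by rewrite invf_div divr_gt0.
move=> uoo too.
have [ui ->] := avg_fin r0 (measurable_wpow q mw2) (wpow_ge0 _ _) uoo.
have [ti ->] := avg_fin r0 (measurable_wpow (- e) mw1) (wpow_ge0 _ _) too.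
rewrite /= => le_K.
set U := \int[mu]_(x in eball a r) wpow w2 q x in le_K *.
set T := \int[mu]_(x in eball a r) wpow w1 (- e) x in le_K *.
have U0 : 0 <= U by apply: Rintegral_ge0 => x _; exact: wpow_ge0.
have T0 : 0 <= T by apply: Rintegral_ge0 => x _; exact: wpow_ge0.
have TE : (\int[mu]_(x in eball a r) (wpow w1 (- e) x)%:E)%E = T%:E.
  by rewrite /T /Rintegral fineK// (integrable_fin_num mB ti).
have Hs := @power_mean_le _ _ _ mu (eball a r) (wpow w1 (-1)) P e T mB
  (leb_eball_lty a r) (measurable_wpow _ mw1) (wpow_ge0 _ _) P0 Pe.
have pE z x : wpow w1 (-1) x `^ z = wpow w1 (- z) x.
  by rewrite /wpow -powRrM mulN1r.
have {}Hs : (\int[mu]_(x in eball a r) (wpow w1 (- P) x)%:E <=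
    (T `^ (P / e) * ball_vol a r `^ (1 - P / e))%:E)%E.
  have := Hs _; rewrite -/(ball_vol a r).
  under eq_integral do rewrite pE.
  have -> : (\int[mu]_(x in eball a r) (wpow w1 (-1) x `^ P)%:E)%E =
      (\int[mu]_(x in eball a r) (wpow w1 (- P) x)%:E)%E.
    by apply: eq_integral => x _; rewrite pE.
  by apply; rewrite TE.
have sgi : mu.-integrable (eball a r) (EFin \o wpow w1 (- P)).
  apply/integrableP; split.
    by apply/measurable_EFinP/measurable_funTS; exact: measurable_wpow.
  under eq_integral do rewrite /= ger0_norm ?wpow_ge0//.
  exact: le_lt_trans Hs (ltry _).
split=> //.
set S := \int[mu]_(x in eball a r) wpow w1 (- P) x.
have S0 : 0 <= S by apply: Rintegral_ge0 => x _; exact: wpow_ge0.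
have {}Hs : S `^ P^-1 <= T `^ e^-1 * ball_vol a r `^ (P^-1 - e^-1).
  have HS : S <= T `^ (P / e) * ball_vol a r `^ (1 - P / e).
    by rewrite -lee_fin /S /Rintegral fineK// (integrable_fin_num mB sgi).
  have := powR_homo (ltW PV0) S0 HS.
  rewrite powRM ?powR_ge0// -!powRrM mulrBl mul1r.
  by rewrite mulrAC divff ?gt_eqF// mul1r.
have {}le_K : U `^ q^-1 * T `^ e^-1 <= K `^ s^-1 * ball_vol a r `^ (q^-1 + e^-1).
  have qs : q^-1 * s = (q / s)^-1 by rewrite invf_div mulrC.
  have es : e^-1 * s = (conj_exp (p / s))^-1.
    by rewrite /e invfM mulrAC mulVf ?mul1r// gt_eqF.
  by apply: (average_powers_le V0 U0 T0 s0); rewrite qs es.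
apply: le_trans (ler_wpM2l (powR_ge0 _ _) Hs) _.
rewrite mulrA; apply: le_trans (ler_wpM2r (powR_ge0 _ _) le_K) _.
rewrite -mulrA -powRDp//.
have -> // : q^-1 + e^-1 + (P^-1 - e^-1) = q^-1 + P^-1 by ring.
Qed.

Lemma le_Rintegral_of E g (c : R) : measurable E -> mu.-integrable E (EFin \o g) ->
  (\int[mu]_(x in E) (g x)%:E <= c%:E)%E -> \int[mu]_(x in E) g x <= c.
Proof.
by move=> mE gi; rewrite -lee_fin /Rintegral fineK// (integrable_fin_num mE gi).
Qed.

Lemma Rintegral_EFin E g : measurable E -> mu.-integrable E (EFin \o g) ->
  (\int[mu]_(x in E) (g x)%:E)%E = (\int[mu]_(x in E) g x)%:E.
Proof. by move=> mE gi; rewrite /Rintegral fineK// (integrable_fin_num mE gi). Qed.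

Local Notation normc := (@Normc.normc R).

Lemma Lpw_norm_leP p w E (f : Rn -> R[i]) (M : R) : (forall x, 0 <= w x) -> 0 < p ->
  0 <= M -> (Lpw_norm p w E f <= M%:E)%E <->
  (\int[mu]_(x in E) (normc (f x) `^ p * w x)%:E <= (M `^ p)%:E)%E.
Proof.
move=> w0 p0 M0; rewrite /Lpw_norm; set Q := (\int[mu]_(x in E) _)%E.
have Q0 : (0 <= Q)%E.
  by apply: integral_ge0 => x _; rewrite lee_fin mulr_ge0// powR_ge0.
have p0V : 0 < p^-1 by rewrite invr_gt0.
split => H.
  have Qi : (Q `^ p^-1)%E \in `[0, +oo%E] by rewrite in_itv/= leey poweR_ge0.
  have Mi : M%:E \in `[0, +oo%E] by rewrite in_itv/= leey lee_fin M0.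
  have := gt0_ler_poweR (ltW p0) Qi Mi H.
  by rewrite poweR_EFin -poweRrM mulVf ?gt_eqF// poweRe1.
have Qi : Q \in `[0, +oo%E] by rewrite in_itv/= leey Q0.
have Mi : (M `^ p)%:E \in `[0, +oo%E] by rewrite in_itv/= leey lee_fin powR_ge0.
have := gt0_ler_poweR (ltW p0V) Qi Mi H.
by rewrite poweR_EFin -powRrM divff ?gt_eqF// powRr1.
Qed.

Lemma ball_vol_powR_le a r e : 0 < r -> 0 <= e ->
  ball_vol a r `^ e <= (2 ^+ n) `^ e * r `^ (n%:R * e).
Proof.
move=> r0 e0; rewrite powRrM powR_mulrn ?(ltW r0)// -powRM ?exprn_ge0 ?(ltW r0)//.
rewrite -exprMn; apply: powR_homo => //; last exact: ball_vol_le (ltW r0).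
by rewrite ltW// ball_vol_gt0.
Qed.

Section dual_pair.
Variables (u v : Rn -> R) (th : R).
Hypotheses (u0 : forall x, 0 <= u x) (v0 : forall x, 0 <= v x).
Hypotheses (mu_ : measurable_fun setT u) (mv : measurable_fun setT v).
Hypotheses (ui : ball_integrable u) (vi : ball_integrable v).
Hypotheses (th0 : 0 < th) (th1 : th < 1).
Hypothesis uv1 : {ae mu, forall x, u x `^ th * v x `^ (1 - th) = 1}.

(** Hölder on [F] for the product [u^th v^(1 - th)], which is 1. *)
Lemma measure_le_dual a r F : 0 < r -> measurable F -> F `<=` eball a r ->
  fine (mu F) <= (\int[mu]_(x in F) u x) `^ th * (\int[mu]_(x in F) v x) `^ (1 - th).
Proof.
move=> r0 mF FB.
have mB := measurable_eball a r.
have Foo : (mu F < +oo)%E.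
  by apply: le_lt_trans (leb_eball_lty a r); rewrite le_measure ?inE.
have iF g : ball_integrable g -> mu.-integrable F (EFin \o g).
  by move=> gi; exact: (integrableS mB mF FB (gi a r r0)).
have th10 : 0 < 1 - th by rewrite subr_gt0.
have mp g z : measurable_fun setT g -> measurable_fun setT (fun x => g x `^ z).
  by move=> mg; exact: (measurableT_comp (measurable_powR z)).
have cancelp g z : (forall x, 0 <= g x) -> ball_integrable g -> 0 < z ->
    (\int[mu]_(x in F) ((g x `^ z) `^ z^-1)%:E <= (\int[mu]_(x in F) g x)%:E)%E.
  move=> g0 gi z0; rewrite -Rintegral_EFin//; last exact: iF.
  by under eq_integral do rewrite powR_inv_cancel ?gt_eqF//.
have pge0 g z : forall x, 0 <= g x `^ z by move=> x; rewrite powR_ge0.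
have thV : th^-1^-1 + (1 - th)^-1^-1 = 1 by rewrite !invrK addrC subrK.
have tV : 0 < th^-1 by rewrite invr_gt0.
have tV' : 0 < (1 - th)^-1 by rewrite invr_gt0.
have := hoelder_le mF (mp _ th mu_) (mp _ (1 - th) mv) (pge0 _ _) (pge0 _ _) tV tV'
  thV (cancelp _ _ u0 ui th0) (cancelp _ _ v0 vi th10).
rewrite !invrK; suff -> : (\int[mu]_(x in F) (u x `^ th * v x `^ (1 - th))%:E)%E = mu F.
  by rewrite -lee_fin fineK// ge0_fin_numE.
rewrite -[RHS]mul1e -integral_cst//; apply: ae_eq_integral => //.
- apply/measurable_EFinP/measurable_funTS/measurable_funM; exact: mp.
- by apply: filterS uv1 => x -> _.
Qed.

(** In [measure_le_dual] the mass [v(F)] is replaced by that of the ball, which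
    the product bound controls. *)
Lemma Ainf_of_dual K : 0 <= K ->
  (forall a r, 0 < r -> (\int[mu]_(x in eball a r) u x) `^ th *
     (\int[mu]_(x in eball a r) v x) `^ (1 - th) <= K * ball_vol a r) ->
  ball_Ainf K th u.
Proof.
move=> K0 HK a r F r0 mF FB; have mB := measurable_eball a r.
apply: le_trans (ler_wpM2r (powR_ge0 _ _) (measure_le_dual r0 mF FB)) _.
have vFB : (\int[mu]_(x in F) v x) `^ (1 - th) <=
    (\int[mu]_(x in eball a r) v x) `^ (1 - th).
  apply: powR_homo.
  - by rewrite subr_ge0 ltW.
  - exact: Rintegral_ge0.
  - by apply: subset_Rintegral => //; exact: vi.
have := HK a r r0; have := powR_ge0 (\int[mu]_(x in F) u x) th.
have := powR_ge0 (\int[mu]_(x in eball a r) u x) th.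
move: vFB; move: (_ `^ _) (_ `^ _) (_ `^ _) (_ `^ _) => uF uB vB vF vFB uB0 uF0 HK'.
have -> : uF * vF * uB = uF * (uB * vF) by rewrite -mulrA (mulrC vF).
rewrite [X in _ <= X](mulrC _ uF); apply: ler_wpM2l => //.
by apply: le_trans HK'; apply: ler_wpM2l.
Qed.

End dual_pair.

Section strong_type_weights.
Variables (p q s : R) (w1 w2 : Rn -> R).
Hypotheses (W1 : weight w1) (W2 : weight w2).
Hypotheses (p1 : 1 < p) (q0 : 0 < q) (sp : 1 <= s < p).
Hypothesis A12 : A_pq (p / s) (q / s) (wpow w1 s) (wpow w2 s).
Hypothesis A22 : A_pq (p / s) (q / s) (wpow w2 s) (wpow w2 s).
Local Notation p' := (conj_exp p).
Local Notation u := (wpow w2 q).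
Local Notation v := (wpow w2 (- p')).
Local Notation sg := (wpow w1 (- p')).
Let kap := q^-1 + p'^-1.
Local Notation I g a r := (\int[mu]_(x in eball a r) g x).

Lemma conj_exp_gt0 : 0 < p'.
Proof.
by have p0 := lt_trans ltr01 p1; rewrite /conj_exp invr_gt0 subr_gt0 invf_lt1.
Qed.

Let p'0 := conj_exp_gt0.
Let p'V0 : 0 < p'^-1. Proof. by rewrite invr_gt0. Qed.
Let qV0 : 0 < q^-1. Proof. by rewrite invr_gt0. Qed.
Let kap0 : 0 < kap. Proof. exact: addr_gt0. Qed.
Let th := q^-1 / kap.
Let th0 : 0 < th. Proof. exact: divr_gt0. Qed.
Let thE : 1 - th = p'^-1 / kap.
Proof. by rewrite /th -[X in X - _](@divff _ kap) ?gt_eqF// -mulrBl /kap addrAC subrr add0r. Qed.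
Let th1 : th < 1.
Proof. by rewrite -subr_gt0 thE divr_gt0. Qed.
Let mw1 : measurable_fun setT w1. Proof. by case: W1. Qed.
Let mw2 : measurable_fun setT w2. Proof. by case: W2. Qed.

Lemma ball_integrable_wpow : ball_integrable u /\ ball_integrable v /\ ball_integrable sg.
Proof.
have [K1 _ H1] := A_pq_product W1 W2 p1 q0 sp A12.
have [K2 _ H2] := A_pq_product W2 W2 p1 q0 sp A22.
by split; [|split] => a r r0; [case: (H1 a r r0)|case: (H2 a r r0)|case: (H1 a r r0)].
Qed.

Let ui := ball_integrable_wpow.1.
Let vi := ball_integrable_wpow.2.1.
Let sgi := ball_integrable_wpow.2.2.

Let I0 w z a r : 0 <= I (wpow w z) a r.
Proof. by apply: Rintegral_ge0 => x _; exact: wpow_ge0. Qed.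

Lemma weighted_ball_gt0 a r : 0 < r -> 0 < I u a r.
Proof.
move=> r0; rewrite -lte_fin -Rintegral_EFin//; [|exact: measurable_eball|exact: ui].
apply: integral_ball_gt0 => //; [exact: measurable_wpow|exact: wpow_ge0|].
exact: wpow_gt0.
Qed.

Let dual_uv : {ae mu, forall x, u x `^ th * v x `^ (1 - th) = 1}.
Proof.
have [_ _ + _] := W2; apply: filterS => x wx.
rewrite /wpow -!powRrM -powRDp// (_ : _ + _ = 0) ?powRr0// thE /th.
rewrite mulNr !mulrA !divff ?gt_eqF// subrr.
by [].
Qed.

Let powers_kap (x y K V : R) : 0 <= x -> 0 <= y -> 0 <= K -> 0 < V ->
  x `^ q^-1 * y `^ p'^-1 <= K * V `^ kap ->
  x `^ th * y `^ (1 - th) <= K `^ kap^-1 * V.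
Proof.
move=> x0 y0 K0 V0 H.
have kV0 : 0 <= kap^-1 by rewrite invr_ge0 ltW.
have := powR_homo kV0 (mulr_ge0 (powR_ge0 _ _) (powR_ge0 _ _)) H.
rewrite powR_mul_powR [X in _ <= X -> _]powRM ?powR_ge0//.
by rewrite (powR_inv_cancel (lt0r_neq0 kap0) (ltW V0)) thE.
Qed.

Lemma Ainf_dual : exists2 K : R, 0 < K & ball_Ainf K th u /\ ball_Ainf K (1 - th) v.
Proof.
have [K K0 H2] := A_pq_product W2 W2 p1 q0 sp A22.
have K'0 : 0 <= K `^ kap^-1 by rewrite powR_ge0.
have HK a r : 0 < r -> I u a r `^ th * I v a r `^ (1 - th) <= K `^ kap^-1 * ball_vol a r.
  move=> r0; have [_ _ H] := H2 a r r0.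
  by apply: powers_kap => //; [exact: ltW|exact: ball_vol_gt0].
exists (K `^ kap^-1); first exact: powR_gt0.
have mu_ := measurable_wpow q mw2; have mv := measurable_wpow (- p') mw2.
split.
  exact: (Ainf_of_dual (wpow_ge0 _ _) (wpow_ge0 _ _) mu_ mv ui vi th0 th1 dual_uv K'0 HK).
have th'0 : 0 < 1 - th by rewrite subr_gt0.
have th'1 : 1 - th < 1 by rewrite ltrBlDr ltrDl.
have dual_vu : {ae mu, forall x, v x `^ (1 - th) * u x `^ (1 - (1 - th)) = 1}.
  by rewrite subKr; apply: filterS dual_uv => x H; rewrite mulrC; exact: H.
apply: (Ainf_of_dual (wpow_ge0 _ _) (wpow_ge0 _ _) mv mu_ vi ui th'0 th'1 dual_vu K'0).
by move=> a r r0; rewrite subKr mulrC; exact: HK.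
Qed.

(** Since [u] and [v] are dual, [u(B)^(1/q) v(B)^(1/p')] is comparable to
    [|B|^kap], so the condition on the pair bounds [sg(B)] by [v(B)]. *)
Lemma sigma_le_dual : exists2 C : R, 0 < C &
  forall a r, 0 < r -> I sg a r <= C * I v a r.
Proof.
have [K K0 H1] := A_pq_product W1 W2 p1 q0 sp A12.
exists (K `^ p'); first exact: powR_gt0.
move=> a r r0; have [_ _ H] := H1 a r r0.
have V0 := ball_vol_gt0 a r0; have U0 := weighted_ball_gt0 a r0.
have mB := measurable_eball a r.
have D := measure_le_dual (wpow_ge0 _ _) (wpow_ge0 _ _) (measurable_wpow _ mw2)
  (measurable_wpow _ mw2) ui vi th0 th1 dual_uv r0 mB (fun x h => h).
have {}D : ball_vol a r `^ kap <= I u a r `^ q^-1 * I v a r `^ p'^-1.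
  have := powR_homo (ltW kap0) (ltW V0) D.
  by rewrite powR_mul_powR thE /th !divfK ?gt_eqF.
have {}H : I sg a r `^ p'^-1 <= K * I v a r `^ p'^-1.
  have U1 := powR_gt0 q^-1 U0.
  rewrite -(ler_pM2l U1) mulrCA; apply: le_trans H _.
  by apply: ler_wpM2l D; exact: ltW.
have pV : p'^-1 * p' = 1 by rewrite mulVf ?gt_eqF.
move: H (I0 w1 (- p') a r) (I0 w2 (- p') a r); move: (I sg a r) (I v a r) => y z H y0 z0.
have := powR_homo (ltW p'0) (powR_ge0 _ _) H.
by rewrite powRM ?powR_ge0 ?(ltW K0)// -!powRrM pV !powRr1.
Qed.

(** Hölder after inserting [w1^(-1) w1]. *)
Lemma weighted_pairing (F : Rn -> R) (f : Rn -> R[i]) (E : set Rn) (M Y : R) : measurable E ->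
  measurable_fun setT F -> (forall x, 0 <= F x) -> cmeasurable setT f -> 0 <= M ->
  (Lpw_norm p (wpow w1 p) E f <= M%:E)%E ->
  (\int[mu]_(x in E) (F x `^ p' * sg x)%:E <= Y%:E)%E ->
  (\int[mu]_(x in E) (F x * normc (f x))%:E <= (Y `^ p'^-1 * M)%:E)%E.
Proof.
move=> mE mF F0 mf M0; have p0 := lt_trans ltr01 p1.
move/(Lpw_norm_leP E f (wpow_ge0 w1 p) p0 M0) => HM HY.
have mnf := measurable_normc mf.
have [_ w10 w1p _] := W1.
have m1 : measurable_fun setT (fun x => F x * wpow w1 (-1) x).
  by apply: measurable_funM => //; exact: measurable_wpow.
have m2 : measurable_fun setT (fun x => normc (f x) * w1 x) by exact: measurable_funM.
have pp' : p'^-1 + p^-1 = 1 by rewrite /conj_exp invrK subrK.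
have F1 x : 0 <= F x * wpow w1 (-1) x by rewrite mulr_ge0// wpow_ge0.
have F2 x : 0 <= normc (f x) * w1 x by rewrite mulr_ge0// normc_ge0.
have -> : (\int[mu]_(x in E) (F x * normc (f x))%:E)%E =
    (\int[mu]_(x in E) (F x * wpow w1 (-1) x * (normc (f x) * w1 x))%:E)%E.
  apply: ae_eq_integral => //.
  - by apply/measurable_EFinP/measurable_funTS; exact: measurable_funM.
  - by apply/measurable_EFinP/measurable_funTS; exact: measurable_funM.
  - apply: filterS w1p => x wx _; congr EFin.
    rewrite /wpow powRN powRr1 ?(ltW wx)//.
    by rewrite mulrACA mulVf ?gt_eqF// mulr1.
have HY' : (\int[mu]_(x in E) ((F x * wpow w1 (-1) x) `^ p')%:E <= Y%:E)%E.
  apply: le_trans HY; rewrite le_eqVlt; apply/orP; left; apply/eqP.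
  apply: eq_integral => x _; rewrite powRM ?wpow_ge0//.
  by rewrite /wpow -powRrM mulN1r.
have HM' : (\int[mu]_(x in E) ((normc (f x) * w1 x) `^ p)%:E <= (M `^ p)%:E)%E.
  by under eq_integral do rewrite powRM ?normc_ge0//.
have := hoelder_le mE m1 m2 F1 F2 p'0 p0 pp' HY' HM'.
by rewrite (powR_inv_cancel (lt0r_neq0 p0) M0).
Qed.

(** The factor that [A_pq_product] yields is expressed by the target weight [u]
    alone, since this is what the integral condition contains. *)
Lemma ball_integral_bound : exists2 K : R, 0 < K & forall a r f (M : R),
  0 < r -> cmeasurable setT f -> 0 <= M ->
  (Lpw_norm p (wpow w1 p) (eball a r) f <= M%:E)%E ->
  (\int[mu]_(x in eball a r) (normc (f x))%:E <=
    (K * M * (r `^ (n%:R * kap) / I u a r `^ q^-1))%:E)%E.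
Proof.
have [K K0 H1] := A_pq_product W1 W2 p1 q0 sp A12.
exists (K * (2 ^+ n) `^ kap); first by rewrite mulr_gt0// powR_gt0// exprn_gt0.
move=> a r f M r0 mf M0 fM; have [_ _ H] := H1 a r r0.
have mB := measurable_eball a r.
have U0 := powR_gt0 q^-1 (weighted_ball_gt0 a r0).
have := @weighted_pairing (cst 1) f _ M (I sg a r) mB (measurable_cst _)
  (fun=> ler01) mf M0 fM.
have -> : (\int[mu]_(x in eball a r) (cst 1 x * normc (f x))%:E)%E =
   (\int[mu]_(x in eball a r) (normc (f x))%:E)%E.
  by apply: eq_integral => x _; rewrite mul1r.
have -> : (\int[mu]_(x in eball a r) (cst 1 x `^ p' * sg x)%:E)%E = (I sg a r)%:E.
  rewrite -Rintegral_EFin//; last exact: sgi.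
  by apply: eq_integral => x _; rewrite powR1 mul1r.
move=> /(_ (lexx _)) /le_trans; apply; rewrite lee_fin.
have {}H : I sg a r `^ p'^-1 <= K * (2 ^+ n) `^ kap * (r `^ (n%:R * kap) / I u a r `^ q^-1).
  rewrite mulrA ler_pdivlMr// mulrC; apply: le_trans H _; rewrite -mulrA.
  exact: (ler_wpM2l (ltW K0) (ball_vol_powR_le a r0 (ltW kap0))).
have := ler_wpM2r M0 H => /le_trans; apply.
by rewrite mulrAC.
Qed.

(** The John-Nirenberg inequality for the weight [sg]: it is only dominated by
    the A-infinity weight [v] on balls. *)
Lemma ball_integral_osc_bound (i0 : 'I_n) : exists2 K : R, 0 < K & forall g b (A : R),
  ball_integrable g -> measurable_fun setT g -> 0 < A -> ball_oscillation A g b ->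
  forall a r f (M : R), 0 < r -> cmeasurable setT f -> 0 <= M ->
  (Lpw_norm p (wpow w1 p) (eball a r) f <= M%:E)%E ->
  (\int[mu]_(x in eball a r) (`|g x - b a r| * normc (f x))%:E <=
    (K * A * M * (r `^ (n%:R * kap) / I u a r `^ q^-1))%:E)%E.
Proof.
have [K K0 H2] := A_pq_product W2 W2 p1 q0 sp A22.
have [KA KA0 [_ vA]] := Ainf_dual.
have [C0 C00 sgv] := sigma_le_dual.
have th'0 : 0 < 1 - th by rewrite subr_gt0.
have [C C0' JN] := john_nirenberg_ball i0 (wpow_ge0 w2 (- p')) vi KA0 th'0 vA
  (wpow_ge0 w1 (- p')) sgi C00 sgv p'0.
exists (C `^ p'^-1 * K * (2 ^+ n) `^ kap).
  by rewrite !mulr_gt0// powR_gt0// exprn_gt0.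
move=> g b A gi mg A0 osc a r f M r0 mf M0 fM; have [_ _ H] := H2 a r r0.
have mB := measurable_eball a r.
have U0 := powR_gt0 q^-1 (weighted_ball_gt0 a r0).
have mgb : measurable_fun setT (fun x => `|g x - b a r|).
  by apply: measurableT_comp => //; exact: measurable_funB.
have := weighted_pairing mB mgb (fun x => normr_ge0 _) mf M0 fM (JN g A b gi mg A0 osc a r r0).
move/le_trans; apply; rewrite lee_fin.
have E : (C * A `^ p' * I v a r) `^ p'^-1 = C `^ p'^-1 * A * I v a r `^ p'^-1.
  move: (I0 w2 (- p') a r); move: (I v a r) => z z0.
  rewrite powRM ?mulr_ge0 ?powR_ge0 ?(ltW C0')// powRM ?powR_ge0 ?(ltW C0')//.
  by rewrite powR_inv_cancel ?gt_eqF ?ltW.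
rewrite E.
have {}H : I v a r `^ p'^-1 <= K * (2 ^+ n) `^ kap * (r `^ (n%:R * kap) / I u a r `^ q^-1).
  rewrite mulrA ler_pdivlMr// mulrC; apply: le_trans H _; rewrite -mulrA.
  exact: (ler_wpM2l (ltW K0) (ball_vol_powR_le a r0 (ltW kap0))).
have CAM : 0 <= C `^ p'^-1 * A * M by rewrite !mulr_ge0 ?powR_ge0// ltW.
have := ler_wpM2l CAM H; rewrite mulrAC => /le_trans; apply.
by rewrite le_eqVlt; apply/orP; left; apply/eqP; ring.
Qed.

End strong_type_weights.

Section weak_type_weights.
Variable q : R.
Hypothesis q0 : 0 < q.
Let qV0 : 0 < q^-1. Proof. by rewrite invr_gt0. Qed.

(** At the endpoint the essential supremum of [w1^(-1)] takes the place of the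
    dual average. *)
Lemma A_1q_product w1 w2 : weight w1 -> weight w2 -> A_pq 1 q w1 w2 ->
  exists2 K : R, 0 < K & forall a r, 0 < r ->
    mu.-integrable (eball a r) (EFin \o wpow w2 q) /\
    exists N : R, [/\ 0 < N,
      {ae mu, forall x, eball a r x -> (w1 x)^-1 <= N} &
      (\int[mu]_(x in eball a r) wpow w2 q x) `^ q^-1 * N <=
        K * ball_vol a r `^ q^-1].
Proof.
move=> W1 W2 [K K0 HK]; exists K => // a r r0.
have [mw1 w10 w1p _] := W1; have [mw2 w20 w2p _] := W2.
have mB := measurable_eball a r; have V0 := ball_vol_gt0 a r0.
have B0 : (0 < mu (eball a r))%E by move: V0; rewrite -lte_fin -leb_eballE.
have T0 : (0 < mu [set: Rn])%E by apply: (lt_le_trans B0); rewrite le_measure ?inE.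
have := HK a r r0; rewrite eqxx /norm_inf unlock T0.
set h := (abse \o _); set Z := ess_sup mu h.
have hE x : eball a r x -> h x = (w1 x)^-1%:E.
  move=> Bx; rewrite /h/= /patch mem_set//= /wpow powRN powRr1//.
  by rewrite ger0_norm// invr_ge0.
have hZ := ess_sup_ge mu h; rewrite -/Z in hZ.
have Z0 : (0 < Z)%E.
  rewrite ltNge; apply/negP => Z0.
  have : {ae mu, forall x, ~ eball a r x}.
    apply: filterS2 hZ w1p => x hx wx Bx; move: (le_trans hx Z0).
    by rewrite hE// lee_fin leNgt invr_gt0 wx.
  case=> M [mM M0 BM]; move: B0.
  suff -> : mu (eball a r) = 0 by rewrite ltxx.
  apply/eqP; rewrite eq_le measure_ge0 andbT -M0 le_measure ?inE//.
  by move=> x Bx; apply: BM => /=; apply.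
have pos : (0 < avg (wpow w2 q) a r)%E.
  rewrite avgE// mule_gt0// ?lte_fin ?invr_gt0//.
  apply: integral_ball_gt0 => //; last exact: wpow_gt0.
    exact: measurable_wpow.
  exact: wpow_ge0.
rewrite -[X in (_ * X <= _)%E](poweRe1 (ltW Z0)).
move=> /(poweR_mul_le pos Z0 qV0 ltr01)[uoo Zoo].
have [ui ->] := avg_fin r0 (measurable_wpow q mw2) (wpow_ge0 _ _) uoo.
have NZ : (fine Z)%:E = Z by rewrite fineK// ge0_fin_numE// ltW.
have N0 : 0 < fine Z by rewrite -lte_fin NZ.
rewrite powRr1 ?(ltW N0)// => le_K; split=> //.
exists (fine Z); split=> //.
  by apply: filterS hZ => x hx Bx; rewrite -lee_fin NZ -hE.
have U0 : 0 <= \int[mu]_(x in eball a r) wpow w2 q x.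
  by apply: Rintegral_ge0 => x _; exact: wpow_ge0.
move: (\int[mu]_(x in eball a r) wpow w2 q x) le_K U0 => U; move: (fine Z) => N.
move: (ball_vol a r) V0 => V V0 le_K U0.
rewrite -ler_pdivrMr ?powR_gt0// mulrAC; apply: le_trans le_K.
rewrite powRM ?invr_ge0 ?(ltW V0)// -[V^-1]powR_inv1 ?(ltW V0)// -powRrM mulN1r powRN.
by rewrite [_^-1 * _]mulrC.
Qed.

Section pair.
Variables (w1 w2 : Rn -> R).
Hypotheses (W1 : weight w1) (W2 : weight w2).
Hypotheses (A12 : A_pq 1 q w1 w2) (A22 : A_pq 1 q w2 w2).
Local Notation u := (wpow w2 q).
Local Notation I g a r := (\int[mu]_(x in eball a r) g x).

Lemma ball_integrable_wpow1 : ball_integrable u.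
Proof.
by have [K _ H] := A_1q_product W2 W2 A22; move=> a r r0; have [] := H a r r0.
Qed.

Lemma weighted_ball1_gt0 a r : 0 < r -> 0 < I u a r.
Proof.
move=> r0; rewrite -lte_fin -Rintegral_EFin//; [|exact: measurable_eball|].
  apply: integral_ball_gt0 => //; [|exact: wpow_ge0|exact: wpow_gt0].
  by apply: measurable_wpow; case: W2.
exact: ball_integrable_wpow1.
Qed.

(** Here [u] is bounded below almost everywhere on the ball by a power of the
    essential supremum of [w2^(-1)]. *)
Lemma Ainf_A1 : exists2 K : R, 0 < K & ball_Ainf K 1 u.
Proof.
have [K K0 H] := A_1q_product W2 W2 A22.
exists (K `^ q); first exact: powR_gt0.
move=> a r F r0 mF FB; have [ui [N [N0 wN HN]]] := H a r r0.
have mB := measurable_eball a r; have V0 := ball_vol_gt0 a r0.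
have [mw2 w20 w2p _] := W2.
have Foo : (mu F < +oo)%E.
  by apply: le_lt_trans (leb_eball_lty a r); rewrite le_measure ?inE.
have uFi := integrableS mB mF FB ui.
have U0 := weighted_ball1_gt0 a r0.
have uF : fine (mu F) <= N `^ q * \int[mu]_(x in F) u x.
  rewrite -lee_fin EFinM -Rintegral_EFin// -ge0_integralZl//; first last.
  - by rewrite lee_fin powR_ge0.
  - by move=> x _; rewrite lee_fin wpow_ge0.
  - exact: measurable_int uFi.
  rewrite fineK ?ge0_fin_numE// -[X in (X <= _)%E]mul1e -integral_cst//.
  apply: ae_ge0_le_integral => //.
  - by move=> x _; rewrite -EFinM lee_fin mulr_ge0 ?powR_ge0.
  - apply/measurable_EFinP/measurable_funTS/measurable_funM => //.
    exact: measurable_wpow.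
  - apply: filterS2 wN w2p => x wx w2x Fx.
    rewrite -EFinM lee_fin /wpow -powRM ?(ltW N0)//.
    have {1}-> : 1 = 1 `^ q :> R by rewrite powR1.
    apply: powR_homo; rewrite ?(ltW q0)//.
    by rewrite -ler_pdivrMr// div1r; exact: wx (FB x Fx).
have u0 : 0 <= \int[mu]_(x in F) u x by apply: Rintegral_ge0 => x _; exact: wpow_ge0.
move: uF HN U0 u0.
move: (I u a r) (\int[mu]_(x in F) u x) (fine (mu F)) (ball_vol a r) V0.
move=> U uF f V V0 fuF HN U0 uF0.
rewrite !powRr1 ?(ltW U0)//.
have {}HN : U * N `^ q <= K `^ q * V.
  have := powR_homo (ltW q0) (mulr_ge0 (powR_ge0 _ _) (ltW N0)) HN.
  rewrite !powRM ?powR_ge0 ?(ltW N0) ?(ltW K0)// -!powRrM mulVf ?gt_eqF//.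
  by rewrite !powRr1// ltW.
apply: le_trans (ler_wpM2r (ltW U0) fuF) _.
apply: le_trans (ler_wpM2r uF0 HN).
by rewrite le_eqVlt; apply/orP; left; apply/eqP; ring.
Qed.

Lemma ball_integral_bound1 : exists2 K : R, 0 < K & forall a r f (M : R),
  0 < r -> cmeasurable setT f -> 0 <= M ->
  (Lpw_norm 1 w1 (eball a r) f <= M%:E)%E ->
  (\int[mu]_(x in eball a r) (normc (f x))%:E <=
    (K * M * (r `^ (n%:R * q^-1) / I u a r `^ q^-1))%:E)%E.
Proof.
have [K K0 H1] := A_1q_product W1 W2 A12.
exists (K * (2 ^+ n) `^ q^-1); first by rewrite mulr_gt0// powR_gt0// exprn_gt0.
move=> a r f M r0 mf M0; have [mw1 w10 w1p _] := W1.
move/(Lpw_norm_leP (eball a r) f w10 ltr01 M0); rewrite powRr1// => fM.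
have [_ [N [N0 wN HN]]] := H1 a r r0.
have mB := measurable_eball a r.
have U0 := powR_gt0 q^-1 (weighted_ball1_gt0 a r0).
have mnf := measurable_normc mf.
have fN : (\int[mu]_(x in eball a r) (normc (f x))%:E <= (N * M)%:E)%E.
  apply: (@le_trans _ _ (\int[mu]_(x in eball a r) (N%:E * (normc (f x) `^ 1 * w1 x)%:E))%E).
    apply: ae_ge0_le_integral => //.
    - by move=> x _; rewrite lee_fin normc_ge0.
    - exact/measurable_EFinP/measurable_funTS.
    - by move=> x _; rewrite -EFinM lee_fin !mulr_ge0 ?powR_ge0 ?(ltW N0).
    - apply/measurable_EFinP/measurable_funTS/measurable_funM => //.
      apply: measurable_funM => //.
      exact: (measurableT_comp (measurable_powR 1)).
    - apply: filterS2 wN w1p => x wx w1x Bx.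
      rewrite -EFinM lee_fin powRr1 ?normc_ge0// mulrCA ler_peMr ?normc_ge0//.
      by rewrite -ler_pdivrMr// div1r; exact: wx.
  rewrite ge0_integralZl//.
  - by rewrite EFinM lee_pmul2l.
  - apply/measurable_EFinP/measurable_funTS/measurable_funM => //.
    exact: (measurableT_comp (measurable_powR 1)).
  - by move=> x _; rewrite lee_fin mulr_ge0 ?powR_ge0.
  - by rewrite lee_fin ltW.
apply: le_trans fN _; rewrite lee_fin.
have {}HN : N <= K * (2 ^+ n) `^ q^-1 * (r `^ (n%:R * q^-1) / I u a r `^ q^-1).
  rewrite mulrA ler_pdivlMr// mulrC; apply: le_trans HN _; rewrite -mulrA.
  exact: (ler_wpM2l (ltW K0) (ball_vol_powR_le a r0 (ltW qV0))).
by have := ler_wpM2r M0 HN => /le_trans; apply; rewrite mulrAC.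
Qed.

End pair.
End weak_type_weights.
End weight_conditions.
(** * Discretization of the Morrey conditions *)
Section dyadic_lower_sums.
Context (R : realType).
Local Notation leb1 := (@lebesgue_measure R).
Implicit Types (g : R -> \bar R) (c : nat -> \bar R) (r : R).

(** The integral of a nonnegative function is a supremum over the simple functions
    below it, hence monotone for arbitrary integrands, such as those of the
    Morrey conditions. *)
Lemma le_integral_nonneg d (X : measurableType d) (m : {measure set X -> \bar R})
    (D : set X) (h g : X -> \bar R) :
  (forall x, D x -> (0 <= h x)%E) -> (forall x, D x -> (h x <= g x)%E) ->
  (\int[m]_(x in D) h x <= \int[m]_(x in D) g x)%E.
Proof.
move=> h0 hg; rewrite integral_mkcond [leRHS]integral_mkcond.
have hD x : (0 <= (h \_ D) x)%E.
  by rewrite /patch; case: ifPn => //; rewrite inE => /h0.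
have hgD x : ((h \_ D) x <= (g \_ D) x)%E.
  by rewrite /patch; case: ifPn => //; rewrite inE => /hg.
rewrite !ge0_integralTE//; last by move=> x; exact: le_trans (hgD x).
apply: ge_ereal_sup => _ [phi /= Hphi <-]; apply: ereal_sup_ubound => /=.
by exists phi => // x; exact: le_trans (hgD x).
Qed.

(** A lower Riemann sum over the shells. *)
Lemma dyadic_integral_ge g c r J : 0 < r ->
  (forall t, r < t -> (0 <= g t)%E) -> (forall j, (0 <= c j)%E) ->
  (forall j t, (0 < j < J)%N -> 2 ^+ j * r < t <= 2 ^+ j.+1 * r -> (c j <= g t)%E) ->
  (\sum_(1 <= j < J) c j * (2 ^+ j * r)%:E <= \int[leb1]_(t in `]r, +oo[) g t)%E.
Proof.
move=> r0 g0 c0 cg.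
pose E j : set R := [set` `]2 ^+ j * r, 2 ^+ j.+1 * r]%R].
pose h j : R -> \bar R := (cst (c j)) \_ (E j).
have p2 j : 0 < 2 ^+ j :> R by rewrite exprn_gt0.
have p21 j : 1 <= 2 ^+ j :> R by rewrite exprn_ege1// ler1n.
have mh j D : measurable_fun D (h j).
  apply: measurable_funTS; apply/(measurable_restrictT _ _).1.
    exact: measurable_itv.
  exact: measurable_cst.
have h0 j t : (0 <= h j t)%E by rewrite /h /patch; case: ifPn => _ //; exact: c0.
have hI j : (\int[leb1]_(t in `]r, +oo[) h j t)%E = (c j * (2 ^+ j * r)%:E)%E.
  rewrite -integral_mkcondr (_ : _ `&` _ = E j); last first.
    apply/seteqP; split => [t []//|t Et]; split => //.
    move: Et; rewrite /E/= !in_itv/= andbT => /andP[+ _]; apply: le_lt_trans.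
    by rewrite ler_peMl// ltW.
  rewrite integral_cst; last exact: measurable_itv.
  congr (_ * _)%E; rewrite [LHS]lebesgue_measure_itv/= lte_fin ltr_pM2r//.
  by rewrite ltr_eXn2l ?ltr1n// ltnSn -EFinB exprS; congr EFin; ring.
rewrite (eq_bigr (fun j => \int[leb1]_(t in `]r, +oo[) h j t)%E); last first.
  by move=> j _; rewrite hI.
have mD : measurable ([set` `]r, +oo[%R] : set (measurableTypeR R)).
  exact: measurable_itv.
have <- := @ge0_integral_sum _ _ R leb1 _ mD nat h (fun j => mh j _)
  (fun j t _ => h0 j t) (index_iota 1 J).
apply: le_integral_nonneg => t.
  by move=> _; apply: sume_ge0 => j _; exact: h0.
rewrite /= in_itv/= andbT => rt.
suff : (\sum_(1 <= j < J) h j t <= g t)%E /\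
    (2 ^+ J * r < t -> (\sum_(1 <= j < J) h j t)%E = 0) by case.
elim: J cg => [|[|J] IH] cg; [by rewrite big_geq// g0..|].
have [|IH1 IH2] := IH _.
  by move=> j s /andP[j1 jJ]; apply: cg; rewrite j1 ltnS ltnW.
rewrite big_nat_recr//=; have [tJ|tJ] := ltP (2 ^+ J.+1 * r) t.
  rewrite IH2// add0e; split.
    rewrite /h /patch; case: ifPn; last by rewrite g0.
    by rewrite inE /E/= in_itv/= => tE; apply: cg; rewrite //= ltnS leqnn.
  move=> tJ2; rewrite /h /patch memNset// /E/= in_itv/=.
  by move=> /andP[_]; rewrite leNgt tJ2.
have -> : h J.+1 t = 0.
  by rewrite /h /patch memNset// /E/= in_itv/= => /andP[+ _]; rewrite ltNge tJ.
rewrite adde0; split => // tJ2; exfalso; move: tJ; rewrite leNgt => /negP; apply.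
by apply: lt_trans tJ2; rewrite ltr_pM2r// ltr_eXn2l// ltr1n.
Qed.

End dyadic_lower_sums.
Section real_fractions.
Context (R : realFieldType).

Lemma fraction_le (x y z z' t t' : R) : 0 <= x -> x <= y -> 0 < z -> z <= z' ->
  0 < t -> t <= t' -> x / z' / t' <= y / z / t.
Proof.
move=> x0 xy z0 zz' t0 tt'.
have z'0 := lt_le_trans z0 zz'; have t'0 := lt_le_trans t0 tt'.
apply: ler_pM; rewrite ?divr_ge0 ?invr_ge0 ?(ltW z'0) ?(ltW t'0)//.
  by apply: ler_pM; rewrite ?invr_ge0 ?(ltW z'0) ?lef_pV2 ?posrE.
by rewrite lef_pV2 ?posrE.
Qed.

Lemma half_cancel (x z : R) : 0 < z -> x / (2 * z) * z = 2^-1 * x.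
Proof. by move=> z0; rewrite invfM mulrA divfK ?gt_eqF// mulrC. Qed.

End real_fractions.

Section morrey_condition.
Context (R : realType) (n : nat).
Local Notation Rn := (Rn R n).
Local Notation mu := (leb R n).
Local Notation leb1 := (@lebesgue_measure R).
Implicit Types (a x : Rn) (r t : R) (f : Rn -> R[i]).
Variables (p q : R) (w1 w2 : Rn -> R) (psi1 psi2 : Rn -> R -> R).
Hypotheses (W1 : weight w1) (W2 : weight w2) (p0 : 0 < p) (q0 : 0 < q).
Hypothesis ui : ball_integrable (wpow w2 q).
Hypothesis psi1_gt0 : forall a r, 0 < r -> 0 < psi1 a r.
Hypothesis psi2_gt0 : forall a r, 0 < r -> 0 < psi2 a r.
Local Notation omega := (wpow w1 p).
Local Notation u := (wpow w2 q).

Definition target_size a r : R := (\int[mu]_(x in eball a r) u x) `^ q^-1.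

Let mw1 : measurable_fun setT w1. Proof. by case: W1. Qed.
Let mw2 : measurable_fun setT w2. Proof. by case: W2. Qed.

Lemma target_sizeE a r : 0 < r ->
  (wmeas u (eball a r) `^ q^-1)%E = (target_size a r)%:E.
Proof.
move=> r0; rewrite /wmeas Rintegral_EFin ?poweR_EFin//.
  exact: measurable_eball.
exact: ui.
Qed.

Lemma target_size_gt0 a r : 0 < r -> 0 < target_size a r.
Proof.
move=> r0; apply: powR_gt0; rewrite -lte_fin -Rintegral_EFin//.
- apply: integral_ball_gt0 => //; [exact: measurable_wpow|exact: wpow_ge0|].
  exact: wpow_gt0.
- exact: measurable_eball.
- exact: ui.
Qed.

Lemma target_sizeS a r r' : 0 < r -> r <= r' -> target_size a r <= target_size a r'.
Proof.
move=> r0 rr'; apply: powR_homo.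
- by rewrite invr_ge0 ltW.
- by apply: Rintegral_ge0 => x _; exact: wpow_ge0.
- apply: subset_Rintegral; [exact: measurable_eball|exact: measurable_eball|..].
  + exact: eballS.
  + exact/ui/lt_le_trans/rr'.
  + exact: wpow_ge0.
Qed.

(** The infimum in the Morrey conditions, an extended real since [w1^p] need not
    be integrable on balls; [source_inf_fin] shows that it is finite. *)
Definition source_inf a t : \bar R :=
  ereal_inf [set ((psi1 a l)%:E * wmeas omega (eball a l) `^ p^-1)%E
             | l in [set` `[t, +oo[%R]].

Lemma source_inf_ge0 a t : 0 < t -> (0 <= source_inf a t)%E.
Proof.
move=> t0; apply/ereal_infP => _ [l /= + <-]; rewrite in_itv/= andbT => tl.
rewrite mule_ge0 ?poweR_ge0// lee_fin ltW// psi1_gt0//.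
exact: lt_le_trans tl.
Qed.

Lemma source_infS a t t' : t <= t' -> (source_inf a t <= source_inf a t')%E.
Proof.
move=> tt'; apply: ereal_inf_le_tmp => _ [l /= + <-].
rewrite in_itv/= andbT => t'l; exists l => //=.
by rewrite in_itv/= andbT (le_trans tt').
Qed.

Definition source_size a t : R := fine (source_inf a t).

Section discretization.
Variables (lam : R -> R -> R) (l : nat -> R).
Hypothesis lam_ge0 : forall r t, 0 < r -> r < t -> 0 <= lam r t.
Hypothesis l_gt0 : forall j, 0 < l j.
Hypothesis l_le : forall r t j, 0 < r -> 2 ^+ j * r < t <= 2 ^+ j.+1 * r ->
  l j <= lam r t.
Hypothesis cond : (sup_balls (fun a r => (psi2 a r)^-1%:E *
  \int[leb1]_(t in `]r, +oo[)
    ((lam r t)%:E * psi_ratio psi1 p q w1 w2 a t * t^-1%:E)) < +oo)%E.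

Let pow2_gt0 j r : 0 < r -> 0 < 2 ^+ j * r.
Proof. by move=> r0; rewrite mulr_gt0// exprn_gt0. Qed.

Let psi_ratioE a t : 0 < t ->
  psi_ratio psi1 p q w1 w2 a t = (source_inf a t * (target_size a t)^-1%:E)%E.
Proof.
move=> t0; rewrite /psi_ratio target_sizeE// inver gt_eqF//.
exact: target_size_gt0.
Qed.

(** On the [j]-th shell the infimum is at least its value at the inner radius, and
    the weight in the denominator at most its value at the outer radius. *)
Lemma dyadic_condition : exists2 M0 : R, 0 <= M0 & forall a r J, 0 < r ->
  (\sum_(1 <= j < J) (l j / target_size a (2 ^+ j.+1 * r))%:E * source_inf a (2 ^+ j * r)
    <= (M0 * psi2 a r)%:E)%E.
Proof.
move: cond; set S := sup_balls _ => Soo.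
exists (2 * `|fine S|); first by rewrite mulr_ge0.
move=> a r J r0; have P0 := psi2_gt0 a r0.
set g := (fun t => (lam r t)%:E * psi_ratio psi1 p q w1 w2 a t * t^-1%:E)%E.
have g0 t : r < t -> (0 <= g t)%E.
  move=> rt; have t0 := lt_trans r0 rt.
  rewrite /g psi_ratioE//; have := source_inf_ge0 a t0.
  move: (source_inf a t) => y y0; have W0 := target_size_gt0 a t0.
  by rewrite !mule_ge0 ?lee_fin ?invr_ge0 ?lam_ge0 ?(ltW t0) ?(ltW W0).
have gS : ((psi2 a r)^-1%:E * \int[leb1]_(t in `]r, +oo[) g t <= S)%E.
  by apply: ereal_sup_ubound; exists (a, r).
have I0 : (0 <= \int[leb1]_(t in `]r, +oo[) g t)%E.
  by apply: integral_ge0 => t /=; rewrite in_itv/= andbT; exact: g0.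
have S0 : (0 <= S)%E.
  by apply: le_trans gS; rewrite mule_ge0// lee_fin invr_ge0 ltW.
have SE : S = (`|fine S|)%:E.
  by rewrite ger0_norm ?fine_ge0// fineK// ge0_fin_numE.
have {}gS : (\int[leb1]_(t in `]r, +oo[) g t <= (`|fine S| * psi2 a r)%:E)%E.
  by move: gS; rewrite lee_pdivrMl// => /le_trans; apply; rewrite {1}SE -EFinM mulrC.
pose c j := ((l j / target_size a (2 ^+ j.+1 * r) / (2 ^+ j.+1 * r))%:E *
  source_inf a (2 ^+ j * r))%E.
have k0 j : 0 <= l j / target_size a (2 ^+ j.+1 * r).
  rewrite divr_ge0 ?(ltW (l_gt0 _))// ltW//.
  exact/target_size_gt0/pow2_gt0.
have c0 j : (0 <= c j)%E.
  rewrite mule_ge0 ?source_inf_ge0 ?pow2_gt0// lee_fin.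
  by rewrite divr_ge0// ltW// pow2_gt0.
have cg j t : (0 < j < J)%N -> 2 ^+ j * r < t <= 2 ^+ j.+1 * r -> (c j <= g t)%E.
  move=> _ jt; have /andP[jt1 jt2] := jt.
  have t0 : 0 < t := lt_trans (pow2_gt0 j r0) jt1.
  rewrite /c /g psi_ratioE// (muleC (source_inf _ t)) muleA -EFinM muleAC -EFinM.
  have T0 := pow2_gt0 j.+1 r0; have Wt := target_size_gt0 a t0.
  have WT := target_size_gt0 a T0.
  apply: lee_pmul; rewrite ?source_inf_ge0 ?pow2_gt0 ?source_infS ?(ltW jt1)//.
    by rewrite lee_fin divr_ge0// ltW.
  rewrite lee_fin; exact: (fraction_le (ltW (l_gt0 j)) (l_le r0 jt) Wt
    (target_sizeS a t0 jt2) t0 jt2).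
have := dyadic_integral_ge r0 g0 c0 cg => /le_trans /(_ gS).
have -> : (\sum_(1 <= j < J) c j * (2 ^+ j * r)%:E)%E =
    (2^-1%:E * \sum_(1 <= j < J) (l j / target_size a (2 ^+ j.+1 * r))%:E *
      source_inf a (2 ^+ j * r))%E.
  rewrite ge0_sume_distrr.
    apply: eq_bigr => j _; rewrite /c muleAC -EFinM muleA; congr (_ * _)%E.
    rewrite -EFinM; congr EFin; have -> : 2 ^+ j.+1 * r = 2 * (2 ^+ j * r) by rewrite exprS mulrA.
    by rewrite half_cancel// pow2_gt0.
  by move=> j _; rewrite mule_ge0 ?source_inf_ge0 ?pow2_gt0// lee_fin.
rewrite lee_pdivrMl// -EFinM mulrA.
by [].
Qed.

(** A single term of the sum for the radius [t / 2] bounds the infimum at [t]. *)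
Lemma source_inf_fin a t : 0 < t -> source_inf a t = (source_size a t)%:E.
Proof.
move=> t0; rewrite /source_size fineK// ge0_fin_numE ?source_inf_ge0//.
have [M0 _ H] := dyadic_condition.
have t20 : 0 < t / 2 by rewrite divr_gt0.
have := H a (t / 2) 2 t20; rewrite big_nat1 expr1.
have -> : 2 * (t / 2) = t by rewrite mulrC divfK.
have k0 : 0 < l 1 / target_size a (2 ^+ 2 * (t / 2)).
  apply: divr_gt0; first exact: l_gt0.
  by apply: target_size_gt0; exact: pow2_gt0.
move: (l 1 / _) k0 => k k0 Hk; rewrite ltNge leye_eq; apply/negP => /eqP E.
by move: Hk; rewrite E gt0_muley ?lte_fin// leye_eq.
Qed.

Lemma dyadic_sum : exists2 M0 : R, 0 <= M0 & forall a r J, 0 < r ->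
  \sum_(1 <= j < J) l j / target_size a (2 ^+ j.+1 * r) * source_size a (2 ^+ j * r)
    <= M0 * psi2 a r.
Proof.
have [M0 M00 H] := dyadic_condition; exists M0 => // a r J r0.
have := H a r J r0.
rewrite (eq_bigr (fun j =>
  (l j / target_size a (2 ^+ j.+1 * r) * source_size a (2 ^+ j * r))%:E)).
  by rewrite sumEFin lee_fin.
by move=> j _; rewrite source_inf_fin// pow2_gt0.
Qed.

Lemma source_ball_lty a t : 0 < t -> (wmeas omega (eball a t) < +oo)%E.
Proof.
move=> t0; rewrite ltNge leye_eq; apply/negP => /eqP tE.
suff : source_inf a t = +oo%E by rewrite source_inf_fin.
apply/eqP; rewrite -leye_eq; apply/ereal_infP => _ [z /= + <-].
rewrite in_itv/= andbT => tz.
have -> : wmeas omega (eball a z) = +oo%E.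
  apply/eqP; rewrite -leye_eq -tE /wmeas; apply: ge0_subset_integral.
  - exact: measurable_eball.
  - exact: measurable_eball.
  - by apply/measurable_EFinP/measurable_funTS; exact: measurable_wpow.
  - by move=> x _; rewrite lee_fin wpow_ge0.
  - exact: eballS.
by rewrite poweRyr ?gt_eqF ?invr_gt0// gt0_muley ?lte_fin ?psi1_gt0// (lt_le_trans t0).
Qed.

(** Inside a ball the norm of [f] is controlled by every larger ball, hence by
    the infimum in the Morrey condition. *)
Lemma Morrey_norm_ball f a t (M : R) : 0 < t -> 0 < M -> cmeasurable setT f ->
  (Morrey_norm psi1 p omega f <= M%:E)%E ->
  (Lpw_norm p omega (eball a t) f <= (M * source_size a t)%:E)%E.
Proof.
move=> t0 M0 mf fM; rewrite EFinM -source_inf_fin// -lee_pdivrMl//.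
apply/ereal_infP => _ [z /= + <-]; rewrite in_itv/= andbT => tz.
have z0 := lt_le_trans t0 tz; have P0 := psi1_gt0 a z0.
rewrite lee_pdivrMl//.
have W0 : (0 < wmeas omega (eball a z))%E.
  apply: integral_ball_gt0 => //; [exact: measurable_wpow|exact: wpow_ge0|].
  exact: wpow_gt0.
have : (wmeas omega (eball a z) `^ p^-1)%E \is a fin_num.
  by rewrite fin_num_poweR// ge0_fin_numE ?source_ball_lty// ltW.
have : (0 < wmeas omega (eball a z) `^ p^-1)%E by rewrite poweR_gt0.
have : (((psi1 a z)^-1)%:E * (wmeas omega (eball a z) `^ p^-1)^-1 *
    Lpw_norm p omega (eball a z) f <= M%:E)%E.
  by apply: le_trans fM; apply: ereal_sup_ubound; exists (a, z).
case: (wmeas omega (eball a z) `^ p^-1)%E => // y + y0 _; rewrite lte_fin in y0.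
rewrite inver gt_eqF// -EFinM -invfM lee_pdivrMl ?mulr_gt0// => H.
apply: (@le_trans _ _ (Lpw_norm p omega (eball a z) f)); last first.
  by apply: le_trans H _; rewrite -!EFinM lee_fin mulrC.
rewrite /Lpw_norm gt0_ler_poweR ?invr_ge0 ?(ltW p0)//.
- rewrite in_itv/= leey andbT; apply: integral_ge0 => x _.
  by rewrite lee_fin mulr_ge0 ?powR_ge0 ?wpow_ge0.
- rewrite in_itv/= leey andbT; apply: integral_ge0 => x _.
  by rewrite lee_fin mulr_ge0 ?powR_ge0 ?wpow_ge0.
- apply: ge0_subset_integral.
  + exact: measurable_eball.
  + exact: measurable_eball.
  + apply/measurable_EFinP/measurable_funTS/measurable_funM; last exact: measurable_wpow.
    exact: (measurableT_comp (measurable_powR p) (measurable_normc mf)).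
  + by move=> x _; rewrite lee_fin mulr_ge0 ?powR_ge0 ?wpow_ge0.
  + exact: eballS.
Qed.

End discretization.
End morrey_condition.
(** * Dyadic bounds for the tail *)
Section dyadic_tail.
Context (R : realType) (n : nat).
Local Notation Rn := (Rn R n).
Local Notation mu := (leb R n).

Lemma powR_nhomo (e x y : R) : e <= 0 -> 0 < x -> x <= y -> y `^ e <= x `^ e.
Proof.
move=> e0 x0 xy; rewrite -(opprK e) !(powRN _ (- e)).
have y0 := lt_le_trans x0 xy.
by rewrite lef_pV2 ?posrE ?powR_gt0// powR_homo ?oppr_ge0 ?(ltW x0).
Qed.

Lemma eball_cover (a : Rn) r : 0 < r -> \bigcup_J eball a (2 ^+ J * r) = setT.
Proof.
move=> r0; rewrite -subTset => y _.
have [m] : exists m : nat, edist y a / r < m%:R.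
  by exists (Num.trunc (edist y a / r)).+1; exact: truncnS_gt.
rewrite ltr_pdivrMr// => ym; exists m => //; rewrite /eball/=.
apply: lt_le_trans ym _; rewrite ler_pM2r// -natrX ler_nat.
by rewrite ltnW// ltn_expl.
Qed.

(** On the shell between the radii [2^j r] and [2^(j+1) r] the factor
    [edist y a `^ e] is at most its value at the inner radius. *)
Lemma dyadic_tail (g : Rn -> R) a r (e S : R) (I : nat -> R) : 0 < r -> e <= 0 ->
  measurable_fun setT g -> (forall y, 0 <= g y) ->
  (forall y, eball a (2 * r) y -> g y = 0) ->
  (forall j, (0 < j)%N ->
    (\int[mu]_(y in eball a (2 ^+ j.+1 * r)) (g y)%:E <= (I j)%:E)%E) ->
  (forall J, \sum_(1 <= j < J) (2 ^+ j * r) `^ e * I j <= S) ->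
  (\int[mu]_y (g y * edist y a `^ e)%:E <= S%:E)%E.
Proof.
move=> r0 e0 mg g0 gB gI IS; rewrite -(eball_cover a r0).
have mF J : measurable (eball a (2 ^+ J * r)) by exact: measurable_eball.
have mge : measurable_fun setT (fun y => (g y * edist y a `^ e)%:E).
  apply/measurable_EFinP/measurable_funM => //.
  exact: (measurableT_comp (measurable_powR e) (measurable_edist a)).
have ge0 y : (0 <= (g y * edist y a `^ e)%:E)%E by rewrite lee_fin mulr_ge0// powR_ge0.
have p2 j : 0 < 2 ^+ j * r by rewrite mulr_gt0// exprn_gt0.
have FS i j : (i <= j)%N -> eball a (2 ^+ i * r) `<=` eball a (2 ^+ j * r).
  by move=> ij; apply: eballS; rewrite ler_pM2r// ler_weXn2l// ler1n.
apply: integral_bigcup_le => //.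
  by move=> i j ij; apply/subsetPset; exact: FS.
move=> J; apply: le_trans (_ : _ <= (\sum_(1 <= j < J) (2 ^+ j * r) `^ e * I j)%:E)%E _;
  last by rewrite lee_fin.
elim: J => [|[|J] IH].
- rewrite big_geq// integral0_eq// => y By; rewrite gB ?mul0r//.
  by have := FS 0 1 isT y By; rewrite expr1.
- rewrite big_geq// integral0_eq// => y; rewrite expr1 => By.
  by rewrite gB ?mul0r.
rewrite big_nat_recr//= EFinD.
have -> : eball a (2 ^+ J.+2 * r) = eball a (2 ^+ J.+1 * r) `|`
    (eball a (2 ^+ J.+2 * r) `\` eball a (2 ^+ J.+1 * r)).
  by rewrite setDUK//; exact: FS.
rewrite ge0_integral_setU//.
- apply: leeD => //.
  apply: (@le_trans _ _ (\int[mu]_(y in eball a (2 ^+ J.+2 * r) `\` eball a (2 ^+ J.+1 * r))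
      (((2 ^+ J.+1 * r) `^ e)%:E * (g y)%:E))%E).
    apply: ge0_le_integral => //.
    + exact: measurableD.
    + exact: measurable_funTS.
    + by apply/measurable_EFinP/measurable_funTS; exact: measurable_funM.
    + move=> y [_ /negP]; rewrite -leNgt => yJ; rewrite -EFinM lee_fin mulrC.
      by rewrite ler_wpM2r// powR_nhomo.
  rewrite ge0_integralZl//; first last.
  + by rewrite lee_fin powR_ge0.
  + by move=> y _; rewrite lee_fin.
  + by apply/measurable_EFinP; exact: measurable_funTS.
  + exact: measurableD.
  rewrite EFinM; apply: lee_pmul => //.
  + by rewrite lee_fin powR_ge0.
  + by apply: integral_ge0 => y _; rewrite lee_fin.
  + apply: le_trans (gI J.+1 isT); apply: ge0_subset_integral => //.
    * exact: measurableD.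
    * by apply/measurable_EFinP; exact: measurable_funTS.
    * by move=> y _; rewrite lee_fin.
- exact: measurableD.
- exact: measurable_funTS.
- by rewrite disj_set2E setDIK.
Qed.

End dyadic_tail.
(** * Splitting a function at a ball *)
Section restriction.
Context (R : realType) (n : nat).
Local Notation Rn := (Rn R n).
Local Notation mu := (leb R n).
Local Notation normc := (@Normc.normc R).
Implicit Types (E : set Rn) (f : Rn -> R[i]) (x : Rn).

Definition crestrict E f : Rn -> R[i] := fun x => ((\1_E x)%:C * f x)%C.

Lemma crestrict_in E f x : E x -> crestrict E f x = f x.
Proof. by move=> Ex; rewrite /crestrict indicE mem_set// mul1r. Qed.

Lemma crestrict_out E f x : ~ E x -> crestrict E f x = 0.
Proof. by move=> Ex; rewrite /crestrict indicE memNset// mul0r. Qed.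

Lemma crestrictD E f x : f x = crestrict E f x + crestrict (~` E) f x.
Proof.
have [Ex|Ex] := pselect (E x); first by rewrite crestrict_in// crestrict_out ?addr0//; exact.
by rewrite crestrict_out// crestrict_in ?add0r.
Qed.

Lemma normc0 : normc 0 = 0 :> R.
Proof. by rewrite normcE/= expr0n/= addr0 sqrtr0. Qed.

Lemma normc_crestrict E f x : normc (crestrict E f x) <= normc (f x).
Proof.
have [Ex|Ex] := pselect (E x); first by rewrite crestrict_in.
by rewrite crestrict_out// normc0 normc_ge0.
Qed.

Lemma cmeasurable_crestrict E f : measurable E -> cmeasurable setT f ->
  cmeasurable setT (crestrict E f).
Proof.
move=> mE mf; apply: cmeasurableM => //; apply: cmeasurable_real.
exact: measurable_indic.
Qed.

Lemma Lpw_norm_crestrict p w E f : 0 < p -> measurable E ->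
  Lpw_norm p w setT (crestrict E f) = Lpw_norm p w E f.
Proof.
move=> p0 mE; rewrite /Lpw_norm [in RHS]integral_mkcond.
suff -> : (\int[mu]_x (normc (crestrict E f x) `^ p * w x)%:E)%E =
    (\int[mu]_x ((fun x => (normc (f x) `^ p * w x)%:E) \_ E) x)%E by [].
apply: eq_integral => x _; rewrite /patch; case: ifPn => [|/negP] xE.
  by rewrite crestrict_in//; exact: set_mem.
rewrite crestrict_out; last by move=> /mem_set.
by rewrite normc0 powR0 ?gt_eqF// mul0r.
Qed.

End restriction.
(** * The tail in terms of the Morrey condition *)
Section condition_bounds.
Context (R : realType) (n : nat).
Local Notation Rn := (Rn R n).
Local Notation mu := (leb R n).
Implicit Types (a : Rn) (r : R).
Variables (al D M0 : R) (W src psi2 : Rn -> R -> R) (l : nat -> R).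
Hypothesis aln : al < n%:R.
Hypothesis W_gt0 : forall a r, 0 < r -> 0 < W a r.
Hypothesis src_ge0 : forall a r, 0 < r -> 0 <= src a r.
Hypothesis M00 : 0 <= M0.
Hypothesis psi2_gt0 : forall a r, 0 < r -> 0 < psi2 a r.
Hypothesis D0 : 0 < D.
Hypothesis W_double : forall a r, 0 < r -> W a (2 * r) <= D * W a r.
Hypothesis l_gt0 : forall j, 0 < l j.
Hypothesis dyadic : forall a r J, 0 < r ->
  \sum_(1 <= j < J) l j / W a (2 ^+ j.+1 * r) * src a (2 ^+ j * r) <= M0 * psi2 a r.

Let pow2_gt0 j r : 0 < r -> 0 < 2 ^+ j * r.
Proof. by move=> r0; rewrite mulr_gt0// exprn_gt0. Qed.

Let pow2S j r : 2 ^+ j.+1 * r = 2 * (2 ^+ j * r).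
Proof. by rewrite exprS mulrA. Qed.

(** The first term of the dyadic sum alone. *)
Lemma source_le_target : forall a r, 0 < r ->
  src a (2 * r) <= M0 * D * D / l 1 * psi2 a r * W a r.
Proof.
move=> a r r0; have MP := mulr_ge0 M00 (ltW (psi2_gt0 a r0)).
have := dyadic a 2 r0; rewrite big_nat1 expr1.
have r20 : 0 < 2 * r by rewrite mulr_gt0.
have W2 : W a (2 ^+ 2 * r) <= D * (D * W a r).
  rewrite pow2S expr1; apply: le_trans (W_double a r20) _.
  by apply: ler_wpM2l (W_double a r0); exact: ltW.
have W40 : 0 < W a (2 ^+ 2 * r) by apply/W_gt0/pow2_gt0.
move: MP; move: (W a (2 ^+ 2 * r)) (src a (2 * r)) (l 1%N) (l_gt0 1) (psi2 a r) (W a r) W2 W40.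
move=> w s l1 l10 P w0 w2 w40 MP H.
have -> : s = (l1 / w * s) * (w / l1) by field; rewrite !gt_eqF.
have wl0 : 0 <= w / l1 by rewrite divr_ge0// ltW.
apply: le_trans (ler_wpM2r wl0 H) _.
have -> : M0 * D * D / l1 * P * w0 = M0 * P * (D * (D * w0) / l1) by ring.
by apply: ler_wpM2l => //; rewrite ler_wpM2r// invr_ge0 ltW.
Qed.

(** The powers of the radius cancel, and doubling turns the radius of the weight
    into the one in the dyadic sum. *)
Lemma tail_bound (h : Rn -> R) a r (Q : R) : 0 < r -> 0 <= Q ->
  measurable_fun setT h -> (forall y, 0 <= h y) ->
  (forall y, eball a (2 * r) y -> h y = 0) ->
  (forall j, (0 < j)%N -> let t := 2 ^+ j.+1 * r in
    (\int[mu]_(y in eball a t) (h y)%:E <=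
      (Q * l j.+1 * src a t * (t `^ (n%:R - al) / W a t))%:E)%E) ->
  (\int[mu]_y (h y * edist y a `^ (al - n%:R))%:E <=
    (2 `^ (n%:R - al) * D * M0 * Q * psi2 a r)%:E)%E.
Proof.
move=> r0 Q0 mh h0 hB hI.
have e0 : al - n%:R <= 0 by rewrite subr_le0 ltW.
apply: (dyadic_tail r0 e0 mh h0 hB hI) => J.
set F := fun j => l j / W a (2 ^+ j.+1 * r) * src a (2 ^+ j * r).
have F0 j : 0 <= F j.
  by rewrite /F mulr_ge0 ?src_ge0 ?pow2_gt0// divr_ge0// ltW// ?W_gt0 ?pow2_gt0.
have FJ : \sum_(1 <= j < J) F j.+1 <= M0 * psi2 a r.
  apply: le_trans (_ : _ <= \sum_(1 <= j < J.+1) F j) (dyadic a J.+1 r0).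
  case: J => [|J]; first by rewrite !big_geq.
  by rewrite [leRHS]big_ltn// big_add1/= lerDr.
have Ee : 0 < 2 `^ (n%:R - al) :> R by rewrite powR_gt0.
rewrite mulrAC.
apply: le_trans (_ : _ <= \sum_(1 <= j < J) (2 `^ (n%:R - al) * D * Q) * F j.+1) _.
  apply: ler_sum_nat => j _; rewrite /F.
  have T0 := pow2_gt0 j r0; have T10 := pow2_gt0 j.+1 r0.
  have E : (2 ^+ j * r) `^ (al - n%:R) * (2 ^+ j.+1 * r) `^ (n%:R - al) = 2 `^ (n%:R - al).
    rewrite pow2S (powRM _ (ler0n _ 2) (ltW T0)) mulrCA -powRDp//.
    by rewrite addrA subrK subrr powRr0 mulr1.
  have WW := W_double a T10; rewrite -pow2S in WW.
  have W1 := W_gt0 a T10; have W20 := W_gt0 a (pow2_gt0 j.+2 r0).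
  have {}WW : (W a (2 ^+ j.+1 * r))^-1 <= D / W a (2 ^+ j.+2 * r).
    by rewrite ler_pdivlMr// mulrC ler_pdivrMr.
  have s0 := src_ge0 a T10; have l0 := l_gt0 j.+1.
  move: (src a _) s0 (l _) l0 (W a _) (W a _) W1 W20 WW E Ee => s s0 l1 l10 wb wa.
  move: (_ `^ _) (_ `^ _) (_ `^ _) => z y x wa0 wb0 wab xyz z0.
  have -> : x * (Q * l1 * s * (y / wa)) = z * Q * l1 * s * wa^-1.
    by rewrite -xyz; ring.
  have -> : z * D * Q * (l1 / wb * s) = z * Q * l1 * s * (D / wb) by ring.
  by apply: ler_wpM2l => //; rewrite !mulr_ge0// ltW.
rewrite -mulr_sumr; apply: le_trans (ler_wpM2l _ FJ) _.
  by rewrite !mulr_ge0// ltW.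
by rewrite le_eqVlt; apply/orP; left; apply/eqP; ring.
Qed.
End condition_bounds.
(** * Norms of sums *)
Section norm_combination.
Context (R : realType) (n : nat).
Local Notation Rn := (Rn R n).
Local Notation mu := (leb R n).
Local Notation normc := (@Normc.normc R).
Implicit Types (E : set Rn) (F f : Rn -> R[i]) (x : Rn) (w h : Rn -> R).

Lemma scaled_le (G : \bar R) (x y z : R) : 0 < x -> 0 < y ->
  (G <= (z * x * y)%:E)%E -> (x^-1%:E * (y%:E)^-1 * G <= z%:E)%E.
Proof.
move=> x0 y0 H; rewrite inver gt_eqF// -EFinM -invfM lee_pdivrMl ?mulr_gt0//.
by rewrite -EFinM mulrC mulrA.
Qed.

(** Estimates are proved for positive majorants [M] of a norm that may vanish;
    this recovers the norm itself. *)
Lemma le_mul_of_majorants (y : \bar R) (K m : R) : 0 <= K ->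
  (forall M, m < M -> (y <= (K * M)%:E)%E) -> (y <= (K * m)%:E)%E.
Proof.
move=> K0 H; apply/lee_addgt0Pr => e e0.
have K10 : 0 < K + 1 by rewrite ltr_wpDl.
apply: le_trans (H (m + e / (K + 1)) _) _; first by rewrite ltrDl divr_gt0.
rewrite -EFinD lee_fin mulrDr lerD2l mulrCA ler_piMr ?(ltW e0)//.
by rewrite ler_pdivrMr// mul1r lerDl.
Qed.

(** The constant [9] is not optimal: [(h1 + h2 + h3)^q <= 3^q (h1^q + h2^q + h3^q)]
    and [3^(q+1) <= 9^q]. *)
Lemma strong_combine w E F h1 h2 h3 (q X : R) : measurable E -> 1 <= q -> 0 <= X ->
  measurable_fun setT w -> (forall x, 0 <= w x) -> cmeasurable setT F ->
  measurable_fun setT h1 -> measurable_fun setT h2 -> measurable_fun setT h3 ->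
  (forall x, 0 <= h1 x) -> (forall x, 0 <= h2 x) -> (forall x, 0 <= h3 x) ->
  {ae mu, forall x, E x -> normc (F x) <= h1 x + h2 x + h3 x} ->
  (\int[mu]_(x in E) (h1 x `^ q * w x)%:E <= (X `^ q)%:E)%E ->
  (\int[mu]_(x in E) (h2 x `^ q * w x)%:E <= (X `^ q)%:E)%E ->
  (\int[mu]_(x in E) (h3 x `^ q * w x)%:E <= (X `^ q)%:E)%E ->
  (Lpw_norm q w E F <= (9 * X)%:E)%E.
Proof.
move=> mE q1 X0 mw w0 mF m1 m2 m3 p1 p2 p3 Fh I1 I2 I3.
have q0 : 0 < q by exact: lt_le_trans q1.
apply/Lpw_norm_leP => //; first by rewrite mulr_ge0.
have mh h : measurable_fun setT h ->
    measurable_fun setT (fun x => (h x `^ q * w x)%:E).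
  move=> m; apply/measurable_EFinP/measurable_funM => //.
  exact: (measurableT_comp (measurable_powR q)).
have g0 h x : (0 <= (h x `^ q * w x)%:E)%E by rewrite lee_fin mulr_ge0// powR_ge0.
pose H x := ((h1 x `^ q * w x)%:E + (h2 x `^ q * w x)%:E + (h3 x `^ q * w x)%:E)%E.
have mH : measurable_fun setT H.
  by do 2?[apply: emeasurable_funD]; exact: mh.
have H0 x : (0 <= H x)%E by rewrite !adde_ge0.
have p9 : 3 `^ q * 3 <= 9 `^ q :> R.
  have -> : 9 = 3 * 3 :> R by ring.
  rewrite powRM// ler_wpM2l ?powR_ge0//.
  have {1}<- : 3 `^ 1 = 3 :> R by rewrite powRr1.
  by apply: ler_powR => //; rewrite ler1n.
apply: (@le_trans _ _ (\int[mu]_(x in E) ((3 `^ q)%:E * H x))%E).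
  apply: ae_ge0_le_integral => //.
  - by move=> x _; rewrite lee_fin mulr_ge0 ?powR_ge0.
  - exact: measurable_funTS (mh (fun x => normc (F x)) (measurable_normc mF)).
  - by move=> x _; rewrite mule_ge0// lee_fin powR_ge0.
  - by apply: measurable_funeM; exact: measurable_funTS.
  - apply: filterS Fh => x Fx Ex; rewrite /H -!EFinD -EFinM lee_fin -!mulrDl mulrA.
    apply: ler_wpM2r => //.
    set y := Num.max (h1 x) (Num.max (h2 x) (h3 x)).
    have hy : h1 x <= y /\ h2 x <= y /\ h3 x <= y.
      by rewrite /y !le_max !lexx !orbT.
    have [hy1 [hy2 hy3]] := hy.
    apply: (@le_trans _ _ ((3 * y) `^ q)).
      apply: powR_homo; rewrite ?normc_ge0 ?(ltW q0)//.
      by apply: le_trans (Fx Ex) _; lra.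
    have y0 : 0 <= y by exact: le_trans hy1.
    rewrite powRM// ler_wpM2l ?powR_ge0//.
    have := powR_ge0 (h1 x) q; have := powR_ge0 (h2 x) q; have := powR_ge0 (h3 x) q.
    have [->|[->|->]] : y = h1 x \/ y = h2 x \/ y = h3 x.
      rewrite /y; case: (leP (h1 x) _) => _; last by left.
      by case: (leP (h2 x) _) => _; [right; right|right; left].
    - by move=> *; lra.
    - by move=> *; lra.
    - by move=> *; lra.
rewrite ge0_integralZl//; last exact: measurable_funTS.
  rewrite /H ge0_integralD//; first last.
  - exact: measurable_funTS (mh _ m3).
  - by apply: measurable_funTS; apply: emeasurable_funD; exact: mh.
  - by move=> x _; rewrite adde_ge0.
  rewrite ge0_integralD//; first last.
  - exact: measurable_funTS (mh _ m2).
  - exact: measurable_funTS (mh _ m1).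
  apply: (@le_trans _ _ ((3 `^ q)%:E * ((X `^ q)%:E + (X `^ q)%:E + (X `^ q)%:E))%E).
    apply: lee_wpmul2l; first by rewrite lee_fin powR_ge0.
    exact: (leeD (leeD I1 I2) I3).
  rewrite -!EFinD -EFinM lee_fin powRM// (le_trans _ (ler_wpM2r (powR_ge0 X q) p9))//.
  by rewrite le_eqVlt; apply/orP; left; apply/eqP; ring.
Qed.

(** At a level above [2 * S] the bounded part [f2] takes up at most half of the
    level; below [2 * S] the measure of the whole ball is good enough. *)
Lemma weak_combine w E F f1 f2 (q X S W : R) : measurable E -> 0 < q ->
  measurable_fun setT w -> (forall x, 0 <= w x) ->
  0 <= X -> 0 <= S -> 0 <= W ->
  cmeasurable setT F -> cmeasurable setT f1 ->
  (wmeas w E `^ q^-1 <= W%:E)%E ->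
  {ae mu, forall x, E x -> F x = f1 x + f2 x} ->
  (forall x, E x -> normc (f2 x) <= S) ->
  (WLpw_norm q w setT f1 <= X%:E)%E ->
  (WLpw_norm q w E F <= (2 * (X + S * W))%:E)%E.
Proof.
move=> mE q0 mw w0 X0 S0 W0 mF mf1 wW Fe f2S f1X.
have qV0 : 0 < q^-1 by rewrite invr_gt0.
have SW0 : 0 <= S * W by rewrite mulr_ge0.
apply: ge_ereal_sup => _ [g /= + <-]; rewrite in_itv/= andbT => g0.
have mlevel (h : Rn -> R[i]) (c : R) : cmeasurable setT h ->
    measurable [set x | c < normc (h x)].
  move=> mh; have := measurable_normc mh measurableT (measurable_itv `]c, +oo[).
  rewrite setTI; congr measurable; apply/seteqP; split => x /=;
    by rewrite in_itv/= andbT.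
have mw' D : measurable_fun D (fun x => (w x)%:E).
  by apply/measurable_EFinP; exact: measurable_funTS.
have [gS|gS] := leP (2 * S) g; last first.
  apply: (@le_trans _ _ (g%:E * W%:E)%E).
    apply: lee_wpmul2l; first by rewrite lee_fin ltW.
    apply: le_trans wW; rewrite gt0_ler_poweR ?(ltW qV0)//.
    - by rewrite in_itv/= leey andbT; apply: integral_ge0 => x _; rewrite lee_fin.
    - by rewrite in_itv/= leey andbT; apply: integral_ge0 => x _; rewrite lee_fin.
    - apply: ge0_subset_integral => //; first by apply: measurableI => //; exact: mlevel.
      by move=> x _; rewrite lee_fin.
  rewrite -EFinM lee_fin mulrDr mulrA ler_wpDl ?mulr_ge0//.
  by rewrite ler_wpM2r// ltW.
apply: (@le_trans _ _ (2%:E * ((g / 2)%:E *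
    wmeas w (setT `&` [set x | (g / 2 < normc (f1 x))%R]) `^ q^-1))%E).
  rewrite muleA -EFinM mulrC divfK//; apply: lee_wpmul2l; first by rewrite lee_fin ltW.
  rewrite gt0_ler_poweR ?(ltW qV0)//.
  - by rewrite in_itv/= leey andbT; apply: integral_ge0 => x _; rewrite lee_fin.
  - by rewrite in_itv/= leey andbT; apply: integral_ge0 => x _; rewrite lee_fin.
  - rewrite /wmeas setTI integral_mkcond [leRHS]integral_mkcond.
    have mr D : measurable D -> measurable_fun setT ((fun x => (w x)%:E) \_ D).
      by move=> mD; apply/(measurable_restrictT _ mD).
    apply: ae_ge0_le_integral => //.
    + by move=> x _; rewrite /patch; case: ifPn; rewrite lee_fin.
    + by apply: mr; apply: measurableI => //; exact: mlevel.
    + by move=> x _; rewrite /patch; case: ifPn; rewrite lee_fin.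
    + by apply: mr; exact: mlevel.
    + apply: filterS Fe => x Fx _; rewrite /patch.
      case: ifPn => [/set_mem[Ex /= gF]|_]; last by case: ifPn; rewrite lee_fin.
      rewrite mem_set//=; have := normcD (f1 x) (f2 x); rewrite -Fx// => H.
      have := f2S x Ex; lra.
apply: (@le_trans _ _ (2%:E * X%:E)%E).
  apply: lee_wpmul2l => //; apply: le_trans f1X; apply: ereal_sup_ubound.
  by exists (g / 2) => //=; rewrite in_itv/= andbT divr_gt0.
by rewrite -EFinM lee_fin ler_pM2l// lerDl.
Qed.

End norm_combination.
(** * Fractional powers on Morrey spaces *)
Section operator_on_Morrey.
Context (R : realType) (n : nat).
Local Notation Rn := (Rn R n).
Local Notation mu := (leb R n).
Local Notation normc := (@Normc.normc R).
Implicit Types (a x : Rn) (r t M : R) (f : Rn -> R[i]).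
Variables (k : R -> Rn -> Rn -> R[i]) (al p q : R) (w1 w2 : Rn -> R).
Variables (psi1 psi2 : Rn -> R -> R).
Hypothesis mk : cmeasurable [set z : measurableTypeR R * (Rn * Rn) | 0 < (z.1 : R)]
  (fun z : measurableTypeR R * (Rn * Rn) => k z.1 z.2.1 z.2.2).
Hypothesis alN : 0 < al < n%:R.
Hypothesis gb : gaussian_bound k.
Hypotheses (W2 : weight w2) (p0 : 0 < p) (q1 : 1 <= q).
Hypothesis ui : ball_integrable (wpow w2 q).
Hypothesis psi1_gt0 : forall a r, 0 < r -> 0 < psi1 a r.
Hypothesis psi2_gt0 : forall a r, 0 < r -> 0 < psi2 a r.
Local Notation omega := (wpow w1 p).
Local Notation u := (wpow w2 q).
Local Notation W := (target_size q w2).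
Local Notation src := (source_size p w1 psi1).
Local Notation N := (frac_power k al).
Local Notation Morrey1 := (Morrey_norm psi1 p omega).
Local Notation Morrey2 := (Morrey_norm psi2 q u).
Local Notation near a r f := (crestrict (eball a (2 * r)) f).
Local Notation far a r f := (crestrict (~` eball a (2 * r)) f).
Variables (K1 D M0 c : R) (l : nat -> R).
Hypothesis K10 : 0 < K1.
Hypothesis average_bound : forall a r f M, 0 < r -> cmeasurable setT f -> 0 <= M ->
  (Lpw_norm p omega (eball a r) f <= M%:E)%E ->
  (\int[mu]_(x in eball a r) (normc (f x))%:E <=
    (K1 * M * (r `^ (n%:R - al) / W a r))%:E)%E.
Hypothesis D0 : 0 < D.
Hypothesis W_double : forall a r, 0 < r -> W a (2 * r) <= D * W a r.
Hypothesis M00 : 0 <= M0.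
Hypothesis c0 : 0 < c.
Hypothesis l_ge : forall j, c <= l j.
Hypothesis dyadic : forall a r J, 0 < r ->
  \sum_(1 <= j < J) l j / W a (2 ^+ j.+1 * r) * src a (2 ^+ j * r) <= M0 * psi2 a r.
Hypothesis Morrey_ball : forall f a t M, 0 < t -> 0 < M -> cmeasurable setT f ->
  (Morrey1 f <= M%:E)%E -> (Lpw_norm p omega (eball a t) f <= (M * src a t)%:E)%E.

Let q0 : 0 < q. Proof. exact: lt_le_trans q1. Qed.
Let aln : al < n%:R. Proof. by case/andP: alN. Qed.
Let l_gt0 j : 0 < l j. Proof. exact: lt_le_trans c0 (l_ge j). Qed.
Let W_gt0 a r : 0 < r -> 0 < W a r. Proof. exact: target_size_gt0. Qed.
Let src_ge0 a r : 0 < r -> 0 <= src a r.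
Proof. by move=> r0; rewrite fine_ge0// source_inf_ge0. Qed.
Let mw2 : measurable_fun setT w2. Proof. by case: W2. Qed.
Let pow2_gt0 j r : 0 < r -> 0 < 2 ^+ j * r.
Proof. by move=> r0; rewrite mulr_gt0// exprn_gt0. Qed.

Lemma cmeasurable_near a r f : cmeasurable setT f -> cmeasurable setT (near a r f).
Proof. by apply: cmeasurable_crestrict; exact: measurable_eball. Qed.

Lemma cmeasurable_far a r f : cmeasurable setT f -> cmeasurable setT (far a r f).
Proof. by apply: cmeasurable_crestrict; apply: measurableC; exact: measurable_eball. Qed.

Lemma far_eq0 a r f y : eball a (2 * r) y -> far a r f y = 0.
Proof. by move=> By; rewrite crestrict_out//; exact. Qed.

(** The doubled ball is one of the balls in the Morrey norm. *)
Lemma near_norm : exists2 K : R, 0 <= K & forall a r f M, 0 < r -> 0 < M ->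
  cmeasurable setT f -> (Morrey1 f <= M%:E)%E ->
  (Lpw_norm p omega setT (near a r f) <= (K * M * psi2 a r * W a r)%:E)%E.
Proof.
exists (M0 * D * D / l 1) => [|a r f M r0 M0' mf fM].
  by rewrite divr_ge0 ?mulr_ge0// ltW.
have r20 : 0 < 2 * r by rewrite mulr_gt0.
rewrite Lpw_norm_crestrict//; last exact: measurable_eball.
apply: le_trans (Morrey_ball a r20 M0' mf fM) _; rewrite lee_fin.
have H := source_le_target W_gt0 M00 psi2_gt0 D0 W_double l_gt0 dyadic a r0.
apply: le_trans (ler_wpM2l (ltW M0') H) _.
by rewrite le_eqVlt; apply/orP; left; apply/eqP; ring.
Qed.

(** The integrals of [|f|] over the dyadic balls, bounded by [average_bound], are
    summed by [tail_bound]. *)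
Lemma far_bound : exists2 K : R, 0 <= K & forall a r f M, 0 < r -> 0 < M ->
  cmeasurable setT f -> (Morrey1 f <= M%:E)%E -> forall x, eball a r x ->
  converges k al (far a r f) x /\ normc (N (far a r f) x) <= K * M * psi2 a r.
Proof.
have [Kt Kt0 tail] := frac_power_tail mk alN gb.
pose K2 := 2 `^ (n%:R - al) * D * M0 * (K1 / c).
have K20 : 0 <= K2.
  by rewrite /K2; rewrite !mulr_ge0 ?powR_ge0 ?invr_ge0 ?(ltW K10) ?(ltW D0) ?(ltW c0).
exists (Kt * K2) => [|a r f M r0 Mp mf fM]; first by rewrite mulr_ge0// ltW.
have mfar := cmeasurable_far a r mf.
rewrite -2!mulrA; apply: tail => //.
- by move=> y; exact: far_eq0.
- by rewrite mulr_ge0// mulr_ge0 ?(ltW Mp) ?(ltW (psi2_gt0 a r0)).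
have Q0 : 0 <= K1 * M / c by rewrite !mulr_ge0 ?invr_ge0// ltW.
have := tail_bound aln W_gt0 src_ge0 D0 W_double l_gt0 dyadic r0 Q0
  (measurable_normc mfar) (fun y => normc_ge0 _).
move=> /(_ a); rewrite (_ : 2 `^ _ * D * M0 * (K1 * M / c) * psi2 a r = K2 * (M * psi2 a r)); last first.
  by rewrite /K2; ring.
apply; first by move=> y By; rewrite far_eq0// normc0.
move=> j _; rewrite /=; have := pow2_gt0 j.+1 r0; move: (2 ^+ _ * r) => t t0.
have mB := measurable_eball a t.
apply: (@le_trans _ _ (\int[mu]_(y in eball a t) (normc (f y))%:E)%E).
  apply: le_integral_nonneg => y _; rewrite lee_fin ?normc_ge0//.
  exact: normc_crestrict.
have MS0 : 0 <= M * src a t by rewrite mulr_ge0 ?src_ge0// ltW.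
apply: le_trans (average_bound t0 mf MS0 (Morrey_ball a t0 Mp mf fM)) _.
rewrite lee_fin; have Wt := W_gt0 a t0.
have P0 : 0 <= K1 * (M * src a t) * (t `^ (n%:R - al) / W a t).
  by rewrite !mulr_ge0 ?powR_ge0 ?src_ge0 ?invr_ge0 ?(ltW K10) ?(ltW Mp) ?(ltW Wt).
have -> : K1 * M / c * l j.+1 * src a t * (t `^ (n%:R - al) / W a t) =
    K1 * (M * src a t) * (t `^ (n%:R - al) / W a t) * (l j.+1 / c) by ring.
by rewrite ler_peMr// ler_pdivlMr// mul1r.
Qed.

Lemma converges_split a r f x : converges k al (near a r f) x ->
  converges k al (far a r f) x ->
  converges k al f x /\ N f x = N (near a r f) x + N (far a r f) x.
Proof.
move=> cn cf; have [] := converges_lin 1 cn cf; rewrite mul1r.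
suff -> : (fun y => 1 * near a r f y + far a r f y) = f by [].
by apply/funext => y; rewrite mul1r -crestrictD.
Qed.

(** Countably many balls cover the space. *)
Lemma Morrey_converges f M : 0 < M -> cmeasurable setT f -> (Morrey1 f <= M%:E)%E ->
  (forall a r, 0 < r -> {ae mu, forall x, converges k al (near a r f) x}) ->
  {ae mu, forall x, converges k al f x}.
Proof.
move=> Mp mf fM nc; have [K _ H] := far_bound.
pose z : Rn := [tuple of nseq n (0 : measurableTypeR R)].
have : {ae mu, forall x, forall J : nat, eball z (2 ^+ J * 1) x -> converges k al f x}.
  apply/ae_foralln => J; have r0 := pow2_gt0 J (@ltr01 R).
  apply: filterS (nc z _ r0) => x cn Bx.
  have [cf _] := H z _ f M r0 Mp mf fM x Bx.
  by have [] := converges_split cn cf.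
apply: filterS => x Hx.
have [J _ Bx] : (\bigcup_J eball z (2 ^+ J * 1)) x by rewrite eball_cover.
exact: Hx Bx.
Qed.

Lemma sup_balls_le (G : Rn -> R -> \bar R) (y : R) :
  (forall a r, 0 < r -> (G a r <= (y * psi2 a r * W a r)%:E)%E) ->
  (sup_balls (fun a r => (psi2 a r)^-1%:E * (wmeas u (eball a r) `^ q^-1)^-1 * G a r)
    <= y%:E)%E.
Proof.
move=> HG; apply: ge_ereal_sup => _ [[a r] /= r0 <-].
rewrite target_sizeE//; apply: scaled_le; [exact: psi2_gt0|exact: W_gt0|exact: HG].
Qed.

Lemma Morrey1_ge0 f : (0 <= Morrey1 f)%E.
Proof.
pose z : Rn := [tuple of nseq n (0 : measurableTypeR R)].
apply: (@le_trans _ _ ((psi1 z 1)^-1%:E * (wmeas omega (eball z 1) `^ p^-1)^-1 *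
    Lpw_norm p omega (eball z 1) f)%E); last first.
  by apply: ereal_sup_ubound; exists (z, 1) => //=.
by rewrite mule_ge0 ?poweR_ge0// mule_ge0 ?inve_ge0 ?poweR_ge0// lee_fin invr_ge0 ltW ?psi1_gt0.
Qed.

(** The passage from balls to suprema over balls; [M] ranges over the positive
    majorants of the norm of [f], which itself may vanish. *)
Lemma bounded_by_of_balls (Op : operator R n) (G : Rn -> R -> (Rn -> R[i]) -> \bar R)
    (K : R) : 0 <= K ->
  (forall f M, 0 < M -> cmeasurable setT f -> (Morrey1 f <= M%:E)%E ->
    [/\ dom Op f, cmeasurable setT (Op f) &
      forall a r, 0 < r -> (G a r (Op f) <= (K * M * psi2 a r * W a r)%:E)%E]) ->
  bounded_by K%:E Morrey1 (fun g => sup_balls (fun a r =>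
    (psi2 a r)^-1%:E * (wmeas u (eball a r) `^ q^-1)^-1 * G a r g)%E) Op.
Proof.
move=> K0 H f mf foo; have f0 := Morrey1_ge0 f.
have fE : Morrey1 f = (fine (Morrey1 f))%:E by rewrite fineK// ge0_fin_numE.
have HM M : fine (Morrey1 f) < M -> 0 < M /\ (Morrey1 f <= M%:E)%E.
  move=> mM; split; first by apply: le_lt_trans mM; rewrite fine_ge0.
  by rewrite fE lee_fin ltW.
have [M1 fM1] := HM (fine (Morrey1 f) + 1) (ltr_pwDr ltr01 (lexx _)).
have [dO mO _] := H f _ M1 mf fM1.
have le : (sup_balls (fun a r => (psi2 a r)^-1%:E *
    (wmeas u (eball a r) `^ q^-1)^-1 * G a r (Op f)) <= K%:E * Morrey1 f)%E.
  rewrite fE -EFinM; apply: le_mul_of_majorants => // M /HM[Mp fM].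
  by apply: sup_balls_le => a r r0; have [_ _] := H f M Mp mf fM; exact.
split=> //; apply: le_lt_trans le _.
by rewrite fE -EFinM ltry.
Qed.

Lemma near_far_converges (C : R) (nY : (Rn -> R[i]) -> \bar R) f M :
  bounded_by C%:E (Lpw_norm p omega setT) nY N -> 0 < M -> cmeasurable setT f ->
  (Morrey1 f <= M%:E)%E -> forall a r, 0 < r ->
  {ae mu, forall x, converges k al (near a r f) x}.
Proof.
move=> Nb Mp mf fM a r r0; have [Kn _ Hn] := near_norm.
have mn := cmeasurable_near a r mf.
have := le_lt_trans (Hn a r f M r0 Mp mf fM) (ltry _).
by move=> /(Nb _ mn)[].
Qed.

Lemma near_far_split (C : R) (nY : (Rn -> R[i]) -> \bar R) f M a r :
  bounded_by C%:E (Lpw_norm p omega setT) nY N -> 0 < M -> cmeasurable setT f ->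
  (Morrey1 f <= M%:E)%E -> 0 < r ->
  {ae mu, forall x, eball a r x -> N f x = N (near a r f) x + N (far a r f) x}.
Proof.
move=> Nb Mp mf fM r0; have [Kf _ Hf] := far_bound.
apply: filterS (near_far_converges Nb Mp mf fM a r0) => x cn Bx.
have [cf _] := Hf a r f M r0 Mp mf fM x Bx.
by have [] := converges_split cn cf.
Qed.

Lemma bounded_ball_norm (h : Rn -> R) a r (S : R) : 0 < r -> 0 <= S ->
  measurable_fun setT h -> (forall x, 0 <= h x) ->
  (forall x, eball a r x -> h x <= S) ->
  (\int[mu]_(x in eball a r) (h x `^ q * u x)%:E <= ((S * W a r) `^ q)%:E)%E.
Proof.
move=> r0 S0 mh h0 hS; have mB := measurable_eball a r.
have uB := ui a r0.
apply: (@le_trans _ _ (\int[mu]_(x in eball a r) ((S `^ q)%:E * (u x)%:E))%E).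
  apply: le_integral_nonneg => x Bx; first by rewrite lee_fin mulr_ge0 ?powR_ge0.
  rewrite -EFinM lee_fin ler_wpM2r ?powR_ge0//; apply: powR_homo => //.
  - exact: ltW.
  - exact: hS.
rewrite ge0_integralZl//; first last.
- by rewrite lee_fin powR_ge0.
- by move=> x _; rewrite lee_fin wpow_ge0.
- exact: measurable_int uB.
rewrite Rintegral_EFin// -EFinM lee_fin powRM ?(ltW (W_gt0 a r0))//.
have U0 : 0 <= \int[mu]_(x in eball a r) u x.
  by apply: Rintegral_ge0 => x _; exact: wpow_ge0.
by rewrite /target_size -powRrM mulVf ?gt_eqF// powRr1.
Qed.

Lemma strong_Morrey_bound : bounded (Lpw_norm p omega setT) (Lpw_norm q u setT) N ->
  bounded Morrey1 Morrey2 N.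
Proof.
move=> [C C0 Nb].
have [Kn Kn0 Hn] := near_norm; have [Kf Kf0 Hf] := far_bound.
exists (9 * (C * Kn + Kf) + 1).
  by rewrite ltr_wpDl// mulr_ge0// addr_ge0// mulr_ge0// ltW.
have K0 : 0 <= 9 * (C * Kn + Kf) + 1.
  by rewrite addr_ge0// mulr_ge0// addr_ge0// mulr_ge0// ltW.
apply: (@bounded_by_of_balls N (fun a r => Lpw_norm q u (eball a r)) _ K0).
move=> f M Mp mf fM.
have mNf := cmeasurable_frac_power al mk mf.
split => // [|a r r0].
  exact: (Morrey_converges Mp mf fM (near_far_converges Nb Mp mf fM)).
have mn := cmeasurable_near a r mf; have mfar := cmeasurable_far a r mf.
have P2 := psi2_gt0 a r0; have Wp := W_gt0 a r0.
have mNn := cmeasurable_frac_power al mk mn; have mNf' := cmeasurable_frac_power al mk mfar.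
set X := Kn * M * psi2 a r * W a r.
have X0 : 0 <= X by rewrite /X !mulr_ge0// ltW.
have nX : (Lpw_norm p omega setT (near a r f) <= X%:E)%E := Hn a r f M r0 Mp mf fM.
have [_ _ _ nY] := Nb _ mn (le_lt_trans nX (ltry _)).
have {}nY : (Lpw_norm q u setT (N (near a r f)) <= (C * X)%:E)%E.
  by apply: le_trans nY _; rewrite EFinM; apply: lee_wpmul2l => //; rewrite lee_fin ltW.
set S := Kf * M * psi2 a r.
have S0 : 0 <= S by rewrite /S !mulr_ge0// ltW.
have CX0 : 0 <= C * X by rewrite mulr_ge0// ltW.
have SW0 : 0 <= S * W a r by rewrite mulr_ge0// ltW.
have mB := measurable_eball a r.
apply: (@le_trans _ _ (9 * (C * X + S * W a r))%:E).
  apply: (strong_combine mB q1 (addr_ge0 CX0 SW0) (measurable_wpow q mw2)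
    (wpow_ge0 _ _) mNf (measurable_normc mNn) (measurable_normc mNf')
    (measurable_cst (0 : R))).
  - by move=> x; exact: normc_ge0.
  - by move=> x; exact: normc_ge0.
  - by move=> x; exact: lexx.
  - apply: filterS (near_far_split a Nb Mp mf fM r0) => x Nx Bx.
    by rewrite Nx// addr0; exact: normcD.
  - have [/(_ nY) + _] := Lpw_norm_leP setT (N (near a r f)) (wpow_ge0 w2 q) q0 CX0.
    move=> H; apply: le_trans (_ : _ <= ((C * X) `^ q)%:E)%E _; last first.
      by rewrite lee_fin powR_homo ?(ltW q0)// lerDl.
    apply: le_trans H; apply: ge0_subset_integral => //.
      apply/measurable_EFinP/measurable_funM; last exact: measurable_wpow.
      exact: (measurableT_comp (measurable_powR q) (measurable_normc mNn)).
    by move=> x _; rewrite lee_fin mulr_ge0 ?powR_ge0.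
  - apply: le_trans (_ : _ <= ((S * W a r) `^ q)%:E)%E _; last first.
      by rewrite lee_fin powR_homo ?(ltW q0)// lerDr.
    apply: bounded_ball_norm => //; first exact: measurable_normc.
      by move=> x; exact: normc_ge0.
    by move=> x Bx; have [] := Hf a r f M r0 Mp mf fM x Bx.
  - rewrite integral0_eq ?lee_fin ?powR_ge0// => x _.
    by rewrite powR0 ?gt_eqF// mul0r.
rewrite lee_fin /X /S.
have -> : 9 * (C * (Kn * M * psi2 a r * W a r) + Kf * M * psi2 a r * W a r) =
  9 * (C * Kn + Kf) * (M * psi2 a r * W a r) by ring.
rewrite -!mulrA [leRHS]mulrDl mul1r mulrA lerDl.
by rewrite !mulr_ge0// ltW.
Qed.

Lemma weak_Morrey_bound :
  bounded (Lpw_norm p omega setT) (WLpw_norm q u setT) N ->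
  bounded Morrey1 (WMorrey_norm psi2 q u) N.
Proof.
move=> [C C0 Nb].
have [Kn Kn0 Hn] := near_norm; have [Kf Kf0 Hf] := far_bound.
exists (2 * (C * Kn + Kf) + 1).
  by rewrite ltr_wpDl// mulr_ge0// addr_ge0// mulr_ge0// ltW.
have K0 : 0 <= 2 * (C * Kn + Kf) + 1.
  by rewrite addr_ge0// mulr_ge0// addr_ge0// mulr_ge0// ltW.
apply: (@bounded_by_of_balls N (fun a r => WLpw_norm q u (eball a r)) _ K0).
move=> f M Mp mf fM.
have mNf := cmeasurable_frac_power al mk mf.
split => // [|a r r0].
  exact: (Morrey_converges Mp mf fM (near_far_converges Nb Mp mf fM)).
have mn := cmeasurable_near a r mf; have mfar := cmeasurable_far a r mf.
have P2 := psi2_gt0 a r0; have Wp := W_gt0 a r0.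
have mNn := cmeasurable_frac_power al mk mn.
set X := Kn * M * psi2 a r * W a r.
have X0 : 0 <= X by rewrite /X !mulr_ge0// ltW.
have nX : (Lpw_norm p omega setT (near a r f) <= X%:E)%E := Hn a r f M r0 Mp mf fM.
have [_ _ _ nY] := Nb _ mn (le_lt_trans nX (ltry _)).
have {}nY : (WLpw_norm q u setT (N (near a r f)) <= (C * X)%:E)%E.
  by apply: le_trans nY _; rewrite EFinM; apply: lee_wpmul2l => //; rewrite lee_fin ltW.
set S := Kf * M * psi2 a r.
have S0 : 0 <= S by rewrite /S !mulr_ge0// ltW.
have CX0 : 0 <= C * X by rewrite mulr_ge0// ltW.
have mB := measurable_eball a r.
have uW : (wmeas u (eball a r) `^ q^-1 <= (W a r)%:E)%E by rewrite target_sizeE.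
apply: (@le_trans _ _ (2 * (C * X + S * W a r))%:E).
  apply: (weak_combine mB q0 (measurable_wpow q mw2) (wpow_ge0 _ _) CX0 S0 (ltW Wp)
    mNf mNn uW (near_far_split a Nb Mp mf fM r0) _ nY).
  by move=> x Bx; have [] := Hf a r f M r0 Mp mf fM x Bx.
rewrite lee_fin /X /S.
have -> : 2 * (C * (Kn * M * psi2 a r * W a r) + Kf * M * psi2 a r * W a r) =
  2 * (C * Kn + Kf) * (M * psi2 a r * W a r) by ring.
rewrite -!mulrA [leRHS]mulrDl mul1r mulrA lerDl.
by rewrite !mulr_ge0// ltW.
Qed.

(** * The commutator *)

Section mean_oscillation.
Variables (b : Rn -> R[i]) (A : R).
Hypothesis bB : BMO b.
Hypothesis A0 : 0 < A.
Hypothesis bA : (bmo_norm b <= A%:E)%E.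
Local Notation Reb := (fun x => complex.Re (b x)).
Local Notation Imb := (fun x => complex.Im (b x)).
Local Notation Rem a r := (complex.Re (bmean b a r)).
Local Notation Imm a r := (complex.Im (bmean b a r)).

Let mb : cmeasurable setT b. Proof. by case: bB. Qed.

Lemma BMO_parts : [/\ ball_integrable Reb, ball_integrable Imb,
  measurable_fun setT Reb & measurable_fun setT Imb].
Proof.
have [[mr mi] bi _] := bB; split => //.
- by move=> a r r0; case: (bi a r r0).
- by move=> a r r0; case: (bi a r r0).
Qed.

Let oscillation_of (g : Rn -> R) (m : Rn -> R -> R) : ball_integrable g ->
  measurable_fun setT g ->
  (forall a r x, `|g x - m a r| <= normc (b x - bmean b a r)) ->
  ball_oscillation A g m.
Proof.
move=> gi mg gm a r r0; have mB := measurable_eball a r.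
have V0 := ball_vol_gt0 a r0.
apply: le_Rintegral_of => //.
  by apply: integrable_dev => //; [exact: leb_eball_lty|exact: gi].
have : (avg (fun x => normc (b x - bmean b a r)%R) a r <= A%:E)%E.
  by apply: le_trans bA; apply: ereal_sup_ubound; exists (a, r).
rewrite avgE// lee_pdivrMl// => H.
rewrite mulrC EFinM; apply: le_trans H.
by apply: le_integral_nonneg => x _; rewrite lee_fin// gm.
Qed.

Lemma BMO_oscillation : ball_oscillation A Reb (fun a r => Rem a r) /\
  ball_oscillation A Imb (fun a r => Imm a r).
Proof.
have [ri ii mr mi] := BMO_parts.
have ReB (z z' : R[i]) : complex.Re (z - z') = complex.Re z - complex.Re z'.
  by case: z z' => [? ?] [? ?].
have ImB (z z' : R[i]) : complex.Im (z - z') = complex.Im z - complex.Im z'.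
  by case: z z' => [? ?] [? ?].
split; apply: oscillation_of => // a r x.
- by rewrite -ReB Re_le_normc.
- by rewrite -ImB Im_le_normc.
Qed.

Local Notation step := (1 + (2 * n.+1%:R) ^+ n : R).

(** Each doubling of the ball moves the mean by at most [step * A]. *)
Lemma mean_chain j a r x : 0 < r ->
  normc (b x - bmean b a r) <=
    `|Reb x - Rem a (2 ^+ j * r)| + `|Imb x - Imm a (2 ^+ j * r)| +
    2 * j%:R * step * A.
Proof.
move=> r0; have [ri ii mr mi] := BMO_parts; have [ro io] := BMO_oscillation.
have chain (g : Rn -> R) (m : Rn -> R -> R) : ball_integrable g ->
    ball_oscillation A g m -> `|m a (2 ^+ j * r) - m a r| <= j%:R * step * A.
  move=> gi go; elim: j => [|j IH]; first by rewrite expr0 mul1r subrr normr0 !mul0r.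
  have Tj := pow2_gt0 j r0.
  have := oscillation_double a gi go Tj; rewrite exprS -mulrA => H.
  have := ler_distD (m a (2 ^+ j * r)) (m a (2 * (2 ^+ j * r))) (m a r).
  move=> /le_trans; apply.
  have -> : j.+1%:R * step * A = step * A + j%:R * step * A by rewrite -natr1; ring.
  exact: lerD H IH.
have cR := chain _ _ ri ro; have cI := chain _ _ ii io.
apply: le_trans (normc_le _) _.
have -> : complex.Re (b x - bmean b a r) = complex.Re (b x) - Rem a r.
  by case: (b x) (bmean b a r) => [? ?] [? ?].
have -> : complex.Im (b x - bmean b a r) = complex.Im (b x) - Imm a r.
  by case: (b x) (bmean b a r) => [? ?] [? ?].
have := ler_distD (Rem a (2 ^+ j * r)) (complex.Re (b x)) (Rem a r).
have := ler_distD (Imm a (2 ^+ j * r)) (complex.Im (b x)) (Imm a r).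
lra.
Qed.

End mean_oscillation.

Section commutator.
Variables (K2 Cu : R).
Hypotheses (K20 : 0 < K2) (Cu0 : 0 < Cu).
Hypothesis osc_bound : forall g m (A : R), ball_integrable g -> measurable_fun setT g ->
  0 < A -> ball_oscillation A g m ->
  forall a r f M, 0 < r -> cmeasurable setT f -> 0 <= M ->
  (Lpw_norm p omega (eball a r) f <= M%:E)%E ->
  (\int[mu]_(x in eball a r) (`|g x - m a r| * normc (f x))%:E <=
    (K2 * A * M * (r `^ (n%:R - al) / W a r))%:E)%E.
Hypothesis JN : forall g (A : R) m, ball_integrable g -> measurable_fun setT g ->
  0 < A -> ball_oscillation A g m -> forall a r, 0 < r ->
  (\int[mu]_(x in eball a r) (`|g x - m a r| `^ q * u x)%:E <=
    (Cu * A `^ q * \int[mu]_(x in eball a r) u x)%:E)%E.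
Hypothesis l_lin : forall j, c * (1 + j%:R) <= l j.
Local Notation step := (1 + (2 * n.+1%:R) ^+ n : R).

Lemma BMO_ball_norm b (A : R) a r : BMO b -> 0 < A -> (bmo_norm b <= A%:E)%E -> 0 < r ->
  (\int[mu]_(x in eball a r) (normc (b x - bmean b a r) `^ q * u x)%:E <=
    (2 `^ q * 2 * Cu * (A * W a r) `^ q)%:E)%E.
Proof.
move=> bB A0 bA r0; have [ri ii mr mi] := BMO_parts bB.
have [ro io] := BMO_oscillation bB bA.
have HR := JN ri mr A0 ro a r0; have HI := JN ii mi A0 io a r0.
have mB := measurable_eball a r.
have mdev (g : Rn -> R) (m : R) : measurable_fun setT g ->
    measurable_fun (eball a r) (fun x => (`|g x - m| `^ q * u x)%:E).
  move=> mg; apply/measurable_EFinP/measurable_funTS/measurable_funM.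
    apply: (measurableT_comp (measurable_powR q)).
    by apply: measurableT_comp => //; exact: measurable_funB.
  exact: measurable_wpow.
set r' := complex.Re (bmean b a r) in HR; set i' := complex.Im (bmean b a r) in HI.
apply: (@le_trans _ _ (\int[mu]_(x in eball a r) ((2 `^ q)%:E *
    ((`|complex.Re (b x) - r'| `^ q * u x)%:E + (`|complex.Im (b x) - i'| `^ q * u x)%:E)))%E).
  apply: le_integral_nonneg => x _.
    by rewrite lee_fin mulr_ge0 ?powR_ge0.
  rewrite -EFinD -EFinM lee_fin -mulrDl mulrA ler_wpM2r ?powR_ge0//.
  apply: le_trans (powRD_le (ltW q0) (normr_ge0 _) (normr_ge0 _)).
  apply: powR_homo; rewrite ?normc_ge0 ?(ltW q0)//.
  apply: le_trans (normc_le _) _.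
  by rewrite le_eqVlt; apply/orP; left; apply/eqP; rewrite /r' /i';
    case: (b x) (bmean b a r) => [? ?] [? ?].
have ge0 (z : R) x : (0 <= (`|z| `^ q * u x)%:E)%E.
  by rewrite lee_fin mulr_ge0 ?powR_ge0.
rewrite ge0_integralZl//; first last.
- by move=> x _; apply: adde_ge0; exact: ge0.
- by apply: emeasurable_funD; exact: mdev.
rewrite ge0_integralD//; [|exact: mdev|exact: mdev].
have U0 : 0 <= \int[mu]_(x in eball a r) u x.
  by apply: Rintegral_ge0 => x _; exact: wpow_ge0.
have Wq : W a r `^ q = \int[mu]_(x in eball a r) u x.
  by rewrite /target_size -powRrM mulVf ?gt_eqF// powRr1.
apply: (@le_trans _ _ ((2 `^ q)%:E * ((Cu * A `^ q * W a r `^ q)%:E +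
    (Cu * A `^ q * W a r `^ q)%:E))%E).
  apply: lee_wpmul2l; first by rewrite lee_fin powR_ge0.
  by rewrite Wq; exact: leeD HR HI.
rewrite -EFinD -EFinM lee_fin powRM ?(ltW A0) ?(ltW (W_gt0 a r0))//.
by rewrite le_eqVlt; apply/orP; left; apply/eqP; ring.
Qed.

(** On the shell of radius [2^(j+1) r] the distance of [b] to its mean on the
    small ball is its oscillation there plus a multiple of [j + 1]; the factor
    [l j] of the dyadic sum grows at this rate. *)
Lemma far_commutator_bound : exists2 K : R, 0 <= K & forall b (A : R) a r f M,
  BMO b -> 0 < A -> (bmo_norm b <= A%:E)%E -> 0 < r -> 0 < M ->
  cmeasurable setT f -> (Morrey1 f <= M%:E)%E -> forall x, eball a r x ->
  converges k al (fun y => (b y - bmean b a r) * far a r f y) x /\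
  normc (N (fun y => (b y - bmean b a r) * far a r f y) x) <= K * A * M * psi2 a r.
Proof.
have [Kt Kt0 tail] := frac_power_tail mk alN gb.
have step0 : 0 < step by rewrite ltr_pwDl// exprn_ge0// mulr_ge0.
set K3 := 2 * (K2 + step * K1).
have K30 : 0 < K3 by rewrite mulr_gt0// addr_gt0// mulr_gt0.
pose K4 := 2 `^ (n%:R - al) * D * M0 * (K3 / c).
have K40 : 0 <= K4.
  have K3c : 0 <= K3 / c by rewrite divr_ge0// ltW.
  exact: (mulr_ge0 (mulr_ge0 (mulr_ge0 (powR_ge0 _ _) (ltW D0)) M00) K3c).
exists (Kt * K4) => [|b A a r f M bB A0 bA r0 Mp mf fM]; first by rewrite mulr_ge0// ltW.
have mfar := cmeasurable_far a r mf.
have mb : cmeasurable setT b by case: bB.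
have mbm : cmeasurable setT (fun y => b y - bmean b a r).
  by apply: cmeasurableB => //; exact: cmeasurable_cst.
have mh := cmeasurableM mbm mfar.
rewrite -3!mulrA; apply: tail => //.
- by move=> y /far_eq0 ->; rewrite mulr0.
- exact: (mulr_ge0 K40 (mulr_ge0 (ltW A0) (mulr_ge0 (ltW Mp) (ltW (psi2_gt0 a r0))))).
have Q0 : 0 <= K3 * A * M / c.
  exact: (divr_ge0 (mulr_ge0 (mulr_ge0 (ltW K30) (ltW A0)) (ltW Mp)) (ltW c0)).
have := tail_bound aln W_gt0 src_ge0 D0 W_double l_gt0 dyadic r0 Q0
  (measurable_normc mh) (fun y => normc_ge0 _).
move=> /(_ a).
rewrite (_ : 2 `^ _ * D * M0 * (K3 * A * M / c) * psi2 a r =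
  K4 * (A * (M * psi2 a r))); last by rewrite /K4; ring.
apply; first by move=> y By; rewrite far_eq0// mulr0 normc0.
move=> j _; rewrite /=.
have t0 := pow2_gt0 j.+1 r0; set t := 2 ^+ j.+1 * r in t0 *.
have mB := measurable_eball a t.
have [ri ii mr mi] := BMO_parts bB; have [ro io] := BMO_oscillation bB bA.
have MS0 : 0 <= M * src a t by rewrite mulr_ge0 ?src_ge0// ltW.
have fB := Morrey_ball a t0 Mp mf fM.
have IR := osc_bound ri mr A0 ro t0 mf MS0 fB.
have II := osc_bound ii mi A0 io t0 mf MS0 fB.
have I1 := average_bound t0 mf MS0 fB.
set r' := complex.Re (bmean b a t) in IR; set i' := complex.Im (bmean b a t) in II.
have mnf := measurable_normc mf.
have mdev (g : Rn -> R) (m : R) : measurable_fun setT g ->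
    measurable_fun (eball a t) (fun x => (`|g x - m| * normc (f x))%:E).
  move=> mg; apply/measurable_EFinP/measurable_funTS/measurable_funM => //.
  by apply: measurableT_comp => //; exact: measurable_funB.
have mnf' : measurable_fun (eball a t) (fun x => (normc (f x))%:E).
  exact/measurable_EFinP/measurable_funTS.
set s := 2 * j.+1%:R * step * A.
have s0 : 0 <= s by rewrite /s !mulr_ge0 ?(ltW A0) ?(ltW step0).
have ge0 (z : R) x : (0 <= (`|z| * normc (f x))%:E)%E.
  by rewrite lee_fin mulr_ge0 ?normc_ge0.
apply: (@le_trans _ _ (\int[mu]_(x in eball a t) (
    (`|complex.Re (b x) - r'| * normc (f x))%:E + (`|complex.Im (b x) - i'| * normc (f x))%:E
    + s%:E * (normc (f x))%:E))%E).
  apply: le_integral_nonneg => x _; first by rewrite lee_fin normc_ge0.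
  rewrite -EFinM -!EFinD lee_fin -!mulrDl Normc.normcM; apply: ler_pM.
  - exact: normc_ge0.
  - exact: normc_ge0.
  - exact: mean_chain.
  - exact: normc_crestrict.
rewrite ge0_integralD//; first last.
- by apply: measurable_funeM.
- by move=> x _; rewrite mule_ge0// lee_fin normc_ge0.
- by apply: emeasurable_funD; exact: mdev.
- by move=> x _; apply: adde_ge0; exact: ge0.
rewrite ge0_integralD//; [|exact: mdev|exact: mdev].
rewrite ge0_integralZl//; last by move=> x _; rewrite lee_fin normc_ge0.
apply: le_trans (leeD (leeD IR II) (lee_wpmul2l _ I1)) _; first by rewrite lee_fin.
have Wt := W_gt0 a t0; have sr0 := src_ge0 a t0.
rewrite -EFinM -!EFinD lee_fin.
have Z0 : 0 <= t `^ (n%:R - al) / W a t by rewrite divr_ge0 ?powR_ge0// ltW.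
have lj := l_lin j.+1.
move: (t `^ _ / _) Z0 (src a t) sr0 => Z Z0 S S0.
have -> : K2 * A * (M * S) * Z + K2 * A * (M * S) * Z + s * (K1 * (M * S) * Z) =
    (K2 + j.+1%:R * step * K1) * (2 * A * M * S * Z) by rewrite /s; ring.
have -> : K3 * A * M / c * l j.+1 * S * Z = (K3 / 2 * (l j.+1 / c)) * (2 * A * M * S * Z).
  by field; rewrite gt_eqF.
apply: ler_wpM2r; first by rewrite !mulr_ge0// ltW.
have {}lj : 1 + j.+1%:R <= l j.+1 / c by rewrite ler_pdivlMr// mulrC.
apply: (@le_trans _ _ (K3 / 2 * (1 + j.+1%:R))); last first.
  by apply: ler_wpM2l => //; rewrite divr_ge0// ltW.
have -> : K3 / 2 = K2 + step * K1 by rewrite /K3 mulrAC divff ?mul1r.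
have j0 : 0 <= j.+1%:R :> R by [].
have : 0 <= K2 * j.+1%:R + step * K1.
  by rewrite addr_ge0// mulr_ge0// ltW.
by rewrite -subr_ge0 => H; rewrite -subr_ge0; apply: le_trans H _; rewrite le_eqVlt; apply/orP; left; apply/eqP; ring.
Qed.

Local Notation Lp1 := (Lpw_norm p omega setT).
Local Notation Lq2 := (Lpw_norm q u setT).

Lemma mul_crestrict b E f :
  b \* crestrict E f = crestrict E (b \* f) :> (Rn -> R[i]).
Proof.
by apply/funext => x /=; rewrite /crestrict mulrCA.
Qed.

Lemma converges_mul_far b a r f x (z : R[i]) : converges k al (far a r f) x ->
  converges k al (fun y => (b y - z) * far a r f y) x ->
  converges k al (far a r (b \* f)) x /\
  N (far a r (b \* f)) x = z * N (far a r f) x + N (fun y => (b y - z) * far a r f y) x.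
Proof.
move=> cf cb; have := converges_lin z cf cb.
suff -> : (fun y => z * far a r f y + (b y - z) * far a r f y) = far a r (b \* f) by [].
rewrite -mul_crestrict; apply/funext => y /=.
by rewrite mulrBl addrCA subrr addr0.
Qed.

Let commutator_algebra (bx z n1 n2 nb nf : R[i]) :
  bx * (n1 + n2) - (nb + (z * n2 + nf)) = bx * n1 - nb + (bx - z) * n2 - nf.
Proof. by ring. Qed.

(** Replacing [b] by [b - z] does not change a commutator; only the far part is
    rewritten in this way. *)
Lemma commutator_split b a r f x (z : R[i]) :
  converges k al (near a r f) x -> converges k al (near a r (b \* f)) x ->
  converges k al (far a r f) x ->
  converges k al (fun y => (b y - z) * far a r f y) x ->
  [/\ converges k al f x, converges k al (b \* f) x &
      commutator b N f x = commutator b N (near a r f) x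
        + (b x - z) * N (far a r f) x - N (fun y => (b y - z) * far a r f y) x].
Proof.
move=> c1 c2 c3 c4; have [c5 e5] := converges_mul_far c3 c4.
have [c6 e6] := converges_split c1 c3; have [c7 e7] := converges_split c2 c5.
split; [exact: c6|exact: c7|].
have comm g : commutator b N g x = b x * N g x - N (b \* g) x by [].
by rewrite !comm e6 e7 e5 mul_crestrict; exact: commutator_algebra.
Qed.

(** The constants are uniform in [b]: the estimate holds for every majorant [A]
    of its seminorm, linearly in [A], and the seminorm may vanish. *)
Lemma commutator_Morrey_bound (C : R) : 0 < C -> exists2 C' : R, 0 < C' &
  forall b, BMO b ->
    bounded_by (C%:E * bmo_norm b)%E Lp1 Lq2 (commutator b N) ->
    bounded_by (C'%:E * bmo_norm b)%E Morrey1 Morrey2 (commutator b N).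
Proof.
move=> C0; have [Kn Kn0 Hn] := near_norm; have [Kf Kf0 Hf] := far_bound.
have [Kc Kc0 Hc] := far_commutator_bound.
have qV0 : 0 < q^-1 by rewrite invr_gt0.
pose J := (2 `^ q * 2 * Cu) `^ q^-1.
have J0 : 0 <= J by exact: powR_ge0.
pose K := 9 * (C * Kn + Kf * J + Kc).
have K0 : 0 <= K.
  by rewrite mulr_ge0// !addr_ge0// mulr_ge0// ltW.
exists (K + 1); first by rewrite ltr_wpDl.
move=> b bB Cb; have mb : cmeasurable setT b by case: bB.
have b0 : (0 <= bmo_norm b)%E.
  pose z : Rn := [tuple of nseq n (0 : measurableTypeR R)].
  apply: (@le_trans _ _ (avg (fun x => normc (b x - bmean b z 1)%R) z 1)).
    rewrite avgE// mule_ge0 ?integral_ge0// ?lee_fin ?invr_ge0 ?ltW ?ball_vol_gt0//.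
    by move=> x _; rewrite lee_fin normc_ge0.
  by apply: ereal_sup_ubound; exists (z, 1) => //=.
have bE : bmo_norm b = (fine (bmo_norm b))%:E.
  by rewrite fineK// ge0_fin_numE//; case: bB.
have KK0 : 0 <= K + 1 by rewrite addr_ge0.
have ball (A : R) : fine (bmo_norm b) < A ->
    bounded_by ((K + 1) * A)%:E Morrey1 Morrey2 (commutator b N).
  move=> hA; have A0 : 0 < A by apply: le_lt_trans hA; rewrite fine_ge0.
  have bA : (bmo_norm b <= A%:E)%E by rewrite bE lee_fin ltW.
  apply: (@bounded_by_of_balls (commutator b N) (fun a r => Lpw_norm q u (eball a r))).
    by rewrite mulr_ge0// ltW.
  move=> f M Mp mf fM.
  have mbf : cmeasurable setT (b \* f) := cmeasurableM mb mf.
  have mCg g : cmeasurable setT g -> cmeasurable setT (commutator b N g).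
    move=> mg; apply: cmeasurableB; last first.
      by apply: cmeasurable_frac_power => //; exact: cmeasurableM.
    by apply: cmeasurableM => //; exact: cmeasurable_frac_power.
  have near_dom a r : 0 < r ->
      {ae mu, forall x, converges k al (near a r f) x /\ converges k al (near a r (b \* f)) x}.
    move=> r0; have mn := cmeasurable_near a r mf.
    have := le_lt_trans (Hn a r f M r0 Mp mf fM) (ltry _).
    move=> /(Cb _ mn)[[d1 d2] _ _ _]; rewrite -mul_crestrict.
    by apply: filterS2 d1 d2 => x.
  have split_ball a r : 0 < r -> {ae mu, forall x, eball a r x ->
      [/\ converges k al f x, converges k al (b \* f) x &
      commutator b N f x = commutator b N (near a r f) x
        + (b x - bmean b a r) * N (far a r f) x
        - N (fun y => (b y - bmean b a r) * far a r f y) x]}.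
    move=> r0; apply: filterS (near_dom a r r0) => x [c1 c2] Bx.
    have [c3 _] := Hf a r f M r0 Mp mf fM x Bx.
    have [c4 _] := Hc b A a r f M bB A0 bA r0 Mp mf fM x Bx.
    exact: commutator_split.
  split; [|exact: mCg|].
    pose z : Rn := [tuple of nseq n (0 : measurableTypeR R)].
    have : {ae mu, forall x, forall j : nat, eball z (2 ^+ j * 1) x ->
        converges k al f x /\ converges k al (b \* f) x}.
      apply/ae_foralln => j; have r0 := pow2_gt0 j (@ltr01 R).
      by apply: filterS (split_ball z _ r0) => x + Bx => /(_ Bx)[].
    move=> H; have {}H : {ae mu, forall x,
        converges k al f x /\ converges k al (b \* f) x}.
      apply: filterS H => x Hx.
      have [j _ Bx] : (\bigcup_j eball z (2 ^+ j * 1)) x by rewrite eball_cover.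
      exact: Hx Bx.
    by split; apply: filterS H => x [].
  move=> a r r0.
  have mn := cmeasurable_near a r mf; have mfar := cmeasurable_far a r mf.
  have P2 := psi2_gt0 a r0; have Wp := W_gt0 a r0; have mB := measurable_eball a r.
  have mbm : cmeasurable setT (fun y => b y - bmean b a r).
    by apply: cmeasurableB => //; exact: cmeasurable_cst.
  have mbfar := cmeasurableM mbm mfar.
  have mNfar := cmeasurable_frac_power al mk mfar.
  have mNbfar := cmeasurable_frac_power al mk mbfar.
  set X := Kn * M * psi2 a r * W a r.
  have X0 : 0 <= X by rewrite /X !mulr_ge0// ltW.
  have nX : (Lp1 (near a r f) <= X%:E)%E := Hn a r f M r0 Mp mf fM.
  have [_ _ _ nY] := Cb _ mn (le_lt_trans nX (ltry _)).
  have CAX0 : 0 <= C * A * X by rewrite !mulr_ge0// ltW.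
  have {}nY : (Lq2 (commutator b N (near a r f)) <= (C * A * X)%:E)%E.
    apply: le_trans nY _; rewrite EFinM; apply: lee_pmul => //.
    - by rewrite mule_ge0// lee_fin ltW.
    - exact: poweR_ge0.
    - by rewrite EFinM; apply: lee_wpmul2l => //; rewrite lee_fin ltW.
  set S := Kf * M * psi2 a r.
  have S0 : 0 <= S by rewrite /S !mulr_ge0// ltW.
  set S' := Kc * A * M * psi2 a r.
  have S'0 : 0 <= S' by rewrite /S' !mulr_ge0// ltW.
  have SJ0 : 0 <= S * (J * (A * W a r)) by rewrite !mulr_ge0// ltW.
  have SW0 : 0 <= S' * W a r by rewrite mulr_ge0// ltW.
  set Y := C * A * X + S * (J * (A * W a r)) + S' * W a r.
  have Y0 : 0 <= Y by rewrite !addr_ge0.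
  have mCn := mCg _ mn.
  have mpow (h : Rn -> R) D' : measurable_fun setT h ->
      measurable_fun D' (fun x => (h x `^ q * u x)%:E).
    move=> mh; apply/measurable_EFinP/measurable_funTS/measurable_funM.
      exact: (measurableT_comp (measurable_powR q)).
    exact: measurable_wpow.
  apply: (@le_trans _ _ (9 * Y)%:E).
    apply: (strong_combine mB q1 Y0 (measurable_wpow q mw2)
      (wpow_ge0 _ _) (mCg _ mf) (measurable_normc mCn)
      (measurable_normc (cmeasurableM mbm mNfar)) (measurable_normc mNbfar)).
    - by move=> x; exact: normc_ge0.
    - by move=> x; exact: normc_ge0.
    - by move=> x; exact: normc_ge0.
    - apply: filterS (split_ball a r r0) => x + Bx => /(_ Bx)[_ _ ->].
      apply: le_trans (normcB _ _) _; rewrite lerD2r; exact: normcD.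
    - have [/(_ nY) + _] := Lpw_norm_leP setT (commutator b N (near a r f))
        (wpow_ge0 w2 q) q0 CAX0.
      move=> H; apply: le_trans (_ : _ <= ((C * A * X) `^ q)%:E)%E _; last first.
        by rewrite lee_fin powR_homo ?(ltW q0)// /Y -addrA lerDl addr_ge0.
      apply: le_trans H; apply: ge0_subset_integral => //.
        exact: (mpow (fun x => normc (commutator b N (near a r f) x)) _ (measurable_normc mCn)).
      by move=> x _; rewrite lee_fin mulr_ge0 ?powR_ge0.
    - apply: le_trans (_ : _ <= ((S * (J * (A * W a r))) `^ q)%:E)%E _; last first.
        rewrite lee_fin powR_homo ?(ltW q0)// /Y addrAC lerDr.
        by rewrite addr_ge0.
      have HB := BMO_ball_norm a bB A0 bA r0.
      have Jq : J `^ q = 2 `^ q * 2 * Cu.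
        rewrite /J -powRrM mulVf ?gt_eqF// powRr1//.
        by rewrite !mulr_ge0 ?powR_ge0 ?(ltW Cu0).
      have AW0 : 0 <= A * W a r by rewrite mulr_ge0// ltW.
      apply: (@le_trans _ _ (\int[mu]_(x in eball a r)
          ((S `^ q)%:E * (normc (b x - bmean b a r) `^ q * u x)%:E))%E).
        apply: le_integral_nonneg => x Bx.
          by rewrite lee_fin mulr_ge0 ?powR_ge0.
        rewrite -EFinM lee_fin [X in _ <= X]mulrA; apply: ler_wpM2r; first exact: powR_ge0.
        rewrite -powRM// ?normc_ge0//; apply: powR_homo; rewrite ?(ltW q0) ?normc_ge0//.
        rewrite Normc.normcM mulrC ler_wpM2r ?normc_ge0//.
        by have [] := Hf a r f M r0 Mp mf fM x Bx.
      rewrite ge0_integralZl//; first last.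
      + by rewrite lee_fin powR_ge0.
      + by move=> x _; rewrite lee_fin mulr_ge0 ?powR_ge0.
      + exact: (mpow (fun x => normc (b x - bmean b a r)) _ (measurable_normc mbm)).
      rewrite (powRM _ S0 (mulr_ge0 J0 AW0)) (powRM _ J0 AW0) Jq EFinM.
      by apply: lee_wpmul2l => //; rewrite lee_fin powR_ge0.
    - apply: le_trans (_ : _ <= ((S' * W a r) `^ q)%:E)%E _; last first.
        by rewrite lee_fin powR_homo ?(ltW q0)// /Y lerDr addr_ge0.
      apply: bounded_ball_norm => //; first exact: measurable_normc.
        by move=> x; exact: normc_ge0.
      by move=> x Bx; have [] := Hc b A a r f M bB A0 bA r0 Mp mf fM x Bx.
  rewrite lee_fin /Y /X /S /S'.
  have -> : 9 * (C * A * (Kn * M * psi2 a r * W a r) +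
      Kf * M * psi2 a r * (J * (A * W a r)) + Kc * A * M * psi2 a r * W a r) =
    K * (A * M * psi2 a r * W a r) by rewrite /K; ring.
  have -> : (K + 1) * A * M * psi2 a r * W a r =
      K * (A * M * psi2 a r * W a r) + A * M * psi2 a r * W a r by ring.
  rewrite lerDl.
  by rewrite !mulr_ge0// ltW.
move=> f mf foo.
have [dC mC lC _] := ball _ (ltr_pwDr ltr01 (lexx (fine (bmo_norm b)))) f mf foo.
have fE : Morrey1 f = (fine (Morrey1 f))%:E by rewrite fineK// ge0_fin_numE// Morrey1_ge0.
have f0 : 0 <= fine (Morrey1 f) by rewrite fine_ge0// Morrey1_ge0.
split => //.
rewrite muleAC bE fE -!EFinM; apply: le_mul_of_majorants; first by rewrite mulr_ge0.
move=> A hA; have [_ _ _] := ball A hA f mf foo.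
by rewrite fE -EFinM mulrAC.
Qed.

End commutator.
End operator_on_Morrey.
(** * From the weight classes and the integral conditions to discrete bounds *)
Section discrete_hypotheses.
Context (R : realType) (n : nat).
Local Notation Rn := (Rn R n).
Local Notation mu := (leb R n).
Variables (p q : R) (w1 w2 : Rn -> R) (psi1 psi2 : Rn -> R -> R).

Lemma target_size_doubling (K th : R) : 0 < q -> 0 < K -> 0 < th ->
  ball_Ainf K th (wpow w2 q) ->
  exists2 D : R, 0 < D &
    forall a r, 0 < r -> target_size q w2 a (2 * r) <= D * target_size q w2 a r.
Proof.
move=> q0 K0 th0 uA; set c := (K * (2 * n.+1%:R) ^+ n) `^ th^-1.
have c0 : 0 < c by rewrite powR_gt0// mulr_gt0// exprn_gt0// mulr_gt0.
exists (c `^ q^-1); first exact: powR_gt0.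
move=> a r r0; have H := Ainf_doubling (wpow_ge0 w2 q) K0 th0 uA a r0.
have U0 z : 0 <= \int[mu]_(x in eball a z) wpow w2 q x.
  by apply: Rintegral_ge0 => x _; exact: wpow_ge0.
have qV0 : 0 <= q^-1 by rewrite invr_ge0 ltW.
have := powR_homo qV0 (U0 _) H.
by rewrite (powRM _ (ltW c0) (U0 r)).
Qed.

Hypotheses (W1 : weight w1) (W2 : weight w2) (p0 : 0 < p) (q0 : 0 < q).
Hypothesis ui : ball_integrable (wpow w2 q).
Hypothesis psi1_gt0 : forall a r, 0 < r -> 0 < psi1 a r.
Hypothesis psi2_gt0 : forall a r, 0 < r -> 0 < psi2 a r.

Let discrete (l : nat -> R) := exists2 M0 : R, 0 <= M0 &
  (forall a r J, 0 < r -> \sum_(1 <= j < J) l j / target_size q w2 a (2 ^+ j.+1 * r) *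
     source_size p w1 psi1 a (2 ^+ j * r) <= M0 * psi2 a r) /\
  (forall f a t M, 0 < t -> 0 < M -> cmeasurable setT f ->
     (Morrey_norm psi1 p (wpow w1 p) f <= M%:E)%E ->
     (Lpw_norm p (wpow w1 p) (eball a t) f <= (M * source_size p w1 psi1 a t)%:E)%E).

Lemma Morrey_condition_discrete : Morrey_condition psi1 psi2 p q w1 w2 ->
  discrete (fun=> 1).
Proof.
move=> cond; pose lam (r t : R) : R := 1.
have lam0 r t : 0 < r -> r < t -> 0 <= lam r t by move=> _ _; exact: ler01.
have l0 (j : nat) : 0 < 1 :> R by [].
have ll r t j : 0 < r -> 2 ^+ j * r < t <= 2 ^+ j.+1 * r -> 1 <= lam r t by [].
have cond' : (sup_balls (fun a r => (psi2 a r)^-1%:E *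
    \int[@lebesgue_measure R]_(t in `]r, +oo[)
      ((lam r t)%:E * psi_ratio psi1 p q w1 w2 a t * t^-1%:E)) < +oo)%E.
  move: cond; rewrite /Morrey_condition; congr (sup_balls _ < +oo)%E.
  apply/funext => a; apply/funext => r; congr (_ * _)%E.
  by apply: eq_integral => t _; rewrite mul1e.
have [M0 M00 H] := dyadic_sum W2 q0 ui psi1_gt0 psi2_gt0 lam0 l0 ll cond'.
exists M0 => //; split; first exact: H.
move=> f a t M t0 Mp mf fM.
exact: (Morrey_norm_ball W1 W2 p0 q0 ui psi1_gt0 psi2_gt0 lam0 l0 ll cond' a t0 Mp mf fM).
Qed.

(** On the [j]-th dyadic shell the logarithmic weight is at least [1 + j ln 2]. *)
Lemma log_Morrey_condition_discrete : log_Morrey_condition psi1 psi2 p q w1 w2 ->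
  exists2 c : R, 0 < c & discrete (fun j => c * (1 + j%:R)).
Proof.
move=> cond; pose c : R := Num.min 1 (ln 2).
have ln2 : 0 < ln 2 :> R by rewrite ln_gt0// ltr1n.
have c0 : 0 < c by rewrite lt_min ltr01.
exists c => //; pose lam (r t : R) : R := 1 + ln (t / r).
have lam0 r t : 0 < r -> r < t -> 0 <= lam r t.
  move=> r0 rt; rewrite addr_ge0// ltW// ln_gt0//.
  by rewrite ltr_pdivlMr// mul1r.
have l0 (j : nat) : 0 < c * (1 + j%:R) by rewrite mulr_gt0// ltr_pwDl.
have ll r t j : 0 < r -> 2 ^+ j * r < t <= 2 ^+ j.+1 * r -> c * (1 + j%:R) <= lam r t.
  move=> r0 /andP[jt _]; rewrite mulrDr mulr1 lerD// ?ge_min ?lexx//.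
  have p2 : 0 < 2 ^+ j :> R by rewrite exprn_gt0.
  have jt' : 2 ^+ j <= t / r by rewrite ler_pdivlMr// ltW.
  apply: (@le_trans _ _ (ln (2 ^+ j))); last first.
    by rewrite ler_ln ?posrE// (lt_le_trans p2).
  rewrite lnXn// -[ln 2 *+ j]mulr_natr; apply: ler_wpM2r => //.
  by rewrite ge_min lexx orbT.
have [M0 M00 H] := dyadic_sum W2 q0 ui psi1_gt0 psi2_gt0 lam0 l0 ll cond.
exists M0 => //; split; first exact: H.
move=> f a t M t0 Mp mf fM.
exact: (Morrey_norm_ball W1 W2 p0 q0 ui psi1_gt0 psi2_gt0 lam0 l0 ll cond a t0 Mp mf fM).
Qed.

End discrete_hypotheses.
Theorem theorem5p4 (R : realType) (n : nat) (alpha p q s : R)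
  (w1 w2 : Rn R n -> R)
  (L : operator R n) (T : R[i] -> (Rn R n -> R[i]) -> Rn R n -> R[i])
  (k : R -> Rn R n -> Rn R n -> R[i])
  (psi1 psi2 : Rn R n -> R -> R) :
  0 < alpha < n%:R ->
  1 <= p < n%:R / alpha ->
  q^-1 = p^-1 - alpha / n%:R ->
  (1 < p -> 1 <= s < p) ->
  (p = 1 -> s = 1) ->
  weight w1 -> weight w2 ->
  A_pq (p / s) (q / s) (wpow w1 s) (wpow w2 s) ->
  A_pq (p / s) (q / s) (wpow w2 s) (wpow w2 s) ->
  linear_op L -> analytic_semigroup T -> generates L T ->
  heat_kernel k T -> gaussian_bound k ->
  (forall a r, 0 < r -> 0 < psi1 a r) ->
  (forall a r, 0 < r -> 0 < psi2 a r) ->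
  let N := frac_power k alpha in
  (Morrey_condition psi1 psi2 p q w1 w2 ->
    (1 < p ->
      bounded (Lpw_norm p (wpow w1 p) setT)
              (Lpw_norm q (wpow w2 q) setT) N ->
      bounded (Morrey_norm psi1 p (wpow w1 p))
              (Morrey_norm psi2 q (wpow w2 q)) N) /\
    (p = 1 ->
      bounded (Lpw_norm 1 w1 setT) (WLpw_norm q (wpow w2 q) setT) N ->
      bounded (Morrey_norm psi1 1 w1)
              (WMorrey_norm psi2 q (wpow w2 q)) N)) /\
  (1 < p -> A_infty w1 -> log_Morrey_condition psi1 psi2 p q w1 w2 ->
    forall C : R, 0 < C -> exists2 C' : R, 0 < C' &
    forall b : Rn R n -> R[i], BMO b ->
      bounded_by (C%:E * bmo_norm b)%E
        (Lpw_norm p (wpow w1 p) setT) (Lpw_norm q (wpow w2 q) setT)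
        (commutator b N) ->
      bounded_by (C'%:E * bmo_norm b)%E
        (Morrey_norm psi1 p (wpow w1 p)) (Morrey_norm psi2 q (wpow w2 q))
        (commutator b N)).
Proof.
move=> alN /andP[p1 pn] qE sp s1 W1 W2 A12 A22 _ _ _ [mk _] gb psi1_gt0 psi2_gt0 N.
have /andP[al0 aln] := alN.
have n0 : 0 < n%:R :> R := lt_trans al0 aln.
have p0 : 0 < p := lt_le_trans ltr01 p1.
have qV0 : 0 < q^-1.
  rewrite qE subr_gt0 -[p^-1]mul1r ltr_pdivlMr// mulrAC ltr_pdivrMr// mul1r mulrC.
  by rewrite -ltr_pdivlMr.
have q0 : 0 < q by rewrite -invr_gt0.
have q1 : 1 <= q.
  rewrite -invf_le1// qE; apply: le_trans (_ : _ <= p^-1) _.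
    by rewrite gerBl divr_ge0// ltW.
  by rewrite invf_le1.
have expE : n%:R * (q^-1 + (1 - p^-1)) = n%:R - alpha.
  by rewrite qE; field; rewrite !gt_eqF.
have strong : 1 < p -> [/\ ball_integrable (wpow w2 q),
    exists2 K, 0 < K & exists2 th, 0 < th & ball_Ainf K th (wpow w2 q) &
    exists2 K1, 0 < K1 & forall a r f M, 0 < r -> cmeasurable setT f -> 0 <= M ->
      (Lpw_norm p (wpow w1 p) (eball a r) f <= M%:E)%E ->
      (\int[leb R n]_(x in eball a r) (Normc.normc (f x))%:E <=
        (K1 * M * (r `^ (n%:R - alpha) / target_size q w2 a r))%:E)%E].
  move=> p1'; have sp' := sp p1'.
  have [ui _] := ball_integrable_wpow W1 W2 p1' q0 sp' A12 A22.
  have [K K0 [uA _]] := Ainf_dual W1 W2 p1' q0 sp' A12 A22.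
  have [K1 K10 avg] := ball_integral_bound W1 W2 p1' q0 sp' A12 A22.
  have PV : (conj_exp p)^-1 = 1 - p^-1 by rewrite /conj_exp invrK.
  have P0 : 0 < (conj_exp p)^-1 by rewrite PV subr_gt0 invf_lt1.
  split => //.
    by exists K => //; eexists; [|exact: uA]; rewrite divr_gt0// addr_gt0.
  by exists K1 => // a r f M; have := avg a r f M; rewrite PV expE.
split=> [cond|p1' _ cond C C0].
  split=> [p1' Nb|pE Nb].
    have [ui [K K0 [th th0 uA]] [K1 K10 avg]] := strong p1'.
    have [D D0 dbl] := target_size_doubling q0 K0 th0 uA.
    have [M0 M00 [dy mb]] := Morrey_condition_discrete W1 W2 p0 q0 ui psi1_gt0 psi2_gt0 cond.
    exact: (strong_Morrey_bound mk alN gb W2 p0 q1 ui psi1_gt0 psi2_gt0 K10 avg D0 dbl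
      M00 ltr01 (fun=> lexx _) dy mb Nb).
  have w1E : wpow w1 1 = w1.
    by apply/funext => x; rewrite /wpow powRr1//; case: W1.
  have w2E : wpow w2 1 = w2.
    by apply/funext => x; rewrite /wpow powRr1//; case: W2.
  move: A12 A22 cond; rewrite (s1 pE) pE w1E w2E !divr1 => A12' A22' cond.
  have ui := ball_integrable_wpow1 q0 W2 A22'.
  have [K K0 uA] := Ainf_A1 q0 W2 A22'.
  have [K1 K10 avg] := ball_integral_bound1 q0 W1 W2 A12' A22'.
  have [D D0 dbl] := target_size_doubling q0 K0 ltr01 uA.
  have [M0 M00 [dy mb]] := Morrey_condition_discrete W1 W2 ltr01 q0 ui psi1_gt0 psi2_gt0 cond.
  have nq : n%:R * q^-1 = n%:R - alpha by rewrite -expE pE invr1 subrr addr0.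
  rewrite nq in avg; rewrite w1E in mb.
  have := @weak_Morrey_bound R n k alpha 1 q w1 w2 psi1 psi2 mk alN gb W2 ltr01 q1 ui
    psi1_gt0 psi2_gt0 K1 D M0 1 (fun=> 1) K10.
  rewrite w1E => H.
  exact: (H avg D0 dbl M00 ltr01 (fun=> lexx _) dy mb Nb).
have [ui [K K0 [th th0 uA]] [K1 K10 avg]] := strong p1'.
have [D D0 dbl] := target_size_doubling q0 K0 th0 uA.
have [c c0 [M0 M00 [dy mb]]] :=
  log_Morrey_condition_discrete W1 W2 p0 q0 ui psi1_gt0 psi2_gt0 cond.
have i0 : 'I_n by case: (n) n0 => [|m _]; [rewrite ltxx|exact: ord0].
have [K2 K20 osc] := ball_integral_osc_bound W1 W2 p1' q0 (sp p1') A12 A22 i0.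
have PV : (conj_exp p)^-1 = 1 - p^-1 by rewrite /conj_exp invrK.
rewrite PV expE in osc.
have uu a r : 0 < r -> \int[leb R n]_(x in eball a r) wpow w2 q x <=
    1 * \int[leb R n]_(x in eball a r) wpow w2 q x by move=> _; rewrite mul1r.
have [Cu Cu0 JN] := john_nirenberg_ball i0 (wpow_ge0 w2 q) ui K0 th0 uA
  (wpow_ge0 w2 q) ui ltr01 uu q0.
have lge j : c <= c * (1 + j%:R) by rewrite ler_peMr ?(ltW c0)// lerDl.
exact: (commutator_Morrey_bound mk alN gb W2 p0 q1 ui psi1_gt0 psi2_gt0 K10 avg D0 dbl
  M00 c0 lge dy mb K20 Cu0 osc JN (fun=> lexx _) C0).
Qed.
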